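(* Let $\Gamma\subset\mathbb{R}$ be a bounded closed set of Lebesgue measure zero, let $\mu$ be a Radon measure (finite positive regular Borel measure) whose support is $\Gamma$, and let $\beta:\Gamma\to\mathbb{R}$ be absolutely integrable with respect to $\mu$. Then the Schrödinger operator $L_{\Gamma,\beta}$ is self-adjoint on $L_2(\mathbb{R})$ and defines a $\delta'$-interaction on $\Gamma$. Moreover, the negative spectrum of $L_{\Gamma,\beta}$ is discrete.
   Context: Let $\Gamma,\mu,\beta$ be as in the claim. The space $W_2^2(\mathbb{R}\setminus\Gamma;d\mu)$: it consists of all $\psi$ in the Sobolev space $W_2^2(\mathbb{R}\setminus\Gamma)$ (with $\psi,\psi'$ taken continuous on $\mathbb{R}\setminus\Gamma$) for which there are $\mu$-integrable functions $f,g$ on $\Gamma$ such that for all $s<x$ in $\mathbb{R}\setminus\Gamma$ $$\psi(x)=\psi(s)+\int_s^x\psi'(\xi)\,d\xi+\int_{(s,x)}f(\xi)\,\mu(d\xi),\qquad \psi'(x)=\psi'(s)+\int_s^x\psi''(\xi)\,d\xi+\int_{(s,x)}g(\xi)\,\mu(d\xi).$$ One writes $\frac{d\psi}{d\mu}=f$, $\frac{d\psi'}{d\mu}=g$, and on $\Gamma$ sets $\psi_r(x)=\frac12[\psi(x+0)+\psi(x-0)]$, $\psi_r'(x)=\frac12[\psi'(x+0)+\psi'(x-0)]$. The operator $L_{\Gamma,\beta}$: its domain is the set of all $\psi\in W_2^2(\mathbb{R}\setminus\Gamma;d\mu)$ satisfying the boundary conditions $$\frac{d\psi'}{d\mu}(x)=0,\qquad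 \frac{d\psi}{d\mu}(x)=\beta(x)\,\psi_r'(x),\qquad x\in\Gamma$$ (as equalities $\mu$-almost everywhere), and $L_{\Gamma,\beta}\psi(x)=-\psi''(x)$ for $x\notin\Gamma$. The $\delta'$-interaction: let $L_{\min,\Gamma}\varphi=-\varphi''$ on $C_0^\infty(\mathbb{R}\setminus\Gamma)$, a symmetric operator in $L_2(\mathbb{R})$. A self-adjoint operator $A\supset L_{\min,\Gamma}$ with domain $\mathfrak{D}(A)$ defines (describes) a $\delta'$-interaction on $\Gamma$ if: (i) $u\in\mathfrak{D}(A)$ implies $\chi u\in\mathfrak{D}(A)$ for every $\chi\in C_0^\infty(\mathbb{R})$ with $\chi'\in C_0^\infty(\mathbb{R}\setminus\Gamma)$; (ii) for no $x_0\in\Gamma$ can $A$ be written as $A=A_1\oplus A_2$ with $A_1$ self-adjoint on $L_2(-\infty,x_0)$ and $A_2$ self-adjoint on $L_2(x_0,+\infty)$; (iii) every $\chi\in C_0^\infty(\mathbb{R})$ with $\chi'\in C_0^\infty(\mathbb{R}\setminus\Gamma)$ belongs to $\mathfrak{D}(A)$. The negative spectrum is discrete if the part of the spectrum in $(-\infty,0)$ consists of isolated eigenvalues of finite multiplicity. *)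

(* Defs.v *)
From HB Require Import structures.
From mathcomp Require Import all_boot all_order all_algebra.
From mathcomp Require Import all_classical all_reals all_analysis.
From mathcomp Require Import complex.

Set Implicit Arguments.
Unset Strict Implicit.
Unset Printing Implicit Defensive.

Import Order.TTheory GRing.Theory Num.Theory.
Import numFieldNormedType.Exports.

Local Open Scope classical_set_scope.
Local Open Scope ring_scope.
Local Open Scope complex_scope.

(** Complex-valued functions of a real variable: limits, derivatives and
    integrals are taken on the real and imaginary parts. *)

Definition re (T : Type) (R : realType) (u : T -> R[i]) : T -> R :=
  fun x => complex.Re (u x).
Definition im (T : Type) (R : realType) (u : T -> R[i]) : T -> R :=
  fun x => complex.Im (u x).

Definition cderiv (R : realType) (u : R -> R[i]) : R -> R[i] :=
  fun x => (re u)^`()%classic x +i* (im u)^`()%classic x.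

Definition clim (T : Type) (R : realType) (u : T -> R[i])
    (F : set_system T) : R[i] :=
  lim (re u @ F) +i* lim (im u @ F).

Definition cintegrable (d : measure_display) (T : measurableType d)
    (R : realType)
    (mu : {measure set T -> \bar R}) (D : set T) (u : T -> R[i]) : Prop :=
  mu.-integrable D (EFin \o re u) /\ mu.-integrable D (EFin \o im u).

Definition cintegral (d : measure_display) (T : measurableType d)
    (R : realType)
    (mu : {measure set T -> \bar R}) (D : set T) (u : T -> R[i]) : R[i] :=
  Rintegral mu D (re u) +i* Rintegral mu D (im u).

(** An element of [C_0^oo(Omega)], for [Omega] open, is represented by its
    extension by zero to the whole line. *)
Definition test_function (R : realType) (Omega : set R) (phi : R -> R[i]) :
    Prop :=
  [/\ forall n x, derivable (re phi)^`(n)%classic x 1,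
      forall n x, derivable (im phi)^`(n)%classic x 1,
      compact (closure [set x | phi x != 0]) &
      closure [set x | phi x != 0] `<=` Omega].

(** The Hilbert space [L_2(D)].  Its vectors are represented by functions
    [R -> R[i]], of which only the values on [D] matter, considered up to
    Lebesgue almost everywhere equality on [D]. *)

Definition sqnorm (R : realType) (D : set R) (u : R -> R[i]) : \bar R :=
  (\int[lebesgue_measure]_(x in D) ((re u x) ^+ 2 + (im u x) ^+ 2)%:E)%E.

Definition L2 (R : realType) (D : set R) (u : R -> R[i]) : Prop :=
  [/\ measurable_fun D (re u), measurable_fun D (im u) &
      (sqnorm D u < +oo)%E].

Definition eqL2 (R : realType) (D : set R) (u v : R -> R[i]) : Prop :=
  ae_eq lebesgue_measure D u v.

Definition inner (R : realType) (D : set R) (u v : R -> R[i]) : R[i] :=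
  cintegral lebesgue_measure D (fun x => u x * (v x)^*).

(** An operator in [L_2(D)] is represented by its graph: [A u v] means that
    [u] belongs to the domain of [A] and [A u = v]. *)

Definition operator (R : realType) := (R -> R[i]) -> (R -> R[i]) -> Prop.

Definition domain (R : realType) (A : operator R) (u : R -> R[i]) : Prop :=
  exists v, A u v.

Definition linear_operator (R : realType) (D : set R) (A : operator R) :
    Prop :=
  [/\ forall u v, A u v -> L2 D u /\ L2 D v,
      forall u v u' v', A u v -> L2 D u' -> L2 D v' ->
        eqL2 D u u' -> eqL2 D v v' -> A u' v',
      forall u v v', A u v -> A u v' -> eqL2 D v v',
      A (fun=> 0) (fun=> 0) &
      forall (a : R[i]) u v u' v', A u v -> A u' v' ->
        A (fun x => a * u x + u' x) (fun x => a * v x + v' x)].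

Definition densely_defined (R : realType) (D : set R) (A : operator R) :
    Prop :=
  forall u (e : R), L2 D u -> 0 < e ->
    exists2 w, domain A w & (sqnorm D (fun x => u x - w x)%R < e%:E)%E.

Definition adjoint (R : realType) (D : set R) (A : operator R) : operator R :=
  fun u v => [/\ L2 D u, L2 D v &
    forall w z, A w z -> inner D z u = inner D w v].

Definition selfadjoint (R : realType) (D : set R) (A : operator R) : Prop :=
  [/\ linear_operator D A, densely_defined D A &
      forall u v, A u v <-> adjoint D A u v].

(** [A - z] is injective with bounded inverse (the second clause) and onto. *)
Definition resolvent_set (R : realType) (D : set R) (A : operator R) :
    set R[i] :=
  [set z |
    (forall f, L2 D f ->
       exists u v, A u v /\ eqL2 D (fun x => v x - z * u x) f) /\
    (exists c : R, forall u v, A u v ->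
       (sqnorm D u <= c%:E * sqnorm D (fun x => v x - z * u x)%R)%E)].

Definition spectrum (R : realType) (D : set R) (A : operator R) : set R[i] :=
  ~` resolvent_set D A.

Definition eigenvector (R : realType) (D : set R) (A : operator R)
    (z : R[i]) (u : R -> R[i]) : Prop :=
  A u (fun x => z * u x) /\ ~ eqL2 D u (fun=> 0).

Definition finite_multiplicity (R : realType) (D : set R) (A : operator R)
    (z : R[i]) : Prop :=
  exists (n : nat) (e : 'I_n -> R -> R[i]), forall u, eigenvector D A z u ->
    exists c : 'I_n -> R[i], eqL2 D u (fun x => \sum_(j < n) c j * e j x).

Definition isolated_in (R : realType) (S : set R[i]) (z : R[i]) : Prop :=
  S z /\ exists2 e : R, 0 < e &
    forall w, S w -> `|w - z| < e%:C -> w = z.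

Definition discrete_negative_spectrum (R : realType) (D : set R)
    (A : operator R) : Prop :=
  forall l : R, l < 0 -> spectrum D A l%:C ->
    [/\ isolated_in (spectrum D A) l%:C,
        exists u, eigenvector D A l%:C u &
        finite_multiplicity D A l%:C].

Definition msupport (R : realType)
    (mu : {measure set (measurableTypeR R) -> \bar R}) : set R :=
  [set x | forall U : set R, open U -> U x -> (0 < mu U)%E].

Definition regular_measure (R : realType)
    (mu : {measure set (measurableTypeR R) -> \bar R}) : Prop :=
  forall A : set (measurableTypeR R), measurable A ->
    mu A = ereal_inf [set mu U | U in [set U : set R | open U /\ A `<=` U]] /\
    mu A = ereal_sup [set mu K | K in [set K : set R | compact K /\ K `<=` A]].

Definition weak_derivative (R : realType) (Omega : set R)
    (u u1 : R -> R[i]) : Prop :=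
  forall phi, test_function Omega phi ->
    cintegral lebesgue_measure Omega (fun x => u x * cderiv phi x) =
    - cintegral lebesgue_measure Omega (fun x => u1 x * phi x).

(** [psi] is in [W_2^2(R \ Gamma)], with [psi' = psi1] and [psi'' = psi2]. *)
Definition W22 (R : realType) (Gamma : set R) (psi psi1 psi2 : R -> R[i]) :
    Prop :=
  [/\ [/\ L2 (~` Gamma) psi, L2 (~` Gamma) psi1 & L2 (~` Gamma) psi2],
      weak_derivative (~` Gamma) psi psi1 /\
      weak_derivative (~` Gamma) psi1 psi2,
      {within ~` Gamma, continuous (re psi)} /\
      {within ~` Gamma, continuous (im psi)} &
      {within ~` Gamma, continuous (re psi1)} /\
      {within ~` Gamma, continuous (im psi1)}].

(** [f] is [d psi / d mu], where [psi1] is the classical part [psi'] of the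
    derivative of [psi]. *)
Definition mu_derivative (R : realType) (Gamma : set R)
    (mu : {measure set (measurableTypeR R) -> \bar R})
    (psi psi1 f : R -> R[i]) : Prop :=
  cintegrable mu Gamma f /\
  forall s x : R, ~ Gamma s -> ~ Gamma x -> s < x ->
    psi x = psi s + cintegral lebesgue_measure `]s, x[ psi1
                  + cintegral mu (`]s, x[ `&` Gamma) f.

(** [psi] is in [W_2^2(R \ Gamma; d mu)], with [d psi / d mu = f] and
    [d psi' / d mu = g]. *)
Definition W22mu (R : realType) (Gamma : set R)
    (mu : {measure set (measurableTypeR R) -> \bar R})
    (psi psi1 psi2 f g : R -> R[i]) : Prop :=
  [/\ W22 Gamma psi psi1 psi2,
      mu_derivative Gamma mu psi psi1 f &
      mu_derivative Gamma mu psi1 psi2 g].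

(** [psi_r]; the one-sided limits are taken along [R \ Gamma], where [psi] is
    defined. *)
Definition mean_value (R : realType) (Gamma : set R) (psi : R -> R[i])
    (x : R) : R[i] :=
  (clim psi (within (~` Gamma) x^'+) + clim psi (within (~` Gamma) x^'-)) / 2.

Definition L_op (R : realType) (Gamma : set R)
    (mu : {measure set (measurableTypeR R) -> \bar R}) (beta : R -> R) :
    operator R :=
  fun u v => [/\ L2 setT u, L2 setT v &
    exists psi psi1 psi2 f g : R -> R[i],
      [/\ W22mu Gamma mu psi psi1 psi2 f g,
          {ae mu, forall x, Gamma x -> g x = 0},
          {ae mu, forall x, Gamma x ->
             f x = (beta x)%:C * mean_value Gamma psi1 x},
          eqL2 (~` Gamma) u psi &
          eqL2 (~` Gamma) v (fun x => - psi2 x)]].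

Definition L_min (R : realType) (Gamma : set R) : operator R :=
  fun u v => [/\ L2 setT u, L2 setT v &
    exists phi, [/\ test_function (~` Gamma) phi,
      eqL2 setT u phi & eqL2 setT v (fun x => - cderiv (cderiv phi) x)]].

Definition cutoff (R : realType) (Gamma : set R) (chi : R -> R[i]) : Prop :=
  test_function setT chi /\ test_function (~` Gamma) (cderiv chi).

(** [A = A1 (+) A2] along [L_2(R) = L_2(-oo, x0) (+) L_2(x0, +oo)]: since the
    vectors of [L_2(D)] are functions on the line of which only the values on
    [D] matter, no restriction map has to be written. *)
Definition splits_at (R : realType) (A : operator R) (x0 : R) : Prop :=
  exists A1 A2 : operator R,
    [/\ selfadjoint `]-oo, x0[ A1, selfadjoint `]x0, +oo[ A2 &
        forall u v, A u v <-> A1 u v /\ A2 u v].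

Definition delta'_interaction (R : realType) (Gamma : set R)
    (A : operator R) : Prop :=
  [/\ selfadjoint setT A /\ (forall u v, L_min Gamma u v -> A u v),
      forall u chi, domain A u -> cutoff Gamma chi ->
        domain A (fun x => chi x * u x),
      forall x0, Gamma x0 -> ~ splits_at A x0 &
      forall chi, cutoff Gamma chi -> domain A chi].

(* Main.v *)
From HB Require Import structures.
Require Import Defs.
From mathcomp Require Import all_boot all_order all_algebra.
From mathcomp Require Import all_classical all_reals all_analysis.
From mathcomp Require Import measurable_realfun complex ring lra.

Set Implicit Arguments.
Unset Strict Implicit.
Unset Printing Implicit Defensive.

Import Order.TTheory GRing.Theory Num.Theory.
Import numFieldNormedType.Exports.

Local Open Scope classical_set_scope.
Local Open Scope ring_scope.
Local Open Scope complex_scope.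

(** The jump conditions say that the classical part of the derivative of a
    function [psi] in the domain has no singular part.  That derivative is
    therefore the restriction of a continuous function [P] on the whole line,
    the mean values on [Gamma] are the values of [P], and the operator becomes a
    first order system for a pair of functions: the derivative of [P] is
    [psi''], and the differential of [psi] is [P dx + beta P dmu]
    ([delta'_data]; the equivalence is [L_opE]).  The coefficients being real,
    real and imaginary parts can be treated separately.

    Symmetry is Green's formula.  For two solutions [(psi, P)] and [(phi, Q)] of
    such systems the singular parts of the differential of [P phi - Q psi]
    cancel, both being [beta P Q dmu]; and [P phi - Q psi], which is integrable,
    is small at suitable points near plus and minus infinity
    ([data_symmetric]).

    Surjectivity.  With [g x = exp (- k |x|) / (2 k)], the equation
    [- psi'' + k^2 psi = f] is solved by [psi = g * f - g' * (beta P mu)] as soon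
    as [P] satisfies on [Gamma] the integral equation
    [P = g' * f - k^2 g * (beta P mu)].  Its kernel is bounded by [k / 2] and
    [beta] is integrable, so for small [k] it is solved by iteration
    ([solve_small]).  A symmetric operator whose translate by one real number
    is onto is densely defined and self-adjoint ([domain_dense],
    [adjoint_sub]).

    The interaction is a [delta']-interaction: a cutoff which is locally
    constant near [Gamma] preserves the system ([cutoff_data]).  If the operator
    split at a point [x0] of [Gamma], the restriction to the right half-line of
    a vector of the domain would be in the domain; its [P] would vanish on the
    left of [x0] and agree with the original one on the right, whence
    [P x0 = 0] by continuity.  But the solution for the right-hand side
    [f y = g' (x0 - y)] has [P x0 <> 0], the free term [g' * f] of the integral
    equation being maximal at [x0] ([no_splitting]).

    Discreteness needs no compactness argument.  Below zero, at [- k^2] with [k]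
    arbitrary, the kernel [- k^2 g (x - y)] is the sum of a Volterra kernel,
    supported in [y <= x], and of the rank one kernel
    [- (k / 2) exp (k (x - y))].  A Volterra kernel becomes small after
    conjugation by an exponential, so the equation is solvable, with a bound,
    for all [f] annihilated by one linear functional ([solve_ker]).  For a
    self-adjoint operator this makes the eigenspace at most one-dimensional
    ([eigenspace_dim1]) and leaves a gap on its orthogonal complement
    ([spectral_gap]); hence the point is either in the resolvent set or an
    isolated eigenvalue ([regular_value], [isolated_eigenvalue]). *)

(** * Symmetric operators in a complex Hilbert space *)

(** The norm of [R[i]] has values in [R[i]]; this is its real counterpart. *)
Definition cabs (R : realType) (a : R[i]) : R :=
  Num.sqrt (complex.Re a ^+ 2 + complex.Im a ^+ 2).

Lemma cabs_ge0 (R : realType) (a : R[i]) : 0 <= cabs a.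
Proof. exact: sqrtr_ge0. Qed.

Lemma cabs_sqr (R : realType) (a : R[i]) :
  cabs a ^+ 2 = complex.Re a ^+ 2 + complex.Im a ^+ 2.
Proof. by rewrite sqr_sqrtr// addr_ge0// sqr_ge0. Qed.

Lemma conjcM_cabs (R : realType) (a : R[i]) : a^* * a = (cabs a ^+ 2)%:C.
Proof.
rewrite cabs_sqr; case: a => a b; apply/eqP; rewrite eq_complex /=.
by apply/andP; split; apply/eqP; ring.
Qed.

Lemma cabs_eq0 (R : realType) (a : R[i]) : cabs a = 0 -> a = 0.
Proof.
move=> a0; have : `|a| = 0 by rewrite normc_def -/(cabs a) a0.
exact: normr0_eq0.
Qed.

Lemma cabs_conj (R : realType) (a : R[i]) : cabs (Num.conj a) = cabs a.
Proof. by case: a => a b; rewrite /cabs /= sqrrN. Qed.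

(** The form [dot] is the real part of a scalar product.  Being real-valued it
    keeps all estimates in [R]; the complex structure enters only through
    [dotJ].  It may be degenerate, so that equality in the Hilbert space is the
    vanishing of [dot (u - v) (u - v)], and completeness is required for
    sequences converging at a geometric rate, which is enough below. *)
Section hilbert.
Variables (R : realType) (V : lmodType R[i]) (dot : V -> V -> R).
Hypothesis dotC : forall u v, dot u v = dot v u.
Hypothesis dotDl : forall u v w, dot (u + v) w = dot u w + dot v w.
Hypothesis dotJ : forall a u v, dot (a *: u) v = dot u (a^* *: v).
Hypothesis dotR : forall (r : R) u v, dot (r%:C *: u) v = r * dot u v.
Hypothesis dot_ge0 : forall u, 0 <= dot u u.

Let nrm u := Num.sqrt (dot u u).

#[local] Hint Resolve dot_ge0 : core.

Hypothesis complete : forall u_ : nat -> V,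
  (forall n, dot (u_ n.+1 - u_ n) (u_ n.+1 - u_ n) <= 4^-1 ^+ n) ->
  exists (u : V) (K : R), forall n, dot (u_ n - u) (u_ n - u) <= K * 4^-1 ^+ n.

Let dotDr u v w : dot u (v + w) = dot u v + dot u w.
Proof. by rewrite dotC dotDl !(dotC _ u). Qed.

Let dotNl u v : dot (- u) v = - dot u v.
Proof.
have -> : - u = (-1)%:C *: u by rewrite rmorphN1 scaleN1r.
by rewrite dotR mulN1r.
Qed.

Let dotNr u v : dot u (- v) = - dot u v.
Proof. by rewrite dotC dotNl dotC. Qed.

Let dotRr (r : R) u v : dot u (r%:C *: v) = r * dot u v.
Proof. by rewrite dotC dotR dotC. Qed.

Let dot0l v : dot 0 v = 0.
Proof. by rewrite -(scale0r v) -(rmorph0 (real_complex R)) dotR mul0r. Qed.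

Let dot0r v : dot v 0 = 0. Proof. by rewrite dotC. Qed.

Let dotE := (dotDl, dotDr, dotNl, dotNr, dotR, dotRr, dot0l, dot0r).

Let nrm_ge0 u : 0 <= nrm u. Proof. exact: sqrtr_ge0. Qed.

Let nrm_sqr u : nrm u ^+ 2 = dot u u.
Proof. by rewrite sqr_sqrtr. Qed.

Lemma cauchy_schwarz u v : `|dot u v| <= nrm u * nrm v.
Proof.
suff h : dot u v ^+ 2 <= dot u u * dot v v.
  rewrite -(ler_pXn2r (n := 2)) ?nnegrE ?mulr_ge0//.
  by rewrite real_normK ?num_real// exprMn !nrm_sqr.
have [v0|v0] := eqVneq (dot v v) 0.
  have [->|uv] := eqVneq (dot u v) 0; first by rewrite expr0n/= mulr_ge0.
  have := dot_ge0 (u - ((dot u u + 1) / (2 * dot u v))%:C *: v).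
  rewrite !dotE v0 (dotC v u).
  have -> : (dot u u + 1) / (2 * dot u v) * dot u v = (dot u u + 1) / 2.
    by field.
  by lra.
have vp : 0 < dot v v by rewrite lt_neqAle eq_sym v0 dot_ge0.
have := dot_ge0 (u - (dot u v / dot v v)%:C *: v).
rewrite !dotE (dotC v u).
rewrite (_ : _ + _ = dot u u - dot u v ^+ 2 / dot v v); last by field.
by rewrite subr_ge0 ler_pdivrMr.
Qed.

Lemma ler_nrmD u v : nrm (u + v) <= nrm u + nrm v.
Proof.
rewrite -(ler_pXn2r (n := 2)) ?nnegrE ?addr_ge0// sqrrD !nrm_sqr !dotE (dotC v u).
have := ler_norm (dot u v); have := cauchy_schwarz u v.
by lra.
Qed.

Lemma nrmZ a u : nrm (a *: u) = cabs a * nrm u.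
Proof.
apply/eqP; rewrite -(@eqrXn2 _ 2%N) ?mulr_ge0 ?cabs_ge0//; apply/eqP.
by rewrite exprMn !nrm_sqr dotJ scalerA conjcM_cabs dotRr.
Qed.

Lemma nrmN u : nrm (- u) = nrm u.
Proof. by rewrite /nrm dotNl dotNr opprK. Qed.

Lemma nrm_le_sqr u (x : R) : 0 <= x -> dot u u <= x ^+ 2 -> nrm u <= x.
Proof. by move=> x0; rewrite -nrm_sqr ler_pXn2r// nnegrE. Qed.

Lemma nrm_eq0 u : nrm u <= 0 -> dot u u = 0.
Proof.
by move=> u0; rewrite -nrm_sqr (_ : nrm u = 0) ?expr0n//; apply/le_anti/andP.
Qed.

Lemma nrm0_dot u v : dot u u = 0 -> dot u v = 0.
Proof.
move=> u0; have := cauchy_schwarz u v.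
by rewrite {1}/nrm u0 sqrtr0 mul0r normr_le0 => /eqP.
Qed.

Let half_expn n : (2^-1 : R) ^+ n.*2 = 4^-1 ^+ n.
Proof. by rewrite -mul2n exprM; congr (_ ^+ _); field. Qed.

Lemma geometric_le0 (x K : R) : (forall n, x <= K * 2^-1 ^+ n) -> x <= 0.
Proof.
move=> h; apply/ler_addgt0Pr => e e0; rewrite add0r.
have : (fun n => K * 2^-1 ^+ n) @ \oo --> K * 0.
  by apply: cvgMr; apply: cvg_expr; rewrite ger0_norm; lra.
rewrite mulr0 => /cvgrPdist_lt/(_ e e0)[N _ /(_ N (leqnn N))] /=.
rewrite sub0r normrN => hN.
exact: (le_trans (h N) (le_trans (ler_norm _) (ltW hN))).
Qed.

Lemma complete_nrm (u_ : nat -> V) (c : R) :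
  (forall n, nrm (u_ n.+1 - u_ n) <= c * 2^-1 ^+ n) ->
  exists (u : V) (K : R), forall n, nrm (u_ n - u) <= K * 2^-1 ^+ n.
Proof.
move=> hu.
pose k := Num.max c 1.
have k0 : 0 < k by rewrite lt_max ltr01 orbT.
have := @complete (fun n => (k^-1)%:C *: u_ n).
case=> [n|u [K hK]].
  rewrite -scalerBr dotR dotRr mulrA -nrm_sqr -half_expn -mul2n mulnC exprM.
  rewrite -expr2 -exprMn ler_pXn2r ?nnegrE ?mulr_ge0 ?invr_ge0 ?(ltW k0)//.
    by rewrite mulrC ler_pdivrMr// mulrC (le_trans (hu n))//
       ler_wpM2r ?exprn_ge0// le_max lexx.
have K0 : 0 <= K by have := le_trans (dot_ge0 _) (hK 0%N); rewrite expr0 mulr1.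
exists (k%:C *: u), (k * Num.sqrt K) => n.
apply: nrm_le_sqr; first by rewrite !mulr_ge0 ?sqrtr_ge0 ?exprn_ge0 ?(ltW k0).
have -> : u_ n - k%:C *: u = k%:C *: ((k^-1)%:C *: u_ n - u).
  by rewrite scalerBr scalerA -rmorphM /= divff ?gt_eqF// scale1r.
rewrite dotR dotRr mulrA -expr2 !exprMn sqr_sqrtr// -exprM muln2 half_expn -mulrA.
by rewrite ler_wpM2l ?sqr_ge0//; exact: hK.
Qed.

(** The projection theorem, for a subspace [S] that need not be closed: the
    projection is only a limit of elements of [S]. *)
Lemma projection (S : V -> Prop) (f : V) :
  S 0 -> (forall a u v, S u -> S v -> S (a *: u + v)) ->
  exists (y : V) (w_ : nat -> V) (K : R), [/\ forall n, S (w_ n),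
    forall n, nrm (w_ n - y) <= K * 2^-1 ^+ n &
    forall w, S w -> dot (f - y) w = 0].
Proof.
move=> S0 SL.
pose D := [set dot (f - w) (f - w) | w in [set w | S w]].
have D0 : D !=set0 by exists (dot (f - 0) (f - 0)), 0.
have lD : has_lbound D by exists 0 => _ [w _ <-]; exact: dot_ge0.
pose d := inf D.
have dle w : S w -> d <= dot (f - w) (f - w).
  by move=> Sw; apply: ge_inf => //; exists w.
have e0 n : 0 < (4^-1 : R) * 4^-1 ^+ n by rewrite mulr_gt0// ?exprn_gt0.
have hw n : exists w, S w /\ dot (f - w) (f - w) < d + 4^-1 * 4^-1 ^+ n.
  have [_ [w Sw <-] hw] := @inf_adherent _ D _ (e0 n) (conj D0 lD).
  by exists w.
pose w_ n := projT1 (cid (hw n)).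
have wS n : S (w_ n) by rewrite /w_; case: cid => w [].
have wd n : dot (f - w_ n) (f - w_ n) < d + 4^-1 * 4^-1 ^+ n.
  by rewrite /w_; case: cid => w [].
have SR (r : R) u v : S u -> S v -> S (r%:C *: u + v) by exact: SL.
have [n|y [K hK]] := @complete_nrm w_ 1.
  apply: nrm_le_sqr; first by rewrite mul1r exprn_ge0.
  rewrite mul1r -exprM muln2 half_expn.
  have Sm : S ((2^-1)%:C *: w_ n.+1 + ((2^-1)%:C *: w_ n + 0)).
    by apply: (SL) => //; exact: SL.
  have := dle _ Sm; have := wd n; have := wd n.+1.
  rewrite addr0 exprS !dotE (dotC (w_ n) (w_ n.+1)) (dotC (w_ _) f).
  rewrite (dotC (w_ n) f).
  have : 0 < (4^-1 : R) ^+ n by rewrite exprn_gt0.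
  by lra.
exists y, w_, K; split => // w Sw.
have orth n : `|dot (f - w_ n) w| <= (2^-1 * nrm w) * 2^-1 ^+ n.
  rewrite -(ler_pXn2r (n := 2)) ?nnegrE ?mulr_ge0 ?exprn_ge0//.
  rewrite real_normK ?num_real// !exprMn nrm_sqr -exprM muln2 half_expn.
  set x := dot _ w.
  have h t : d <= dot (f - w_ n) (f - w_ n) - 2 * t * x + t ^+ 2 * dot w w.
    have := dle _ (SR t w (w_ n) Sw (wS n)).
    rewrite /x !dotE (dotC w f) (dotC w (w_ n)) (dotC (w_ n) f).
    set a := dot f f; set b := dot f (w_ n); set c := dot f w.
    by set e := dot (w_ n) w; set g := dot w w; set k := dot (w_ n) (w_ n); lra.
  have h' t : 2 * t * x <= 4^-1 * 4^-1 ^+ n + t ^+ 2 * dot w w.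
    by have := h t; have := wd n; lra.
  have [w0|w0] := eqVneq (dot w w) 0.
    have [->|x0] := eqVneq x 0; first by rewrite expr0n/= w0 mulr0 mul0r.
    have := h' ((4^-1 * 4^-1 ^+ n + 1) / (2 * x)).
    have -> : 2 * ((4^-1 * 4^-1 ^+ n + 1) / (2 * x)) * x = 4^-1 * 4^-1 ^+ n + 1.
      by field.
    by rewrite w0 mulr0 addr0; lra.
  have wp : 0 < dot w w by rewrite lt_neqAle eq_sym w0 dot_ge0.
  have := h' (x / dot w w).
  rewrite (_ : 2 * (x / dot w w) * x = 2 * (x ^+ 2 / dot w w)); last by field.
  rewrite (_ : _ ^+ 2 * dot w w = x ^+ 2 / dot w w); last by field.
  move=> hh; have : x ^+ 2 / dot w w <= 4^-1 * 4^-1 ^+ n by lra.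
  rewrite ler_pdivrMr// => /le_trans; apply.
  by rewrite (_ : 2^-1 ^+ 2 = 4^-1 :> R) -?mulrA ?(mulrC (dot w w))//; field.
suff : `|dot (f - y) w| <= 0 by rewrite normr_le0 => /eqP.
apply: (@geometric_le0 _ (2^-1 * nrm w + K * nrm w)) => n.
have -> : f - y = (f - w_ n) + (w_ n - y) by rewrite addrA subrK.
rewrite dotDl (le_trans (ler_normD _ _))// mulrDl lerD//.
rewrite (le_trans (cauchy_schwarz _ _))// mulrAC.
by rewrite ler_wpM2r.
Qed.

Section operator.
Variables (A : V -> V -> Prop) (l0 : R).
Hypothesis AL : forall a u v u' v',
  A u v -> A u' v' -> A (a *: u + u') (a *: v + v').
Hypothesis Aeq : forall u v u' v', A u v ->
  dot (u - u') (u - u') = 0 -> dot (v - v') (v - v') = 0 -> A u' v'.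
Hypothesis Asv : forall u v, A u v -> dot u u = 0 -> dot v v = 0.
Hypothesis Asym : forall u v w z, A u v -> A w z -> dot v w = dot u z.
Hypothesis Aonto : forall f, exists u, A u (f + l0%:C *: u).

Let A0 : A 0 0.
Proof.
have [u Au] := Aonto 0.
by have := AL (-1) Au Au; rewrite !scaleN1r !addNr.
Qed.

Let AB u v u' v' : A u v -> A u' v' -> A (u - u') (v - v').
Proof.
move=> Au Au'; have := AL (-1) Au' Au.
by rewrite !scaleN1r ![- _ + _]addrC.
Qed.

Let orth0 u : (forall h, dot h u = 0) -> dot u u = 0. Proof. exact. Qed.

(** If [w] solves the equation that [u] should satisfy, then [u - w] is
    orthogonal to the range of [A - l0], which is everything. *)
Lemma adjoint_sub u v : (forall w z, A w z -> dot z u = dot w v) -> A u v.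
Proof.
move=> adj.
have [w Aw] := Aonto (v - l0%:C *: u).
have uw : dot (u - w) (u - w) = 0.
  apply: orth0 => h; have [w' Aw'] := Aonto h.
  have := adj _ _ Aw'; have := Asym Aw' Aw.
  by rewrite !dotE; lra.
apply: Aeq Aw _ _.
  by rewrite -opprB dotNl dotNr opprK.
have -> : v - l0%:C *: u + l0%:C *: w - v = (- l0)%:C *: (u - w).
  by rewrite rmorphN scaleNr scalerBr opprB addrAC [v - _ - _]addrAC subrr add0r
    addrC.
by rewrite dotR dotRr uw !mulr0.
Qed.

(** Solving the equation for [f - y], where [y] is the projection of [f] on the
    closure of the domain, gives an element of the domain whose image under
    [A - l0] is orthogonal to the domain; by symmetry that element is orthogonal
    to the range of [A - l0], so it vanishes, and [f - y] with it. *)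
Lemma domain_dense f e : 0 < e ->
  exists2 w, (exists z, A w z) & dot (f - w) (f - w) < e.
Proof.
move=> e0.
have [||y [w_ [K [wS wy orth]]]] := @projection (fun u => exists z, A u z) f.
- by exists 0.
- by move=> a u v [z Au] [z' Av]; exists (a *: z + z'); exact: AL.
have [u0 Au0] := Aonto (f - y).
have u00 : dot u0 u0 = 0.
  have [w Aw] := Aonto u0.
  have := orth w (ex_intro _ _ Aw); have := Asym Au0 Aw.
  by rewrite !dotE; lra.
have fy : dot (f - y) (f - y) = 0.
  have := Asv Au0 u00; move: (f - y) => g.
  rewrite !dotE u00 (dotC g u0) !(nrm0_dot _ u00).
  by lra.
have K0 : 0 <= K.
  by have := le_trans (nrm_ge0 _) (wy 0%N); rewrite expr0 mulr1.
have : (fun n => K * 2^-1 ^+ n) @ \oo --> K * 0.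
  by apply: cvgMr; apply: cvg_expr; rewrite ger0_norm; lra.
have se0 : 0 < Num.sqrt e by rewrite sqrtr_gt0.
rewrite mulr0 => /cvgrPdist_lt/(_ _ se0)[N _ /(_ N (leqnn N))] /=.
rewrite sub0r normrN => hN; exists (w_ N) => //.
have -> : f - w_ N = (f - y) - (w_ N - y).
  by rewrite opprB addrA subrK.
move: (f - y) fy (w_ N - y) (wy N) => g g0 x xN.
rewrite !dotE (dotC x g) !(nrm0_dot _ g0) !sub0r !oppr0 ?add0r opprK -nrm_sqr -(sqr_sqrtr (ltW e0)) ltr_pXn2r// ?nnegrE//.
by rewrite (le_lt_trans xN)// (le_lt_trans (ler_norm _)).
Qed.

(** The symmetry relation passes to the limit, so a limit of the graph lies in
    the adjoint. *)
Lemma graph_closed u_ v_ u v (K : R) : (forall n, A (u_ n) (v_ n)) ->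
  (forall n, nrm (u_ n - u) <= K * 2^-1 ^+ n) ->
  (forall n, nrm (v_ n - v) <= K * 2^-1 ^+ n) -> A u v.
Proof.
move=> Auv hu hv; apply: adjoint_sub => w z Aw.
suff : `|dot z u - dot w v| <= 0 by rewrite normr_le0 subr_eq0 => /eqP.
apply: (@geometric_le0 _ (K * nrm z + K * nrm w)) => n.
have -> : dot z u - dot w v = dot w (v_ n - v) - dot z (u_ n - u).
  by have := Asym Aw (Auv n); rewrite !dotE; lra.
rewrite (le_trans (ler_normB _ _))// addrC mulrDl lerD//.
  by rewrite (le_trans (cauchy_schwarz _ _))// mulrAC mulrC ler_wpM2r.
by rewrite (le_trans (cauchy_schwarz _ _))// mulrAC mulrC ler_wpM2r.
Qed.

(** The range of [A - z] is closed because of the bound, and dense because its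
    orthogonal complement is the kernel of [A - z^*]. *)
Lemma range_full (z : R[i]) (c : R) :
  (forall u v, A u v -> nrm u <= c * nrm (v - z *: u)) ->
  (forall u, A u (z^* *: u) -> dot u u = 0) ->
  forall f, exists u, A u (f + z *: u).
Proof.
move=> bnd inj f.
pose d := Num.max c 0; have d0 : 0 <= d by rewrite le_max lexx orbT.
have {}bnd u v : A u v -> nrm u <= d * nrm (v - z *: u).
  by move=> /bnd/le_trans; apply; rewrite ler_wpM2r// le_max lexx.
have [||y [w_ [K [wS wy orth]]]] :=
  @projection (fun f => exists u, A u (f + z *: u)) f.
- by exists 0; rewrite scaler0 addr0.
- move=> a u v [x Ax] [x' Ax']; exists (a *: x + x').
  suff -> : a *: u + v + z *: (a *: x + x') = a *: (u + z *: x) + (v + z *: x').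
    exact: AL.
  by rewrite !scalerDr !scalerA (mulrC z) addrACA.
have g0 : dot (f - y) (f - y) = 0.
  apply: inj; apply: adjoint_sub => u v Au.
  have : exists u', A u' (v - z *: u + z *: u') by exists u; rewrite subrK.
  move=> /orth.
  rewrite dotDr dotNr (dotC _ (z *: u)) dotJ => /eqP.
  by rewrite subr_eq0 dotC => /eqP.
have K0 : 0 <= K.
  by have := le_trans (nrm_ge0 _) (wy 0%N); rewrite expr0 mulr1.
pose u_ n := projT1 (cid (wS n)).
have Au n : A (u_ n) (w_ n + z *: u_ n) by rewrite /u_; case: cid.
have [n|u [L hL]] := @complete_nrm u_ (d * (2 * K)).
  have := bnd _ _ (AB (Au n.+1) (Au n)).
  rewrite opprD addrACA -scalerBr addrK.
  have -> : w_ n.+1 - w_ n = (w_ n.+1 - y) - (w_ n - y).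
    by rewrite opprB addrA subrK.
  move=> /le_trans; apply; rewrite -mulrA ler_wpM2l//.
  rewrite (le_trans (ler_nrmD _ _))// nrmN -mulrA mulr_natl mulr2n lerD//.
  by rewrite (le_trans (wy _))// ler_wpM2l// exprS ler_piMl ?exprn_ge0//; lra.
exists u.
have Ay : A u (y + z *: u).
  apply: (@graph_closed u_ (fun n => w_ n + z *: u_ n) _ _
    (Num.max L (K + cabs z * L))) => // n.
    by rewrite (le_trans (hL n))// ler_wpM2r ?exprn_ge0// le_max lexx.
  rewrite opprD addrACA -scalerBr (le_trans (ler_nrmD _ _))// nrmZ.
  apply: (@le_trans _ _ ((K + cabs z * L) * 2^-1 ^+ n)).
    by rewrite mulrDl lerD// -mulrA ler_wpM2l ?cabs_ge0.
  by rewrite ler_wpM2r ?exprn_ge0// le_max lexx orbT.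
apply: Aeq Ay _ _; first by rewrite subrr dot0l.
by rewrite opprD addrACA subrr addr0 -opprB dotNl dotNr opprK.
Qed.
Definition in_resolvent (z : R[i]) : Prop :=
  (forall f, exists u, A u (f + z *: u)) /\
  exists c : R, forall u v, A u v ->
    dot u u <= c * dot (v - z *: u) (v - z *: u).

Lemma in_resolventP (z : R[i]) (c : R) :
  (forall u v, A u v -> nrm u <= c * nrm (v - z *: u)) ->
  (forall u, A u (z^* *: u) -> dot u u = 0) ->
  in_resolvent z.
Proof.
move=> bnd inj; split; first exact: range_full bnd inj.
exists (c ^+ 2) => u v Au; rewrite -!nrm_sqr -exprMn.
by rewrite ler_sqr ?nnegrE ?(le_trans (nrm_ge0 u) (bnd _ _ Au))//; exact: bnd.
Qed.

Section rank_one_defect.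
Variables (lam : R) (ell : V -> R[i]) (M C : R).
Hypothesis ellL : forall a u v, ell (a *: u + v) = a * ell u + ell v.
Hypothesis ellB : forall u, cabs (ell u) <= M * nrm u.
Hypothesis ellS : forall f, ell f = 0 ->
  exists2 u, A u (f + lam%:C *: u) & nrm u <= C * nrm f.

Let ellB' u v : ell (u - v) = ell u - ell v.
Proof.
by rewrite -[- v]scaleN1r addrC ellL mulN1r addrC.
Qed.

Let ellZ a u : ell (a *: u) = a * ell u.
Proof.
have e0 : ell 0 = 0 by rewrite -(subrr 0) ellB' subrr.
by rewrite -[a *: u]addr0 ellL e0 addr0.
Qed.

Let eigen_ell_eq0 e : A e (lam%:C *: e) -> ell e = 0 -> dot e e = 0.
Proof.
move=> Ae /ellS[u Au _]; have := Asym Au Ae.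
by rewrite !dotE (dotC u); lra.
Qed.

Let AZ a u v : A u v -> A (a *: u) (a *: v).
Proof. by move=> Au; have := AL a Au A0; rewrite !addr0. Qed.

Let eigenB a e e' : A e (lam%:C *: e) -> A e' (lam%:C *: e') ->
  A (e' - a *: e) (lam%:C *: (e' - a *: e)).
Proof.
move=> Ae Ae'; rewrite scalerBr scalerA mulrC -scalerA.
by apply: AB => //; exact: AZ.
Qed.

(** The functional [ell] is injective on the eigenspace: an eigenvector on
    which it vanishes is in the range of [A - lam], to which it is orthogonal. *)
Lemma eigenspace_dim1 e e' : A e (lam%:C *: e) -> dot e e != 0 ->
  A e' (lam%:C *: e') ->
  exists c, dot (e' - c *: e) (e' - c *: e) = 0.
Proof.
move=> Ae e0 Ae'; exists (ell e' / ell e).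
apply: eigen_ell_eq0; first exact: eigenB.
rewrite ellB' ellZ divfK ?subrr//.
by apply: contra_neq e0 => /eigen_ell_eq0; exact.
Qed.

(** Off the eigenspace, the functional [ell] is controlled: either it vanishes
    on the whole range of [A - lam], or a single element of that range corrects
    the defect. *)
Lemma spectral_gap : exists2 c : R, 0 < c & forall u v, A u v ->
  (forall e, A e (lam%:C *: e) -> dot u e = 0) ->
  nrm u <= c * nrm (v - lam%:C *: u).
Proof.
suff [c hc] : exists c : R, forall u f, A u (f + lam%:C *: u) ->
    exists2 u', A u' (f + lam%:C *: u') & nrm u' <= c * nrm f.
  exists (Num.max c 1); first by rewrite lt_max ltr01 orbT.
  move=> u v Au orth.
  have := hc u (v - lam%:C *: u); rewrite subrK => /(_ Au)[u' Au' u'le].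
  have uu' : A (u - u') (lam%:C *: (u - u')).
    have := AB Au Au'.
    by rewrite opprD addrA subKr scalerBr.
  have := orth _ uu'; rewrite dotDr dotNr => /eqP; rewrite subr_eq0 => /eqP uE.
  apply: (@le_trans _ _ (nrm u')).
    have := cauchy_schwarz u u'; rewrite -uE -nrm_sqr ger0_norm ?sqr_ge0//.
    have [->|u0] := eqVneq (nrm u) 0; first by [].
    by rewrite expr2 ler_pM2l// lt_neqAle eq_sym u0 nrm_ge0.
  by rewrite (le_trans u'le)// ler_wpM2r// le_max lexx.
(* An element [r] of the range with [ell r != 0] serves to correct all the
   others; if there is none, [ellS] applies to the whole range. *)
have [[r [s [As r0]]]|h] := pselect (exists r s,
    A s (r + lam%:C *: s) /\ ell r != 0); last first.
  exists C => u f Au; apply: ellS; apply: contrapT => /eqP f0.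
  by apply: h; exists f, u.
pose C' := Num.max C 0.
have C'0 : 0 <= C' by rewrite le_max lexx orbT.
pose m := cabs (ell r)^-1 * M.
exists (C' * (1 + m * nrm r) + m * nrm s) => u f Au.
pose a := ell f / ell r.
have am : cabs a <= m * nrm f.
  rewrite /m -mulrA /a.
  have -> : cabs (ell f / ell r) = cabs (ell r)^-1 * cabs (ell f).
    by apply: complexI; rewrite rmorphM /= /cabs -!normc_def normrM mulrC.
  by rewrite ler_wpM2l ?cabs_ge0.
have [|u' Au' u'le] := @ellS (f - a *: r).
  by rewrite ellB' ellZ divfK// subrr.
exists (u' + a *: s).
  suff -> : f + lam%:C *: (u' + a *: s) =
      a *: (r + lam%:C *: s) + (f - a *: r + lam%:C *: u').
    by rewrite [u' + _]addrC; exact: AL.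
  rewrite !scalerDr !scalerA (mulrC a lam%:C) [RHS]addrACA.
  by rewrite (addrC (a *: r)) subrK (addrC (lam%:C *: u')).
have le1 : nrm (f - a *: r) <= (1 + m * nrm r) * nrm f.
  rewrite (le_trans (ler_nrmD _ _))// nrmN nrmZ mulrDl mul1r lerD2l.
  by rewrite mulrAC ler_wpM2r.
rewrite (le_trans (ler_nrmD _ _))// mulrDl lerD//.
  rewrite (le_trans u'le)//.
  apply: (@le_trans _ _ (C' * nrm (f - a *: r))).
    by rewrite ler_wpM2r// le_max lexx.
  by rewrite -mulrA ler_wpM2l.
by rewrite nrmZ mulrAC ler_wpM2r.
Qed.

Let conj_real (r : R) : Num.conj (r%:C) = r%:C.
Proof. by apply/eqP; rewrite eq_complex /= oppr0 !eqxx. Qed.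

(** Without eigenvectors the orthogonality condition in [spectral_gap] is void. *)
Lemma regular_value :
  (forall e, A e (lam%:C *: e) -> dot e e = 0) -> in_resolvent lam%:C.
Proof.
move=> noe; have [c c0 gap] := spectral_gap.
apply: (@in_resolventP _ c) => [u v Au|u]; last by rewrite conj_real; exact: noe.
by apply: gap Au _ => e /noe e0; rewrite dotC nrm0_dot.
Qed.

(** Along an eigenvector [e] and its orthogonal complement, [A - z] is the
    multiplication by [lam - z] and a small perturbation of [A - lam]. *)
Lemma isolated_eigenvalue e : A e (lam%:C *: e) -> dot e e != 0 ->
  exists2 eps : R, 0 < eps &
    forall z, z != lam%:C -> cabs (z - lam%:C) < eps -> in_resolvent z.
Proof.
move=> Ae e0; have [c c0 gap] := spectral_gap.
have dime := eigenspace_dim1 Ae e0.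
exists (2 * c)^-1; first by rewrite invr_gt0 mulr_gt0.
have key z : z != lam%:C -> cabs (z - lam%:C) < (2 * c)^-1 -> forall u v,
    A u v -> nrm u <= ((cabs (lam%:C - z))^-1 + 2 * c) * nrm (v - z *: u).
  move=> zl zc u v Au.
  pose J : R[i] := 0 +i* 1.
  (* The complex coordinate of [u] along [e], recovered from the real part of
     the scalar product at [e] and at [J *: e]. *)
  pose a : R[i] := (dot u e / dot e e)%:C + J * (dot u (J *: e) / dot e e)%:C.
  have iie : dot e (J *: e) = 0.
    have := dotJ J e e; rewrite (_ : Num.conj J = - J) ?scaleNr ?dotNr; last first.
      by apply/eqP; rewrite eq_complex /= oppr0 !eqxx.
    by rewrite dotC; lra.
  have nie : dot (J *: e) (J *: e) = dot e e.
    rewrite dotJ scalerA conjcM_cabs dotRr cabs_sqr /=.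
    by rewrite expr0n /= add0r expr1n mul1r.
  pose w := u - a *: e.
  have we : dot w e = 0.
    rewrite /w /a scalerDl (mulrC J) -scalerA !dotE (dotC (J *: e) e) iie.
    by field.
  have wie : dot w (J *: e) = 0.
    rewrite /w /a scalerDl (mulrC J) -scalerA !dotE nie iie.
    by field.
  have wx x : dot w (x *: e) = 0.
    have -> : x = (complex.Re x)%:C + (complex.Im x)%:C * J.
      by rewrite mulrC [LHS]complexE.
    by rewrite scalerDl -scalerA dotDr !dotRr we wie !mulr0 addr0.
  pose v' := v - (a * lam%:C) *: e.
  have Aw : A w v' by rewrite /v' -scalerA; apply: AB => //; exact: AZ.
  have v'x x : dot v' (x *: e) = 0.
    have := Asym Aw (AZ x Ae); rewrite scalerA wx => ->//.
  have gw : nrm w <= c * nrm (v' - lam%:C *: w).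
    apply: gap Aw _ => e' /dime[b]; rewrite -nrm_sqr => /eqP.
    rewrite expf_eq0/= => /eqP b0.
    have -> : e' = b *: e + (e' - b *: e) by rewrite addrC subrK.
    rewrite dotDr wx add0r dotC nrm0_dot//.
    by rewrite -nrm_sqr b0 expr0n.
  have gw' : nrm w <= 2 * c * nrm (v' - z *: w).
    have : nrm (v' - lam%:C *: w) <= nrm (v' - z *: w) + (2 * c)^-1 * nrm w.
      have -> : v' - lam%:C *: w = (v' - z *: w) + (z - lam%:C) *: w.
        by rewrite scalerBl addrA subrK.
      rewrite (le_trans (ler_nrmD _ _))// nrmZ lerD2l ler_wpM2r//; exact: ltW.
    move=> h.
    have : c * nrm (v' - lam%:C *: w) <= c * nrm (v' - z *: w) + 2^-1 * nrm w.
      have := ler_wpM2l (ltW c0) h; rewrite mulrDr.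
      by rewrite (_ : c * (_ * _) = 2^-1 * nrm w)//; field; rewrite gt_eqF.
    by lra.
  have vzE : v - z *: u = (a * (lam%:C - z)) *: e + (v' - z *: w).
    rewrite /v' /w scalerBr opprB scalerA mulrBr scalerBl (mulrC z).
    by rewrite [RHS]addrACA addKr (addrC (_ *: e)) subrK.
  have pyth : dot (v - z *: u) (v - z *: u) =
      nrm ((a * (lam%:C - z)) *: e) ^+ 2 + nrm (v' - z *: w) ^+ 2.
    rewrite vzE; set x := _ *: e; set y := v' - _.
    have xy : dot y x = 0.
      by rewrite /y /x dotDl dotNl v'x dotJ scalerA wx subr0.
    clearbody x y.
    by rewrite !nrm_sqr !dotE (dotC x y) xy addr0 add0r.
  have p1 : nrm ((a * (lam%:C - z)) *: e) <= nrm (v - z *: u).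
    by apply: nrm_le_sqr => //; rewrite nrm_sqr pyth nrm_sqr lerDl sqr_ge0.
  have p2 : nrm (v' - z *: w) <= nrm (v - z *: u).
    by apply: nrm_le_sqr => //; rewrite nrm_sqr pyth !nrm_sqr lerDr.
  have -> : nrm u = nrm (a *: e + w) by rewrite /w addrC subrK.
  rewrite (le_trans (ler_nrmD _ _))// mulrDl lerD//; last first.
    by rewrite (le_trans gw')// ler_wpM2l ?mulr_ge0// ltW.
  have zl0 : 0 < cabs (lam%:C - z).
    rewrite lt_neqAle cabs_ge0 andbT eq_sym; apply: contra_neq zl.
    by move=> /cabs_eq0/eqP; rewrite subr_eq0 eq_sym => /eqP.
  rewrite [leRHS]mulrC ler_pdivlMr// (le_trans _ p1)// [leLHS]mulrC -nrmZ.
  by rewrite scalerA [_ * a]mulrC.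
have inj z : z != lam%:C -> cabs (z - lam%:C) < (2 * c)^-1 ->
    forall u, A u (z *: u) -> dot u u = 0.
  move=> zl zc u Au; apply: nrm_eq0; rewrite (le_trans (key z zl zc _ _ Au))//.
  by rewrite subrr /nrm dot0l sqrtr0 mulr0.
move=> z zl zc; apply: in_resolventP (key z zl zc) _.
have conjB : Num.conj (z - lam%:C) = Num.conj z - lam%:C by rewrite rmorphB; congr (_ - _); exact: conj_real.
apply: inj.
  by apply: contra_neq zl => h; rewrite -[z]conjCK h; exact: conj_real.
by rewrite -conjB cabs_conj.
Qed.

End rank_one_defect.
End operator.
End hilbert.

(** * Integrable functions *)

Section rintegrable.
Context d (T : measurableType d) (R : realType).
Variable m : {measure set T -> \bar R}.

Definition rintegrable (f : T -> R) : Prop :=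
  m.-integrable [set: T] (EFin \o f).

Lemma rintegrable_measurable f : rintegrable f -> measurable_fun [set: T] f.
Proof. by move=> /(measurable_int m)/measurable_EFinP. Qed.

Lemma rintegrable_measurable_abse f : rintegrable f ->
  measurable_fun [set: T] (fun x => `|(f x)%:E|%E).
Proof. by move=> /(measurable_int m) ?; exact: measurableT_comp. Qed.

Lemma rintegrableD f g : rintegrable f -> rintegrable g ->
  rintegrable (fun x => f x + g x).
Proof. by move=> fi gi; have := integrableD measurableT fi gi; exact. Qed.

Lemma rintegrableZ r f : rintegrable f -> rintegrable (fun x => r * f x).
Proof. by move=> fi; have := integrableZl measurableT r fi; exact. Qed.

Lemma rintegrableN f : rintegrable f -> rintegrable (fun x => - f x).
Proof.
move=> /(@rintegrableZ (- 1)); congr rintegrable.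
by apply/funext => x; rewrite mulN1r.
Qed.

Lemma rintegrableB f g : rintegrable f -> rintegrable g ->
  rintegrable (fun x => f x - g x).
Proof. by move=> fi gi; apply: rintegrableD => //; exact: rintegrableN. Qed.

Lemma rintegrable_le (f g : T -> R) : measurable_fun [set: T] f -> rintegrable g ->
  (forall x, `|f x| <= g x) -> rintegrable f.
Proof.
move=> mf gi fg; apply: (le_integrable measurableT _ _ gi) => //=.
  exact/measurable_EFinP.
by move=> x _; rewrite lee_fin (le_trans (fg x))// ler_norm.
Qed.

Lemma rintegrable_norm f : rintegrable f -> rintegrable (fun x => `|f x|).
Proof. by move=> fi; exact: (integrable_norm fi). Qed.

Lemma rintegrable_bounded (k f : T -> R) (c : R) :
  measurable_fun [set: T] k -> (forall x, `|k x| <= c) -> rintegrable f ->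
  rintegrable (fun x => k x * f x).
Proof.
move=> mk kc fi; apply: (@rintegrable_le _ (fun x => c * `|f x|)).
- by apply: measurable_funM => //; exact: rintegrable_measurable.
- by apply: rintegrableZ; exact: rintegrable_norm.
- by move=> x; rewrite normrM ler_wpM2r.
Qed.

Lemma norm_indic (D : set T) x : `|\1_D x : R| <= 1.
Proof. by rewrite indicE; case: (x \in D); rewrite ?normr1 ?normr0. Qed.

Lemma rintegrable_indic (D : set T) f : measurable D -> rintegrable f ->
  rintegrable (fun x => \1_D x * f x).
Proof.
by move=> mD; apply: (@rintegrable_bounded _ _ 1) => // x; exact: norm_indic.
Qed.

Lemma indicM_patch (D : set T) (f : T -> R) :
  (fun x => \1_D x * f x) = f \_ D.
Proof.
apply/funext => x; rewrite indicE patchE; case: ifP => _.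
  by rewrite mul1r.
by rewrite mul0r.
Qed.

Lemma rintegrable_indicE (D : set T) f : measurable D ->
  m.-integrable D (EFin \o f) <-> rintegrable (fun x => \1_D x * f x).
Proof.
move=> mD; rewrite /rintegrable indicM_patch -restrict_EFin.
by have := integrable_restrict m mD measurableT (EFin \o f); rewrite setTI.
Qed.

Lemma integrable_indicM (D : set T) f : measurable D ->
  m.-integrable D (EFin \o f) -> rintegrable (fun x => \1_D x * f x).
Proof. by move=> mD /(rintegrable_indicE _ mD). Qed.

Lemma Rintegral_indic (D : set T) f :
  \int[m]_(x in D) f x = \int[m]_x (\1_D x * f x).
Proof. by rewrite Rintegral_mkcond -indicM_patch. Qed.

Lemma le_norm_Rintegral (f g : T -> R) : rintegrable f -> rintegrable g ->
  (forall x, `|f x| <= g x) -> `|\int[m]_x f x| <= \int[m]_x g x.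
Proof.
move=> fi gi fg; rewrite (le_trans (le_normr_Rintegral _ _))//.
by apply: le_Rintegral => //; exact: rintegrable_norm.
Qed.

End rintegrable.

(** A bound by a product of two integrable functions is what all the kernels
    below satisfy, and it reduces integrability for the product measure to the
    two factors. *)
Section fubini_dominated.
Context d1 d2 (T1 : measurableType d1) (T2 : measurableType d2) (R : realType).
Variables (m1 : {sigma_finite_measure set T1 -> \bar R}).
Variables (m2 : {sigma_finite_measure set T2 -> \bar R}).
Variables (f : T1 * T2 -> R) (a : T1 -> R) (c : T2 -> R).
Hypothesis mf : measurable_fun setT f.
Hypotheses (ai : rintegrable m1 a) (ci : rintegrable m2 c).
Hypothesis fac : forall x y, `|f (x, y)| <= a x * c y.

Let f2 x : rintegrable m2 (fun y => f (x, y)).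
Proof.
apply: (@rintegrable_le _ _ _ _ _ (fun y => a x * c y)) => //.
  exact: measurableT_comp mf (pair1_measurable x).
exact: rintegrableZ.
Qed.

Let f1 y : rintegrable m1 (fun x => f (x, y)).
Proof.
apply: (@rintegrable_le _ _ _ _ _ (fun x => c y * a x)) => [||x].
- exact: measurableT_comp mf (pair2_measurable y).
- exact: rintegrableZ.
- by rewrite mulrC.
Qed.

Let fi : (m1 \x m2)%E.-integrable setT (EFin \o f).
Proof.
apply/integrable12ltyP; first exact/measurable_EFinP.
have fin2 : (\int[m2]_y `|(c y)%:E| < +oo)%E by case/integrableP : ci.
have ci' : (\int[m2]_y `|(c y)%:E|)%E \is a fin_num.
  by rewrite ge0_fin_numE// integral_ge0.
have ma := rintegrable_measurable_abse ai.
have mc := rintegrable_measurable_abse ci.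
apply: (@le_lt_trans _ _
    (\int[m1]_x (`|(a x)%:E| * \int[m2]_y `|(c y)%:E|))%E).
  apply: ge0_le_integral => //.
  - by move=> x _; exact: integral_ge0.
  - apply: (@measurable_fun_fubini_tonelli_F _ _ _ _ _ m2
      (fun z => `|(EFin \o f) z|)%E) => //=.
    by apply/measurable_EFinP; exact: measurableT_comp.
  - exact: emeasurable_funM.
  - move=> x _; rewrite -ge0_integralZl//=.
    apply: ge0_le_integral => //=.
    + exact: rintegrable_measurable_abse (f2 x).
    + exact: emeasurable_funM.
    + by move=> y _; rewrite lee_fin -normrM (le_trans (fac x y))// ler_norm.
rewrite -(fineK ci') ge0_integralZr//.
- by rewrite muleC lte_mul_pinfty ?lee_fin ?fine_ge0 ?integral_ge0//;
    case/integrableP : ai.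
- by rewrite lee_fin fine_ge0// integral_ge0.
Qed.

Let FE : (fun x => \int[m2]_y (f (x, y))%:E)%E =
  EFin \o (fun x => \int[m2]_y f (x, y)).
Proof.
apply/funext => x /=; rewrite /Rintegral fineK//.
exact: (integrable_fin_num _ (f2 x)).
Qed.

Let GE : (fun y => \int[m1]_x (f (x, y))%:E)%E =
  EFin \o (fun y => \int[m1]_x f (x, y)).
Proof.
apply/funext => y /=; rewrite /Rintegral fineK//.
exact: (integrable_fin_num _ (f1 y)).
Qed.

Lemma rintegrable_fubini1 : rintegrable m1 (fun x => \int[m2]_y f (x, y)).
Proof. by have := integrable_fubini_F fi; rewrite /fubini_F FE. Qed.

Lemma fubini_dominated :
  \int[m1]_x \int[m2]_y f (x, y) = \int[m2]_y \int[m1]_x f (x, y).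
Proof.
have := Fubini fi; rewrite /fubini_F /fubini_G FE GE.
by rewrite /Rintegral => ->.
Qed.

End fubini_dominated.

(** * Square integrable functions and their completeness *)

(** The minimum over [t] is at [t = b / c]; for [c = 0] the expression is
    affine in [t], and its being nonnegative forces [b = 0]. *)
Lemma discriminant_le (R : realType) (a b c : R) :
  0 <= a -> 0 <= c -> (forall t, 0 <= a - 2 * t * b + t ^+ 2 * c) -> b ^+ 2 <= a * c.
Proof.
move=> a0 c0 h.
have [c00|c00] := eqVneq c 0.
  have [->|b0] := eqVneq b 0; first by rewrite expr0n/= mulr_ge0.
  have := h ((a + 1) / (2 * b)).
  rewrite c00 mulr0 (_ : 2 * ((a + 1) / (2 * b)) * b = a + 1); last by field.
  by lra.
have cp : 0 < c by rewrite lt_neqAle eq_sym c00.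
have := h (b / c).
rewrite (_ : _ + _ = a - b ^+ 2 / c); last by field.
by rewrite subr_ge0 ler_pdivrMr.
Qed.

Lemma sum_half_le2 (R : realType) n : \sum_(0 <= k < n) (2^-1 : R) ^+ k <= 2.
Proof.
have -> : \sum_(0 <= k < n) (2^-1 : R) ^+ k = 2 * (1 - 2^-1 ^+ n).
  elim: n => [|n IH]; first by rewrite big_geq// expr0 subrr mulr0.
  by rewrite big_nat_recr//= IH exprS; field.
have : 0 <= (2^-1 : R) ^+ n by exact: exprn_ge0.
by lra.
Qed.

Section square_integrable.
Context d (T : measurableType d) (R : realType).
Variable m : {measure set T -> \bar R}.

Definition square_integrable (f : T -> R) : Prop :=
  measurable_fun [set: T] f /\ rintegrable m (fun x => f x ^+ 2).

Lemma square_integrableM f g : square_integrable f -> square_integrable g ->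
  rintegrable m (fun x => f x * g x).
Proof.
move=> [mf fi] [mg gi]; apply: (@rintegrable_le _ _ _ _ _ (fun x => f x ^+ 2 + g x ^+ 2)).
- exact: measurable_funM.
- exact: rintegrableD.
- move=> x; rewrite ler_norml; apply/andP.
  have := sqr_ge0 (f x + g x); have := sqr_ge0 (f x - g x).
  have := sqr_ge0 (f x); have := sqr_ge0 (g x).
  by rewrite !expr2; split; nra.
Qed.

Lemma square_integrableZ r f : square_integrable f ->
  square_integrable (fun x => r * f x).
Proof.
move=> [mf fi]; split; first exact: measurable_funM.
have := rintegrableZ (r ^+ 2) fi.
by congr rintegrable; apply/funext => x; rewrite exprMn.
Qed.

Lemma square_integrableD f g : square_integrable f -> square_integrable g ->
  square_integrable (fun x => f x + g x).
Proof.
move=> fi gi; split; first by apply: measurable_funD; [case: fi|case: gi].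
have := rintegrableD (rintegrableD (proj2 fi) (proj2 gi))
  (rintegrableZ 2 (square_integrableM fi gi)).
by congr rintegrable; apply/funext => x; ring.
Qed.

Lemma square_integrableB f g : square_integrable f -> square_integrable g ->
  square_integrable (fun x => f x - g x).
Proof.
move=> fi gi.
have := square_integrableD fi (square_integrableZ (-1) gi).
by congr square_integrable; apply/funext => x; rewrite mulN1r.
Qed.

Lemma Rintegral_sqr_ge0 (f : T -> R) : 0 <= \int[m]_x (f x ^+ 2).
Proof. by apply: Rintegral_ge0 => x _; exact: sqr_ge0. Qed.

Lemma Rintegral_sqrD f g (a b : R) :
  square_integrable f -> square_integrable g ->
  \int[m]_x ((a * f x + b * g x) ^+ 2) =
  a ^+ 2 * \int[m]_x (f x ^+ 2) + 2 * a * b * \int[m]_x (f x * g x)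
  + b ^+ 2 * \int[m]_x (g x ^+ 2).
Proof.
move=> fi gi; have fg := square_integrableM fi gi.
rewrite -!RintegralZl//; [|by case: gi|by case: fi].
have hf := rintegrableZ (a ^+ 2) (proj2 fi).
have hg := rintegrableZ (b ^+ 2) (proj2 gi).
have hfg := rintegrableZ (2 * a * b) fg.
rewrite -RintegralD// -RintegralD//; last exact: rintegrableD.
by apply: eq_Rintegral => x _; ring.
Qed.

Lemma Rintegral_cauchy_schwarz f g :
  square_integrable f -> square_integrable g ->
  (\int[m]_x (f x * g x)) ^+ 2 <= \int[m]_x (f x ^+ 2) * \int[m]_x (g x ^+ 2).
Proof.
move=> fi gi; apply: discriminant_le; try exact: Rintegral_sqr_ge0.
move=> t; have := Rintegral_sqr_ge0 (fun x => 1 * f x + - t * g x).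
by rewrite Rintegral_sqrD//; lra.
Qed.

Lemma rintegrable_fin f : rintegrable m f ->
  (\int[m]_x (f x)%:E)%E = (\int[m]_x f x)%:E.
Proof. by move=> fi; rewrite /Rintegral fineK// (integrable_fin_num _ fi). Qed.

Lemma Rintegral_sqrB_le f g (a b : R) :
  square_integrable f -> square_integrable g ->
  \int[m]_x (f x ^+ 2) <= a -> \int[m]_x (g x ^+ 2) <= b ->
  \int[m]_x ((f x + g x) ^+ 2) <= 2 * a + 2 * b.
Proof.
move=> fi gi fa gb.
have := Rintegral_sqr_ge0 (fun x => 1 * f x + - 1 * g x).
rewrite Rintegral_sqrD// => h.
have -> : \int[m]_x ((f x + g x) ^+ 2) =
    \int[m]_x ((1 * f x + 1 * g x) ^+ 2).
  by apply: eq_Rintegral => x _; rewrite !mul1r.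
by rewrite Rintegral_sqrD//; lra.
Qed.

Lemma square_integrable_telescope (u_ : nat -> T -> R) :
  (forall n, square_integrable (u_ n)) ->
  (forall n, \int[m]_x ((u_ n.+1 x - u_ n x) ^+ 2) <= 4^-1 ^+ n) ->
  forall j n, \int[m]_x ((u_ (j + n)%N x - u_ n x) ^+ 2) <= 4 * 4^-1 ^+ n.
Proof.
move=> ui ud; elim=> [|j IH] n.
  under eq_Rintegral do rewrite add0n subrr expr0n/=.
  by rewrite Rintegral_cst// mul0r mulr_ge0// exprn_ge0.
have := @Rintegral_sqrB_le _ _ _ _ (square_integrableB (ui (j + n.+1)%N) (ui n.+1))
  (square_integrableB (ui n.+1) (ui n)) (IH n.+1) (ud n).
rewrite addSnnS exprS.
under eq_Rintegral do rewrite addrA subrK.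
by move=> /le_trans; apply; lra.
Qed.

End square_integrable.

Section riesz_fischer.
Context d (T : measurableType d) (R : realType).
Variable m : {measure set T -> \bar R}.
Variable u_ : nat -> T -> R.
Hypothesis ui : forall n, square_integrable m (u_ n).
Hypothesis ud : forall n, \int[m]_x ((u_ n.+1 x - u_ n x) ^+ 2) <= 4^-1 ^+ n.

Let D k x : R := 2 ^+ k * (u_ k.+1 x - u_ k x) ^+ 2.
Let D0 k x : 0 <= D k x. Proof. by rewrite mulr_ge0 ?sqr_ge0// exprn_ge0. Qed.
Let S x : \bar R := (\sum_(0 <= k <oo) (D k x)%:E)%E.

Let Di k : rintegrable m (D k).
Proof. by apply: rintegrableZ; case: (square_integrableB (ui k.+1) (ui k)). Qed.

Let mD k : measurable_fun [set: T] (fun x => (D k x)%:E).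
Proof. exact/measurable_EFinP/(rintegrable_measurable (Di k)). Qed.

Let mS : measurable_fun [set: T] S.
Proof.
have := @ge0_emeasurable_sum _ T R [set: T] (fun k x => (D k x)%:E) xpredT.
by apply => // k x _ _; rewrite lee_fin.
Qed.

Let S0 x : (0 <= S x)%E.
Proof. by apply: nneseries_ge0 => k _ _; rewrite lee_fin. Qed.

Let intS : (\int[m]_x S x <= 2%:E)%E.
Proof.
rewrite integral_nneseries//; last by move=> k x _; rewrite lee_fin.
apply: lime_le.
  by apply: is_cvg_nneseries => k _ _; apply: integral_ge0 => x _; rewrite lee_fin.
apply: nearW => n.
have h k : (\int[m]_x (D k x)%:E <= (2^-1 ^+ k)%:E)%E.
  rewrite rintegrable_fin// lee_fin RintegralZl//; last first.
    by case: (square_integrableB (ui k.+1) (ui k)).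
  have -> : (2^-1 : R) ^+ k = 2 ^+ k * 4^-1 ^+ k.
    by rewrite -exprMn; congr (_ ^+ _); field.
  by rewrite ler_wpM2l ?exprn_ge0.
apply: (@le_trans _ _ (\sum_(0 <= k < n) (2^-1 ^+ k)%:E)%E).
  by apply: lee_sum => k _; exact: h.
rewrite sumEFin lee_fin.
exact: sum_half_le2.
Qed.

Let G := [set x | (S x < +oo)%E].

Let mG : measurable G.
Proof.
by rewrite -[G]setTI; exact: emeasurable_fun_infty_o.
Qed.

Let aeG : {ae m, forall x, G x}.
Proof.
have : m.-integrable [set: T] S.
  apply/integrableP; split=> //.
  under eq_integral do rewrite gee0_abs//.
  exact: le_lt_trans intS (ltry _).
move=> /(integrable_ae measurableT).
by apply: filterS => x /(_ I); rewrite ge0_fin_numE.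
Qed.

Let v_ n x : R := \1_G x * u_ n x.

Let v_cvg x : cvgn (v_ ^~ x).
Proof.
rewrite /v_ indicE; case: (boolP (x \in G)) => [|_]; last first.
  by under eq_fun do rewrite mul0r; exact: is_cvg_cst.
rewrite inE /G /= => Sx; under eq_fun do rewrite mul1r.
pose w k := u_ k.+1 x - u_ k x.
suff h : cvgn (series w).
  have -> : (u_ ^~ x) = (fun n => u_ 0%N x + series w n).
    apply/funext => n /=; elim: n => [|n IH].
      by rewrite /series /= big_geq// addr0.
    by rewrite seriesSr addrA -IH /w addrC subrK.
  by apply: is_cvgD => //; exact: is_cvg_cst.
apply: normed_cvg; apply: nondecreasing_is_cvgn.
  apply/nondecreasing_seqP => n.
  by rewrite /= seriesSr lerDl.
exists (2 + fine (S x)) => _ [n _ <-].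
have Sfin : S x \is a fin_num by rewrite ge0_fin_numE.
have Sn : \sum_(0 <= k < n) D k x <= fine (S x).
  rewrite -lee_fin fineK// -sumEFin; apply: nneseries_lim_ge => k _ _.
  by rewrite lee_fin.
have : \sum_(0 <= k < n) `|w k| <= \sum_(0 <= k < n) (2^-1 ^+ k + D k x).
  apply: ler_sum => k _; rewrite /D -/(w k).
  have k0 : 0 < (2 : R) ^+ k by rewrite exprn_gt0.
  have := sqr_ge0 (1 - 2 ^+ k * `|w k|).
  rewrite sqrrB expr1n mul1r exprMn real_normK ?num_real// => h.
  have : 2 * `|w k| <= 2^-1 ^+ k + 2 ^+ k * w k ^+ 2.
    rewrite -(ler_pM2l k0) mulrDr -exprMn divff// expr1n; lra.
  have := normr_ge0 (w k); lra.
move=> /le_trans; apply; rewrite big_split/= lerD//.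
exact: sum_half_le2.
Qed.

(** The squared increments weighted by the powers of 2 still have a finite
    integral in total, and the inequality between arithmetic and geometric means
    turns the finiteness of their sum at a point into absolute convergence of
    the increments there. *)
Lemma riesz_fischer : exists2 u, square_integrable m u &
  forall n, \int[m]_x ((u_ n x - u x) ^+ 2) <= 4 * 4^-1 ^+ n.
Proof.
pose u x := limn (v_ ^~ x).
have mv n : measurable_fun [set: T] (v_ n).
  by apply: measurable_funM => //; case: (ui n).
have mu : measurable_fun [set: T] u.
  by apply: (measurable_fun_cvg mv) => x _; exact: v_cvg.
have key n : (\int[m]_x ((u_ n x - u x) ^+ 2)%:E <= (4 * 4^-1 ^+ n)%:E)%E.
  have mun : measurable_fun [set: T] (u_ n) by case: (ui n).
  rewrite (@ae_eq_integral _ _ _ _ _ (fun x => ((v_ n x - u x) ^+ 2)%:E))//; first last.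
  - move: aeG; apply: filterS => x Gx _.
    by rewrite /v_ indicE mem_set// mul1r.
  - by apply/measurable_EFinP; apply: measurable_funX; exact: measurable_funB.
  - by apply/measurable_EFinP; apply: measurable_funX; exact: measurable_funB.
  pose h j x := ((v_ n x - v_ (j + n)%N x) ^+ 2)%:E.
  have hE x : limn_einf (h ^~ x) = ((v_ n x - u x) ^+ 2)%:E.
    apply: (@cvg_limn_einf_sup _ (h ^~ x) _ _).1.
    have c : (fun j => v_ n x - v_ (j + n)%N x) @ \oo --> v_ n x - u x.
      apply: cvgB; first exact: cvg_cst.
      by rewrite (cvg_shiftn n (v_ ^~ x)); exact: v_cvg.
    apply: cvg_EFin; first exact: nearW.
    by rewrite expr2; exact: (cvgM c c).
  under eq_integral do rewrite -hE.
  apply: le_trans; first apply: fatou => //.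
  - move=> j; apply/measurable_EFinP; apply: measurable_funX.
    exact: measurable_funB.
  - by move=> j x _; rewrite lee_fin sqr_ge0.
  have hj j : (\int[m]_x h j x <= (4 * 4^-1 ^+ n)%:E)%E.
    have := square_integrable_telescope ui ud j n.
    rewrite -lee_fin -rintegrable_fin; last first.
      by case: (square_integrableB (ui (j + n)%N) (ui n)).
    apply: le_trans; apply: ge0_le_integral => //.
    - by move=> x _; rewrite lee_fin sqr_ge0.
    - by apply/measurable_EFinP; apply: measurable_funX; exact: measurable_funB.
    - apply/measurable_EFinP; apply: measurable_funX.
      by apply: measurable_funB => //; case: (ui (j + n)%N).
    - move=> x _; rewrite lee_fin /v_ indicE; case: (x \in G).
        by rewrite !mul1r -opprB sqrrN.
      by rewrite !mul0r subrr expr0n/= sqr_ge0.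
  rewrite limn_einf_lim; apply: lime_le; first exact: is_cvg_einfs.
  by apply: nearW => j; apply: le_trans (hj j); apply: ereal_inf_lbound; exists j => /=.
have si n : rintegrable m (fun x => (u_ n x - u x) ^+ 2).
  apply/integrableP; split.
    apply/measurable_EFinP; apply: measurable_funX; apply: measurable_funB => //.
    by case: (ui n).
  under eq_integral do rewrite gee0_abs ?lee_fin ?sqr_ge0//.
  exact: le_lt_trans (key n) (ltry _).
exists u; last by move=> n; rewrite -lee_fin -rintegrable_fin.
have d0 : square_integrable m (fun x => u_ 0%N x - u x).
  by split; [apply: measurable_funB => //; case: (ui 0%N)|exact: si].
have := square_integrableB (ui 0%N) d0.
by congr square_integrable; apply/funext => x; rewrite subKr.
Qed.

End riesz_fischer.

(** * The kernel of the resolvent of the second derivative *)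

Notation leb := lebesgue_measure.

Section interval_integrals.
Variable R : realType.
Implicit Types (f F : R -> R) (a b x y s : R).

Lemma continuous_integrable_cc f a b :
  continuous f -> leb.-integrable `[a, b] (EFin \o f).
Proof.
move=> cf; apply: continuous_compact_integrable; first exact: segment_compact.
exact: continuous_subspaceT.
Qed.

Lemma continuous_integrable_oo f a b :
  continuous f -> leb.-integrable `]a, b[ (EFin \o f).
Proof.
move=> cf; apply: integrableS (continuous_integrable_cc a b cf) => //.
exact: subset_itv_oo_cc.
Qed.

Lemma Rintegral_oo_split f a b y : a <= y -> y <= b ->
  leb.-integrable `]a, b[ (EFin \o f) ->
  \int[leb]_(t in `]a, b[) f t =
  \int[leb]_(t in `]a, y[) f t + \int[leb]_(t in `]y, b[) f t.
Proof.
move=> ay yb fi.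
have [->|yb'] := eqVneq y b.
  by rewrite [X in _ = _ + X](_ : _ = 0) ?addr0// set_itvoo0 ?Rintegral_set0.
have fay : leb.-integrable `]a, y[ (EFin \o f).
  by apply: integrableS fi => //; apply: subset_itvl; rewrite bnd_simp.
have := @Rintegral_itvB R f (BRight a) (BLeft b) y fi.
rewrite !bnd_simp lt_neqAle yb' yb => /(_ ay isT) <-.
by rewrite (Rintegral_itv_bndo_bndc fay) addrC subrK.
Qed.

Lemma Rintegral_oo_FTC f F a b : a <= b -> continuous f ->
  (forall x, is_derive x 1 F (f x)) ->
  \int[leb]_(t in `]a, b[) f t = F b - F a.
Proof.
rewrite le_eqVlt => /predU1P[->|ab] cf dF.
  by rewrite set_itvoo0 ?Rintegral_set0 ?subrr.
have cF : continuous F.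
  move=> x; apply: differentiable_continuous; apply/derivable1_diffP.
  by have := dF x.
have fi := continuous_integrable_oo a b cf.
rewrite Rintegral_itv_obnd_cbnd// Rintegral_itv_bndo_bndc; last first.
  apply: integrableS (continuous_integrable_cc a b cf) => //.
  by apply: subset_itvl; rewrite bnd_simp.
rewrite /Rintegral (@continuous_FTC2 _ f F a b)//.
- exact: continuous_subspaceT.
- by split=> [x _||]; [have := dF x|apply: cvg_at_right_filter; exact: cF|
    apply: cvg_at_left_filter; exact: cF].
- by move=> x _; rewrite derive1E; have := dF x => ?; rewrite derive_val.
Qed.

Lemma is_derive_expR_affine (c y t : R) :
  is_derive t 1 (fun t => expR (c * (t - y))) (c * expR (c * (t - y))).
Proof.
rewrite mulrC; apply: (@is_derive1_comp _ expR (fun t => c * (t - y))).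
have -> : (fun t : R => c * (t - y)) = c \*: (id - cst y) by [].
by apply: is_derive_eq; rewrite subr0 [LHS]mulr1.
Qed.

Lemma continuous_expR_affine (c y : R) : continuous (fun t : R => expR (c * (t - y))).
Proof.
move=> t; apply: differentiable_continuous; apply/derivable1_diffP.
by have := is_derive_expR_affine c y t.
Qed.

Lemma Rintegral_expR (c y a b : R) : c != 0 -> a <= b ->
  \int[leb]_(t in `]a, b[) expR (c * (t - y)) =
  (expR (c * (b - y)) - expR (c * (a - y))) / c.
Proof.
move=> c0 ab.
have dF (t : R) : is_derive t 1 (fun t => c^-1 * expR (c * (t - y)))
    (expR (c * (t - y))).
  have := is_deriveZ c^-1 (is_derive_expR_affine c y t).
  by rewrite [_ *: _]mulrA mulVf// mul1r.
rewrite (Rintegral_oo_FTC ab (@continuous_expR_affine c y) dF).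
by rewrite -mulrBr mulrC.
Qed.

End interval_integrals.

Section kernels.
Variables (R : realType) (k : R).
Hypothesis k0 : 0 < k.
Local Notation RT := (measurableTypeR R).

Lemma rintegrable_indic_oo (a b : R) :
  rintegrable leb (\1_(`]a, b[) : R -> R).
Proof.
exact: integrable_indic_itv.
Qed.

Lemma bounded_integrable_oo (f : RT -> R) (c a b : R) :
  measurable_fun [set: RT] f -> (forall x, `|f x| <= c) ->
  rintegrable leb (fun t => \1_(`]a, b[) t * f t).
Proof.
move=> mf fc; have := rintegrable_bounded mf fc (rintegrable_indic_oo a b).
by congr rintegrable; apply/funext => t; rewrite mulrC.
Qed.

(** The fundamental solution of [- u'' + k^2 u], and its derivative off the
    origin; at the origin [green'] takes the mean of its one-sided limits. *)
Definition green (t : R) : R := expR (- (k * `|t|)) / (2 * k).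
Definition green' (t : R) : R := - (Num.sg t * expR (- (k * `|t|)) / 2).

Lemma measurable_green : measurable_fun [set: RT] green.
Proof.
apply: measurable_funM => //; apply: measurableT_comp => //.
by apply: measurable_funN; apply: measurable_funM => //; apply: measurableT_comp.
Qed.

Lemma measurable_sg : measurable_fun [set: RT] (Num.sg : R -> R).
Proof.
have -> : (Num.sg : R -> R) = (fun x => \1_(`]0, +oo[) x - \1_(`]-oo, 0[) x).
  apply/funext => x; rewrite !indicE !mem_setE !in_itv/= andbT.
  by case: (ltgtP x 0) => [x0|x0|->]; rewrite ?sgr0 ?subrr ?(gtr0_sg x0)
    ?(ltr0_sg x0) ?sub0r ?subr0.
exact: measurable_funB.
Qed.

Lemma measurable_green' : measurable_fun [set: RT] green'.
Proof.
apply: measurable_funN; apply: measurable_funM => //; apply: measurable_funM.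
  exact: measurable_sg.
apply: measurableT_comp => //.
by apply: measurable_funN; apply: measurable_funM => //; apply: measurableT_comp.
Qed.

Lemma green_ge0 t : 0 <= green t.
Proof. by rewrite divr_ge0 ?expR_ge0// mulr_ge0// ltW. Qed.

Lemma norm_greenE t : `|green t| = (2 * k)^-1 * expR (- (k * `|t|)).
Proof. by rewrite ger0_norm ?green_ge0// mulrC. Qed.

Lemma norm_green'_le t : `|green' t| <= 2^-1 * expR (- (k * `|t|)).
Proof.
rewrite /green' normrN !normrM normr_sg (ger0_norm (expR_ge0 _)).
rewrite (ger0_norm (_ : 0 <= (2^-1 : R))) ?invr_ge0// mulrC ler_wpM2l//.
by case: (t == 0); rewrite ?mul0r ?mul1r ?expR_ge0.
Qed.

Lemma expR_abs_le1 (t : R) : expR (- (k * `|t|)) <= 1.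
Proof. by rewrite -expR0 ler_expR oppr_le0 mulr_ge0// ltW. Qed.

Lemma green_integral_right (y a b : R) : y <= a -> a <= b ->
  \int[leb]_(t in `]a, b[) green' (t - y) = green (b - y) - green (a - y) /\
  k ^+ 2 * \int[leb]_(t in `]a, b[) green (t - y) =
    2^-1 * expR (- (k * `|a - y|)) - 2^-1 * expR (- (k * `|b - y|)).
Proof.
move=> ya ab; have yb := le_trans ya ab.
have kn0 : - k != 0 by rewrite oppr_eq0 gt_eqF.
have ci := continuous_integrable_oo a b (@continuous_expR_affine R (- k) y).
have aE : expR (- (k * `|a - y|)) = expR (- k * (a - y)).
  by rewrite ger0_norm ?subr_ge0// mulNr.
have bE : expR (- (k * `|b - y|)) = expR (- k * (b - y)).
  by rewrite ger0_norm ?subr_ge0// mulNr.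
have e := Rintegral_expR y kn0 ab.
rewrite /green; split.
- rewrite aE bE (_ : _ - _ = (- 2^-1) *
     \int[leb]_(t in `]a, b[) expR (- k * (t - y))); last first.
    by rewrite e; field; rewrite gt_eqF.
  rewrite -RintegralZl//; apply: eq_Rintegral => t; rewrite inE /= in_itv/= => /andP[at_ _].
  have yt : 0 < t - y by rewrite subr_gt0 (le_lt_trans ya).
  by rewrite /green' gtr0_sg// gtr0_norm// mul1r mulNr mulrC mulNr.
- rewrite aE bE (_ : \int[leb]_(t in _) _ = (2 * k)^-1 *
     \int[leb]_(t in `]a, b[) expR (- k * (t - y))).
    by rewrite e; field; rewrite gt_eqF.
  rewrite -RintegralZl//; apply: eq_Rintegral => t; rewrite inE /= in_itv/= => /andP[at_ _].
  have yt : 0 < t - y by rewrite subr_gt0 (le_lt_trans ya).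
  by rewrite gtr0_norm// mulrC mulNr.
Qed.

Lemma green_integral_left (y a b : R) : b <= y -> a <= b ->
  \int[leb]_(t in `]a, b[) green' (t - y) = green (b - y) - green (a - y) /\
  k ^+ 2 * \int[leb]_(t in `]a, b[) green (t - y) =
    2^-1 * expR (- (k * `|b - y|)) - 2^-1 * expR (- (k * `|a - y|)).
Proof.
move=> yb ab; have ya := le_trans ab yb.
have kn0 : k != 0 by rewrite gt_eqF.
have ci := continuous_integrable_oo a b (@continuous_expR_affine R k y).
have aE : expR (- (k * `|a - y|)) = expR (k * (a - y)).
  by rewrite ler0_norm ?subr_le0// mulrN opprK.
have bE : expR (- (k * `|b - y|)) = expR (k * (b - y)).
  by rewrite ler0_norm ?subr_le0// mulrN opprK.
have e := Rintegral_expR y kn0 ab.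
rewrite /green; split.
- rewrite aE bE (_ : _ - _ = 2^-1 *
     \int[leb]_(t in `]a, b[) expR (k * (t - y))); last first.
    by rewrite e; field; rewrite gt_eqF.
  rewrite -RintegralZl//; apply: eq_Rintegral => t; rewrite inE /= in_itv/= => /andP[_ tb].
  have yt : t - y < 0 by rewrite subr_lt0 (lt_le_trans tb).
  by rewrite /green' ltr0_sg// ltr0_norm// mulN1r mulNr opprK mulrN opprK mulrC.
- rewrite aE bE (_ : \int[leb]_(t in _) _ = (2 * k)^-1 *
     \int[leb]_(t in `]a, b[) expR (k * (t - y))).
    by rewrite e; field; rewrite gt_eqF.
  rewrite -RintegralZl//; apply: eq_Rintegral => t; rewrite inE /= in_itv/= => /andP[_ tb].
  have yt : t - y < 0 by rewrite subr_lt0 (lt_le_trans tb).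
  by rewrite ltr0_norm// mulrN opprK mulrC.
Qed.

Lemma measurable_shift (y : R) : measurable_fun [set: RT] (fun t : RT => t - y).
Proof. exact: measurable_funB. Qed.

Lemma green_integrable_oo (y a b : R) : leb.-integrable `]a, b[ (EFin \o (fun t => green (t - y))).
Proof.
apply/rintegrable_indicE => //; apply: (@bounded_integrable_oo _ ((2 * k)^-1)).
  exact: measurableT_comp measurable_green (measurable_shift y).
by move=> x; rewrite norm_greenE ler_piMr ?expR_abs_le1// invr_ge0 mulr_ge0// ltW.
Qed.

Lemma green'_integrable_oo (y a b : R) : leb.-integrable `]a, b[ (EFin \o (fun t => green' (t - y))).
Proof.
apply/rintegrable_indicE => //; apply: (@bounded_integrable_oo _ (2^-1)).
  exact: measurableT_comp measurable_green' (measurable_shift y).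
by move=> x; rewrite (le_trans (norm_green'_le _))// ler_piMr ?expR_abs_le1.
Qed.

Lemma green_increment (y s x : R) : s <= x ->
  green (x - y) - green (s - y) = \int[leb]_(t in `]s, x[) green' (t - y).
Proof.
move=> sx; have [ys|sy] := leP y s; first by rewrite (green_integral_right ys sx).1.
have [xy|yx] := leP x y; first by rewrite (green_integral_left xy sx).1.
rewrite (@Rintegral_oo_split _ _ _ _ y) ?ltW//; last exact: green'_integrable_oo.
rewrite (green_integral_left (lexx y) (ltW sy)).1 (green_integral_right (lexx y) (ltW yx)).1.
by ring.
Qed.

(** The jump of [green'] at the origin is responsible for the indicator
    function. *)
Lemma green'_increment (y s x : R) : s <= x -> y != s -> y != x ->
  green' (x - y) - green' (s - y) =
  k ^+ 2 * \int[leb]_(t in `]s, x[) green (t - y) - \1_(`]s, x[) y.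
Proof.
move=> sx ys yx; rewrite indicE mem_setE in_itv/= /green'.
have [{}ys|sy|e] := ltgtP y s; last by rewrite e eqxx in ys.
  rewrite (green_integral_right (ltW ys) sx).2 subr0 !gtr0_sg ?subr_gt0//.
    by ring.
  exact: lt_le_trans sx.
have [{}yx|xy|e] := ltgtP y x; last by rewrite e eqxx in yx.
- rewrite (@Rintegral_oo_split _ _ _ _ y) ?ltW//; last exact: green_integrable_oo.
  rewrite mulrDr.
  rewrite (green_integral_left (lexx y) (ltW sy)).2 (green_integral_right (lexx y) (ltW yx)).2.
  rewrite subrr normr0 mulr0 oppr0 expR0 gtr0_sg ?subr_gt0// ltr0_sg ?subr_lt0//.
  by rewrite /=; field.
- rewrite (green_integral_left (ltW xy) sx).2 subr0 !ltr0_sg ?subr_lt0//.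
  by ring.
Qed.

End kernels.

(** * Convolution of exponentially decaying kernels with densities *)

Section exponential_kernel.
Variables (R : realType) (k : R).
Hypothesis k0 : 0 < k.
Local Notation RT := (measurableTypeR R).

Lemma measurable_expR_abs (y : R) :
  measurable_fun [set: RT] (fun t : RT => expR (- (k * `|t - y|))).
Proof.
apply: measurableT_comp => //; apply: measurable_funN.
apply: measurable_funM => //; apply: measurableT_comp => //.
exact: measurable_funB.
Qed.

Lemma integral_expR_abs (y : R) :
  (\int[leb]_t (expR (- (k * `|t - y|)))%:E = (2 / k)%:E)%E.
Proof.
pose F (n : nat) := (`]y - n%:R, y + n%:R[)%classic : set R.
have bF : \bigcup_n F n = [set: R].
  apply/seteqP; split=> // t _.
  have [n tn] : exists n : nat, `|t - y| < n%:R.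
    have [N _ /(_ N (leqnn N)) /= hN] := nbhs_infty_gtr `|t - y|.
    by exists N.
  exists n => //; rewrite /F /= in_itv/=.
  move: tn; rewrite ltr_norml => /andP[h1 h2].
  by apply/andP; split; lra.
have nd : {homo F : n m / (n <= m)%N >-> (n <= m)%O}.
  move=> n m nm; apply/subsetPset => t; rewrite /F /= !in_itv/=.
  have : (n%:R : R) <= m%:R by rewrite ler_nat.
  by move=> h /andP[h1 h2]; apply/andP; split; lra.
pose f t := (expR (- (k * `|t - y|)))%:E.
have mf : measurable_fun [set: RT] (f : RT -> \bar R).
  by apply/measurable_EFinP; exact: measurable_expR_abs.
have h := @ge0_nondecreasing_set_cvg_integral _ RT R F f leb nd _ _ _.
have {}h : (\int[leb]_(x in F i) f x)%E @[i --> \oo] --> (\int[leb]_t f t)%E.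
  rewrite -bF; apply: h => //.
  - by move=> i; exact: measurable_itv.
  - by move=> i; apply: measurable_funTS; exact: mf.
  - by move=> i x _; rewrite lee_fin expR_ge0.
have e n : (\int[leb]_(x in F n) f x)%E = (2 / k * (1 - expR (- (k * n%:R))))%:E.
  have n0 : (0 : R) <= n%:R by [].
  have i0 := green_integrable_oo k0 y (y - n%:R) (y + n%:R).
  have mF : measurable (F n : set RT) by exact: measurable_itv.
  have i1 : leb.-integrable (F n) (EFin \o (fun t => 2 * k * green k (t - y))).
    exact: (integrableZl mF (2 * k) i0).
  transitivity (\int[leb]_(t in F n) (2 * k * green k (t - y)))%:E.
    rewrite /Rintegral fineK; last exact: (integrable_fin_num mF i1).
    apply: eq_integral => t _; rewrite /f /green; congr EFin.
    by field; rewrite gt_eqF.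
  congr EFin; rewrite RintegralZl// (@Rintegral_oo_split _ _ _ _ y)//; [|lra|lra].
  have yl : y - n%:R <= y by lra.
  have yr : y <= y + n%:R by lra.
  have := (green_integral_left k0 (lexx y) yl).2.
  have := (green_integral_right k0 (lexx y) yr).2.
  have -> : y - n%:R - y = - n%:R by ring.
  have -> : y + n%:R - y = n%:R by ring.
  rewrite subrr normrN normr0 mulr0 oppr0 expR0 ger0_norm//.
  set E := expR _; set A := \int[leb]_(t in _) _; set B := \int[leb]_(t in _) _.
  move=> hA hB.
  have -> : A = (2^-1 * 1 - 2^-1 * E) / k ^+ 2.
    by rewrite -hA; field; rewrite gt_eqF.
  have -> : B = (2^-1 * 1 - 2^-1 * E) / k ^+ 2.
    by rewrite -hB; field; rewrite gt_eqF.
  by field; rewrite gt_eqF.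
have h2 : (\int[leb]_(x in F i) f x)%E @[i --> \oo] --> (2 / k)%:E.
  under eq_fun do rewrite e.
  apply: cvg_EFin; first exact: nearW.
  rewrite -[X in _ --> X]mulr1; apply: cvgMr.
  rewrite -[X in _ --> X]subr0; apply: cvgB; first exact: cvg_cst.
  have -> : (fun n => expR (- (k * n%:R))) = (fun n => expR (- k) ^+ n).
    by apply/funext => n; rewrite -expRM_natl mulrN mulrC.
  by apply: cvg_expr; rewrite ger0_norm ?expR_ge0// expR_lt1 oppr_lt0.
exact: cvg_unique h h2.
Qed.

Lemma rintegrable_expR_abs (y : R) :
  rintegrable leb (fun t => expR (- (k * `|t - y|))).
Proof.
apply/integrableP; split.
  by apply/measurable_EFinP; exact: measurable_expR_abs.
under eq_integral do rewrite gee0_abs ?lee_fin ?expR_ge0//.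
by rewrite integral_expR_abs ltry.
Qed.

Lemma Rintegral_expR_abs (y : R) :
  \int[leb]_t expR (- (k * `|t - y|)) = 2 / k.
Proof. by rewrite /Rintegral integral_expR_abs. Qed.

End exponential_kernel.

Section convolution.
Variables (R : realType) (k : R).
Hypothesis k0 : 0 < k.
Local Notation RT := (measurableTypeR R).
Variable m : {sigma_finite_measure set RT -> \bar R}.
Variable g : RT -> R.
Hypothesis mg : measurable_fun [set: RT] g.
Hypothesis gi : rintegrable m (fun y => expR (- (k * `|y|)) * `|g y|).

Definition convol (K : R -> R) (x : R) : R := \int[m]_y (K (x - y) * g y).

Variables (K : R -> R) (c : R).
Hypothesis mK : measurable_fun [set: RT] K.
Hypothesis Kc : forall t, `|K t| <= c * expR (- (k * `|t|)).

Let c0 : 0 <= c.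
Proof.
have := le_trans (normr_ge0 _) (Kc 0).
by rewrite normr0 mulr0 oppr0 expR0 mulr1.
Qed.

Lemma expR_abs_shift (t y : R) :
  expR (- (k * `|t - y|)) <= expR (k * `|t|) * expR (- (k * `|y|)).
Proof.
rewrite -expRD ler_expR; have := ler_normD (y - t) t.
by rewrite subrK distrC => /(ler_wpM2l (ltW k0)); rewrite mulrDr; lra.
Qed.

Let Kg_le t y : `|K (t - y) * g y| <=
  (c * expR (k * `|t|)) * (expR (- (k * `|y|)) * `|g y|).
Proof.
rewrite normrM mulrA ler_wpM2r// (le_trans (Kc _))// -mulrA ler_wpM2l//.
exact: expR_abs_shift.
Qed.

Let mKg : measurable_fun [set: RT * RT] (fun z : RT * RT => K (z.1 - z.2) * g z.2).
Proof.
apply: measurable_funM; last exact: measurableT_comp.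
by apply: measurableT_comp => //; exact: measurable_funB.
Qed.

Lemma conv_integrable x : rintegrable m (fun y => K (x - y) * g y).
Proof.
apply: (@rintegrable_le _ RT R m _
  (fun y => (c * expR (k * `|x|)) * (expR (- (k * `|y|)) * `|g y|))).
- exact: measurableT_comp mKg (pair1_measurable x).
- exact: rintegrableZ.
- exact: Kg_le.
Qed.

(** Measurability in [x] comes from Fubini's theorem, which requires an
    integrable function: hence a decaying weight, removed afterwards. *)
Lemma measurable_conv : measurable_fun [set: RT] (convol K : RT -> R).
Proof.
pose h (t : RT) := expR (- (2 * k * `|t - 0|)).
pose f (z : RT * RT) := h z.1 * (K (z.1 - z.2) * g z.2).
have mh : measurable_fun [set: RT] h by exact: measurable_expR_abs.
have mf : measurable_fun setT f.
  apply: measurable_funM; last exact: mKg.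
  exact: measurableT_comp.
have fi : rintegrable leb (fun t => \int[m]_y f (t, y)).
  apply: (@rintegrable_fubini1 _ _ _ _ _ leb m f
    (fun t => c * expR (- (k * `|t - 0|))) _ mf _ gi).
- by apply: rintegrableZ; exact: rintegrable_expR_abs.
- move=> t y; rewrite /f /h /= normrM (ger0_norm (expR_ge0 _)).
  rewrite (le_trans (ler_wpM2l (expR_ge0 _) (Kg_le _ _)))//.
  rewrite [leLHS]mulrA ler_wpM2r ?mulr_ge0 ?expR_ge0//.
  rewrite mulrCA ler_wpM2l// -expRD subr0 ler_expR.
  by have := normr_ge0 t; nra.
have : measurable_fun [set: RT] (fun t : RT => expR (2 * k * `|t|)).
  by apply: measurableT_comp => //; apply: measurable_funM => //; apply: measurableT_comp.
move=> me; have -> : convol K = fun t => expR (2 * k * `|t|) * \int[m]_y f (t, y).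
  apply/funext => t; rewrite /f /= RintegralZl//; last exact: conv_integrable.
  by rewrite mulrA /h subr0 -expRD subrr expR0 mul1r.
by apply: measurable_funM => //; exact: rintegrable_measurable fi.
Qed.

(** Exchanging the two integrals reduces the increments of a convolution to
    those of its kernel. *)
Lemma conv_fubini s x : s <= x ->
  \int[leb]_(t in `]s, x[) convol K t =
  \int[m]_y ((\int[leb]_(t in `]s, x[) K (t - y)) * g y) /\
  leb.-integrable `]s, x[ (EFin \o convol K) /\
  rintegrable m (fun y => (\int[leb]_(t in `]s, x[) K (t - y)) * g y).
Proof.
move=> sx.
pose f (z : RT * RT) := \1_(`]s, x[) z.1 * (K (z.1 - z.2) * g z.2).
have mf : measurable_fun setT f.
  apply: measurable_funM; last exact: mKg.
  exact: measurableT_comp.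
pose C := c * expR (k * (`|s| + `|x|)).
have ai : rintegrable leb (fun t => C * \1_(`]s, x[) t).
  by apply: rintegrableZ; exact: rintegrable_indic_oo.
have fac t y : `|f (t, y)| <= C * \1_(`]s, x[) t * (expR (- (k * `|y|)) * `|g y|).
  rewrite /f /= normrM indicE; case: (boolP (t \in _)) => [|_].
    rewrite inE/= in_itv/= normr1 mul1r mulr1 => /andP[st tx].
    rewrite (le_trans (Kg_le _ _))// ler_wpM2r ?mulr_ge0 ?expR_ge0//.
    rewrite ler_wpM2l// ler_expR ler_pM2l// ler_norml.
    have := ler_norm s; have := ler_norm x; have := ler_norm (- s).
    have := normr_ge0 x; have := normr_ge0 s; have := ler_norm (- x).
    by rewrite !normrN => *; apply/andP; split; lra.
  by rewrite normr0 !mul0r mulr0 mul0r.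
have e1 t : \int[m]_y f (t, y) = \1_(`]s, x[) t * convol K t.
  by rewrite /f /= RintegralZl//; exact: conv_integrable.
have e2 y : \int[leb]_t f (t, y) = (\int[leb]_(t in `]s, x[) K (t - y)) * g y.
  rewrite [in RHS]Rintegral_indic -RintegralZr//; last first.
    apply: (@bounded_integrable_oo _ (fun t => K (t - y)) c).
      by apply: measurableT_comp mK _; exact: measurable_shift.
    by move=> t; rewrite (le_trans (Kc _))// ler_piMr// (expR_abs_le1 k0).
  by apply: eq_Rintegral => t _; rewrite /f mulrA.
split; [|split].
- rewrite Rintegral_indic; under eq_Rintegral do rewrite -e1.
  rewrite (fubini_dominated mf ai gi fac); apply: eq_Rintegral => y _.
  exact: e2.
- apply/rintegrable_indicE => //.
  have := rintegrable_fubini1 mf ai gi fac.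
  by congr rintegrable; apply/funext.
- have mf' : measurable_fun setT (fun z : RT * RT => f (z.2, z.1)).
    by apply: measurableT_comp mf _; exact: measurable_fun_pair.
  have := rintegrable_fubini1 mf' gi ai _.
  rewrite (_ : (fun y => _) = fun y => \int[leb]_t f (t, y))//.
  have -> : (fun y => \int[leb]_t f (t, y)) =
    (fun y => (\int[leb]_(t in `]s, x[) K (t - y)) * g y) by apply/funext.
  by apply=> y t /=; rewrite mulrC.
Qed.

End convolution.

Section ae_eq.
Context d (T : measurableType d) (R : realType).
Variable m : {measure set T -> \bar R}.

Lemma ae_eq_Rintegral (f g : T -> R) : rintegrable m f -> rintegrable m g ->
  {ae m, forall x, f x = g x} -> \int[m]_x f x = \int[m]_x g x.
Proof.
move=> fi gi fg; rewrite /Rintegral; congr fine.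
apply: ae_eq_integral => //; [exact: measurable_int fi|exact: measurable_int gi|].
by apply: filterS fg => x /= -> .
Qed.

End ae_eq.

Section convolution_increments.
Variables (R : realType) (k : R).
Hypothesis k0 : 0 < k.
Local Notation RT := (measurableTypeR R).
Variable m : {sigma_finite_measure set RT -> \bar R}.
Variable g : RT -> R.
Hypothesis mg : measurable_fun [set: RT] g.
Hypothesis gi : rintegrable m (fun y => expR (- (k * `|y|)) * `|g y|).

Let green_le (t : R) : `|green k t| <= (2 * k)^-1 * expR (- (k * `|t|)).
Proof. by rewrite norm_greenE. Qed.

Let gI := conv_integrable k0 mg gi (measurable_green k) green_le.
Let gI' := conv_integrable k0 mg gi (measurable_green' k) (norm_green'_le k).

Lemma conv_green_increment (s x : R) : s <= x ->
  convol m g (green k) x - convol m g (green k) s =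
  \int[leb]_(t in `]s, x[) convol m g (green' k) t.
Proof.
move=> sx.
rewrite (conv_fubini k0 mg gi (measurable_green' k) (norm_green'_le k) sx).1.
apply: (etrans (esym (RintegralB measurableT (gI x) (gI s)))).
by apply: eq_Rintegral => y _; rewrite -mulrBl green_increment.
Qed.

Lemma density_integrable_oo (s x : R) :
  rintegrable m (fun y => \1_(`]s, x[) y * g y).
Proof.
apply: (@rintegrable_le _ RT R m _ (fun y =>
  expR (k * (`|s| + `|x|)) * (expR (- (k * `|y|)) * `|g y|))).
- exact: measurable_funM.
- exact: rintegrableZ.
move=> y; rewrite normrM mulrA ler_wpM2r// indicE.
case: (boolP (y \in _)) => [|_]; last first.
  by rewrite normr0 mulr_ge0 ?expR_ge0.
rewrite inE/= in_itv/= normr1 => /andP[sy yx].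
rewrite -expRD -expR0 ler_expR -mulrBr mulr_ge0 ?(ltW k0)// subr_ge0.
have := ler_norm s; have := ler_norm x; have := ler_norm (- s).
have := normr_ge0 x; have := normr_ge0 s; have := ler_norm (- x).
by rewrite !normrN ler_norml => *; apply/andP; split; lra.
Qed.

(** The jump of the kernel contributes the integral of the density over the
    open interval.  The end points must carry no mass because there the kernel
    takes a mean value. *)
Lemma conv_green'_increment (s x : R) : s <= x ->
  {ae m, forall y, g y != 0 -> y != s /\ y != x} ->
  convol m g (green' k) x - convol m g (green' k) s =
  k ^+ 2 * \int[leb]_(t in `]s, x[) convol m g (green k) t -
  \int[m]_(y in `]s, x[) g y.
Proof.
move=> sx ae; have gxi := density_integrable_oo s x.
have [e [ci Gi]] := conv_fubini k0 mg gi (measurable_green k) green_le sx.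
rewrite e; apply: (etrans (esym (RintegralB measurableT (gI' x) (gI' s)))).
rewrite (@Rintegral_indic _ RT R m `]s, x[ g) -RintegralZl//.
rewrite -RintegralB//; last exact: rintegrableZ.
apply: ae_eq_Rintegral.
- by apply: rintegrableB; [exact: gI'|exact: gI'].
- by apply: rintegrableB => //; exact: rintegrableZ.
apply: filterS ae => y hy; rewrite -mulrBl.
have [->|g0] := eqVneq (g y) 0; first by rewrite !mulr0 subr0.
have [ys yx] := hy g0.
by rewrite green'_increment// mulrBl mulrA.
Qed.

End convolution_increments.

(** Schur's test.  The factorisation [g^2 <= w1 w2] covers both the square
    integrable densities ([w1 = 1] and [w2 = g^2]) and the integrable ones
    ([w1 = w2 = |g|]). *)
Section young.
Variables (R : realType) (k : R).
Hypothesis k0 : 0 < k.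
Local Notation RT := (measurableTypeR R).
Variable m : {sigma_finite_measure set RT -> \bar R}.
Variables (g w1 w2 : RT -> R) (C : R).
Hypothesis mg : measurable_fun [set: RT] g.
Hypotheses (mw1 : measurable_fun [set: RT] w1) (w2i : rintegrable m w2).
Hypotheses (w10 : forall y, 0 <= w1 y) (w20 : forall y, 0 <= w2 y).
Hypothesis gw : forall y, g y ^+ 2 <= w1 y * w2 y.
Hypothesis w1i : forall x, rintegrable m (fun y => expR (- (k * `|x - y|)) * w1 y).
Hypothesis w1C : forall x, \int[m]_y (expR (- (k * `|x - y|)) * w1 y) <= C.
Variables (K : R -> R) (c : R).
Hypothesis mK : measurable_fun [set: RT] K.
Hypothesis Kc : forall t, `|K t| <= c * expR (- (k * `|t|)).

Let E (x y : R) := expR (- (k * `|x - y|)).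

Let mw2 : measurable_fun [set: RT] w2.
Proof. exact: rintegrable_measurable w2i. Qed.

Let mE x : measurable_fun [set: RT] (E x : RT -> R).
Proof.
rewrite (_ : E x = fun y => expR (- (k * `|y - x|))).
  exact: measurable_expR_abs.
by apply/funext => y; rewrite /E distrC.
Qed.

Let Ew2 x : rintegrable m (fun y => E x y * w2 y).
Proof.
apply: (@rintegrable_bounded _ RT R m (E x) w2 1) => // y.
by rewrite ger0_norm ?expR_ge0// (expR_abs_le1 k0).
Qed.

Let Eg_le x y : `|E x y * g y| <= 2^-1 * (E x y * w1 y + E x y * w2 y).
Proof.
rewrite normrM (ger0_norm (expR_ge0 _)) -mulrDr mulrCA ler_wpM2l ?expR_ge0//.
have := gw y; have := w10 y; have := w20 y; have := normr_ge0 (g y).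
rewrite -real_normK ?num_real//; set a := `|g y|; set b := w1 y; set d := w2 y.
move=> a0 d0 b0 h; rewrite mulrC ler_pdivlMr// -(@ler_pXn2r _ 2%N) ?nnegrE//.
- have := sqr_ge0 (b - d); rewrite !expr2 in h *; nra.
- by rewrite mulr_ge0.
- by rewrite addr_ge0.
Qed.

Lemma density_integrable : rintegrable m (fun y => expR (- (k * `|y|)) * `|g y|).
Proof.
have := @rintegrable_le _ RT R m (fun y => E 0 y * g y) _
  (measurable_funM (mE 0) mg)
  (rintegrableZ 2^-1 (rintegrableD (w1i 0) (Ew2 0))) (Eg_le 0).
move=> /rintegrable_norm.
congr rintegrable; apply/funext => y.
by rewrite normrM /E sub0r normrN (ger0_norm (expR_ge0 _)).
Qed.

Let conv_sqr_le x : convol m g K x ^+ 2 <= c ^+ 2 * C * \int[m]_y (E x y * w2 y).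
Proof.
pose f1 y := Num.sqrt (E x y * w1 y); pose f2 y := Num.sqrt (E x y * w2 y).
have Ew1_ge0 y : 0 <= E x y * w1 y by rewrite mulr_ge0// expR_ge0.
have Ew2_ge0 y : 0 <= E x y * w2 y by rewrite mulr_ge0// expR_ge0.
have f1E : (fun y => f1 y ^+ 2) = (fun y => E x y * w1 y).
  by apply/funext => y; rewrite sqr_sqrtr.
have f2E : (fun y => f2 y ^+ 2) = (fun y => E x y * w2 y).
  by apply/funext => y; rewrite sqr_sqrtr.
have msqrt : measurable_fun [set: R] (@Num.sqrt R).
  exact: continuous_measurable_fun (@sqrt_continuous R).
have si1 : square_integrable m f1.
  split; last by rewrite f1E; exact: w1i.
  by apply: (measurableT_comp msqrt); exact: measurable_funM.
have si2 : square_integrable m f2.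
  split; last by rewrite f2E; exact: Ew2.
  by apply: (measurableT_comp msqrt); exact: measurable_funM.
have c0 : 0 <= c.
  have := le_trans (normr_ge0 _) (Kc 0).
  by rewrite normr0 mulr0 oppr0 expR0 mulr1.
have le1 : `|convol m g K x| <= c * \int[m]_y (f1 y * f2 y).
  have i12 := square_integrableM si1 si2.
  rewrite -RintegralZl//; apply: le_norm_Rintegral.
  - exact (conv_integrable k0 mg density_integrable mK Kc x).
  - exact: rintegrableZ.
  move=> y; rewrite normrM.
  apply: (@le_trans _ _ (c * E x y * `|g y|)).
    by rewrite ler_wpM2r.
  rewrite -mulrA ler_wpM2l// /f1 /f2 -sqrtrM// mulrACA -expr2.
  rewrite sqrtrM ?sqr_ge0// sqrtr_sqr (ger0_norm (expR_ge0 _)).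
  by rewrite ler_wpM2l ?expR_ge0// -sqrtr_sqr ler_sqrt ?mulr_ge0.
have := Rintegral_cauchy_schwarz si1 si2.
rewrite f1E f2E => cs.
rewrite -real_normK ?num_real//.
apply: (@le_trans _ _ ((c * \int[m]_y (f1 y * f2 y)) ^+ 2)).
  by rewrite ler_pXn2r ?nnegrE// (le_trans (normr_ge0 _) le1).
rewrite exprMn -mulrA ler_wpM2l ?sqr_ge0// (le_trans cs)//.
by apply: ler_wpM2r; [exact: Rintegral_ge0|exact: w1C].
Qed.

Let rintEw2 : rintegrable leb (fun x => \int[m]_y (E x y * w2 y)) /\
  \int[leb]_x \int[m]_y (E x y * w2 y) = 2 / k * \int[m]_y w2 y.
Proof.
pose G (x : RT) : R := \int[m]_y (E x y * w2 y).
pose f (z : RT * RT) : \bar R := (E z.1 z.2 * w2 z.2)%:E.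
have f0 z : (0 <= f z)%E by rewrite lee_fin mulr_ge0// expR_ge0.
have mf : measurable_fun [set: RT * RT] f.
  apply/measurable_EFinP; apply: measurable_funM; last exact: measurableT_comp.
  apply: measurableT_comp => //; apply: measurable_funN.
  apply: measurable_funM => //; apply: measurableT_comp => //.
  exact: measurable_funB.
have FE : fubini_F m f = EFin \o G.
  by apply/funext => x; rewrite /fubini_F /f /= rintegrable_fin.
have GE : fubini_G leb f = (fun y => (2 / k)%:E * (w2 y)%:E)%E.
  apply/funext => y; rewrite /fubini_G /f /=.
  under eq_integral do rewrite EFinM.
  rewrite ge0_integralZr// ?lee_fin//.
  - by rewrite integral_expR_abs.
  - by apply/measurable_EFinP; exact: measurable_expR_abs.
  - by move=> t _; rewrite lee_fin expR_ge0.
have h : (\int[leb]_x (EFin \o G) x)%E = (2 / k * \int[m]_y w2 y)%:E.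
  rewrite EFinM -rintegrable_fin// -integralZl// -FE -GE.
  exact: (@fubini_tonelli _ _ RT RT R leb m f mf f0).
have i : rintegrable leb G.
  apply/integrableP; split.
    by rewrite -FE; exact: measurable_fun_fubini_tonelli_F.
  have -> : (\int[leb]_x `|(EFin \o G) x| = \int[leb]_x (EFin \o G) x)%E.
    apply: eq_integral => x _; rewrite gee0_abs// lee_fin.
    by apply: Rintegral_ge0 => y _; rewrite mulr_ge0// expR_ge0.
  by rewrite h ltry.
by split=> //; rewrite {1}/Rintegral /= h.
Qed.

Lemma conv_square_integrable : square_integrable leb (convol m g K) /\
  \int[leb]_x (convol m g K x ^+ 2) <= c ^+ 2 * C * (2 / k) * \int[m]_y w2 y.
Proof.
have mc := measurable_conv k0 mg density_integrable mK Kc.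
have [i e] := rintEw2.
have ci : rintegrable leb (fun x => convol m g K x ^+ 2).
  apply: (@rintegrable_le _ RT R leb _
    (fun x => c ^+ 2 * C * \int[m]_y (E x y * w2 y))).
  - exact: measurable_funX.
  - exact: rintegrableZ.
  - by move=> x; rewrite ger0_norm ?sqr_ge0// conv_sqr_le.
split; first by split.
rewrite -mulrA -e -RintegralZl//; apply: le_Rintegral => //.
exact: rintegrableZ.
Qed.

End young.

(** * Linear integral equations with a small kernel *)

Section fixed_point.
Variable R : realType.
Local Notation RT := (measurableTypeR R).
Variable m : {sigma_finite_measure set RT -> \bar R}.
Variables (b : RT -> R) (K : RT * RT -> R) (c : R).
Hypothesis bi : rintegrable m b.
Hypothesis mK : measurable_fun [set: RT * RT] K.
Hypothesis Kc : forall z, `|K z| <= c.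

Let mb : measurable_fun [set: RT] b. Proof. exact: rintegrable_measurable bi. Qed.

Lemma bounded_mul_integrable (p : RT -> R) (M : R) :
  measurable_fun [set: RT] p -> (forall y, `|p y| <= M) ->
  rintegrable m (fun y => b y * p y).
Proof.
move=> mp pM; have := rintegrable_bounded mp pM bi.
by congr rintegrable; apply/funext => y; rewrite mulrC.
Qed.

Lemma kernel_integrable (p : RT -> R) x : rintegrable m p ->
  rintegrable m (fun y => K (x, y) * p y).
Proof.
move=> ip; apply: (@rintegrable_bounded _ RT R m _ p c) => //.
exact: measurableT_comp mK (pair1_measurable x).
Qed.

(** As for convolutions, an integrable weight makes Fubini's theorem give the
    measurability. *)
Lemma measurable_kernel_integral (p : RT -> R) : rintegrable m p ->
  measurable_fun [set: RT] (fun x : RT => \int[m]_y (K (x, y) * p y)).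
Proof.
move=> ip; have mp := rintegrable_measurable ip.
pose h (t : RT) := expR (- (1 * `|t - 0|)).
pose f (z : RT * RT) := h z.1 * (K z * p z.2).
have mh : measurable_fun [set: RT] h by exact: measurable_expR_abs.
have mf : measurable_fun setT f.
  apply: measurable_funM; first exact: measurableT_comp.
  by apply: measurable_funM => //; exact: measurableT_comp.
have hi : rintegrable leb h by exact: rintegrable_expR_abs.
have fi : rintegrable leb (fun t => \int[m]_y f (t, y)).
  apply: (@rintegrable_fubini1 _ _ _ _ _ leb m f h (fun y => c * `|p y|) mf hi).
    by apply: rintegrableZ; exact: rintegrable_norm.
  move=> x y; rewrite /f /= !normrM (ger0_norm (expR_ge0 _)).
  by rewrite ler_wpM2l ?expR_ge0// ler_wpM2r.
have -> : (fun x : RT => \int[m]_y (K (x, y) * p y)) =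
    fun t => expR (`|t|) * \int[m]_y f (t, y).
  apply/funext => t; rewrite /f /= RintegralZl//; last exact: kernel_integrable.
  by rewrite mulrA /h subr0 mul1r -expRD subrr expR0 mul1r.
apply: measurable_funM; last exact: rintegrable_measurable fi.
by apply: measurableT_comp => //; exact: measurableT_comp.
Qed.

Lemma kernel_integral_le (p : RT -> R) (M : R) x : 0 <= c ->
  measurable_fun [set: RT] p -> (forall y, `|p y| <= M) ->
  `|\int[m]_y (K (x, y) * (b y * p y))| <= c * \int[m]_y `|b y| * M.
Proof.
move=> c0 mp pM.
have ibp := bounded_mul_integrable mp pM.
have inb := rintegrable_norm bi.
rewrite mulrAC -RintegralZl//; apply: le_norm_Rintegral.
- exact: kernel_integrable.
- exact: rintegrableZ.
- move=> y; rewrite !normrM -mulrA ler_pM// ?mulr_ge0// mulrC.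
  by rewrite ler_wpM2r.
Qed.

Hypothesis contraction : c * \int[m]_y `|b y| <= 2^-1.
Variables (F : RT -> R) (M : R).
Hypothesis mF : measurable_fun [set: RT] F.
Hypothesis FM : forall x, `|F x| <= M.

Let c0 : 0 <= c. Proof. exact: le_trans (normr_ge0 _) (Kc (0, 0)). Qed.
Let M0 : 0 <= M. Proof. exact: le_trans (normr_ge0 _) (FM 0). Qed.

Let step (p : RT -> R) x := F x + \int[m]_y (K (x, y) * (b y * p y)).
Let P_ n := iter n step (fun=> 0).

Let half_le (p : RT -> R) (N : R) x : 0 <= N ->
  measurable_fun [set: RT] p -> (forall y, `|p y| <= N) ->
  `|\int[m]_y (K (x, y) * (b y * p y))| <= 2^-1 * N.
Proof.
move=> N0 mp pN; rewrite (le_trans (kernel_integral_le _ _ mp pN))//.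
by rewrite ler_wpM2r.
Qed.

Let P_prop n : measurable_fun [set: RT] (P_ n) /\ forall x, `|P_ n x| <= 2 * M.
Proof.
elim: n => [|n [mP PM]].
  by split=> [|x]; [exact: measurable_cst|rewrite normr0 mulr_ge0].
split.
  apply: measurable_funD => //; apply: measurable_kernel_integral.
  exact: bounded_mul_integrable mP PM.
move=> x; rewrite /P_ iterS -/(P_ n) /step (le_trans (ler_normD _ _))//.
have := FM x; have := half_le x (mulr_ge0 (ltW (ltr0Sn _ 1)) M0) mP PM.
by lra.
Qed.

Let diff_le (p q : RT -> R) (N : R) x : 0 <= N ->
  (exists L, measurable_fun [set: RT] p /\ forall x, `|p x| <= L) ->
  (exists L, measurable_fun [set: RT] q /\ forall x, `|q x| <= L) ->
  (forall y, `|p y - q y| <= N) ->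
  `|step p x - step q x| <= 2^-1 * N.
Proof.
move=> N0 [Lp [mp pL]] [Lq [mq qL]] pq.
have -> : step p x - step q x = \int[m]_y (K (x, y) * (b y * (p y - q y))).
  rewrite /step opprD addrACA subrr add0r -RintegralB//.
  - by apply: eq_Rintegral => y _; ring.
  - by apply: kernel_integrable; exact: bounded_mul_integrable mp pL.
  - by apply: kernel_integrable; exact: bounded_mul_integrable mq qL.
by apply: half_le => //; exact: measurable_funB.
Qed.

Let P_bounded n : exists L, measurable_fun [set: RT] (P_ n) /\ forall x, `|P_ n x| <= L.
Proof. by exists (2 * M); exact: P_prop. Qed.

Let P_diff n x : `|P_ n.+1 x - P_ n x| <= M * 2^-1 ^+ n.
Proof.
elim: n x => [|n IH] x.
  rewrite expr0 mulr1 /P_ /= subr0 /step.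
  under eq_Rintegral do rewrite !mulr0.
  by rewrite Rintegral_cst// mul0r addr0.
rewrite exprS mulrCA; apply: (@diff_le (P_ n.+1) (P_ n)).
- by rewrite mulr_ge0// exprn_ge0.
- exact: P_bounded.
- exact: P_bounded.
- exact: IH.
Qed.

Let P_cauchy j n x : `|P_ (j + n)%N x - P_ n x| <= 2 * M * 2^-1 ^+ n.
Proof.
elim: j n => [|j IH] n.
  by rewrite add0n subrr normr0 !mulr_ge0// exprn_ge0.
have := IH n.+1; have := P_diff n x; rewrite addSnnS exprS.
have -> : P_ (j + n.+1)%N x - P_ n x =
  (P_ (j + n.+1)%N x - P_ n.+1 x) + (P_ n.+1 x - P_ n x) by rewrite addrA subrK.
move=> h1 h2; rewrite (le_trans (ler_normD _ _))//; lra.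
Qed.

Let P_cvg x : cvgn (fun n => P_ n x).
Proof.
pose w n := P_ n.+1 x - P_ n x.
have -> : (fun n => P_ n x) = series w.
  apply/funext => n; elim: n => [|n IH]; first by rewrite /series /= big_geq.
  by rewrite seriesSr -IH /w addrC subrK.
apply: normed_cvg; apply: nondecreasing_is_cvgn.
  by apply/nondecreasing_seqP => n; rewrite /= seriesSr lerDl.
exists (M * 2) => _ [n _ <-].
apply: (@le_trans _ _ (\sum_(0 <= k < n) M * 2^-1 ^+ k)).
  by apply: ler_sum => k _; exact: P_diff.
by rewrite -big_distrr/= ler_wpM2l// sum_half_le2.
Qed.

Let P x := limn (fun n => P_ n x).

Let P_limit n x : `|P x - P_ n x| <= 2 * M * 2^-1 ^+ n.
Proof.
have h : (fun j => `|P_ (j + n)%N x - P_ n x|) @ \oo --> `|P x - P_ n x|.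
  apply: cvg_norm; apply: cvgB; last exact: cvg_cst.
  by rewrite (cvg_shiftn n (fun j => P_ j x)); exact: P_cvg.
rewrite -(cvg_lim _ h)//; apply: limr_le; first by apply/cvg_ex; exists (`|P x - P_ n x|).
by apply: nearW => j; exact: P_cauchy.
Qed.

(** Picard iteration: the integral operator halves the supremum norm. *)
Lemma fixed_point : exists P : RT -> R, [/\ measurable_fun [set: RT] P,
  forall x, `|P x| <= 2 * M &
  forall x, P x = F x + \int[m]_y (K (x, y) * (b y * P y))].
Proof.
have mP : measurable_fun [set: RT] P.
  by apply: (measurable_fun_cvg (fun n => (P_prop n).1)) => x _; exact: P_cvg.
have PM x : `|P x| <= 2 * M.
  by have := P_limit 0 x; rewrite /P_ /= subr0 expr0 mulr1.
exists P; split=> // x.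
suff : `|P x - step P x| <= 0 by rewrite normr_le0 subr_eq0 => /eqP.
apply: (@geometric_le0 _ _ (4 * M)) => n.
have -> : P x - step P x = (P x - P_ n.+1 x) + (step (P_ n) x - step P x).
  by rewrite addrA subrK.
rewrite (le_trans (ler_normD _ _))//.
have N0 : 0 <= 2 * M * 2^-1 ^+ n by rewrite !mulr_ge0// exprn_ge0.
have h1 := P_limit n.+1 x.
have h2 : `|step (P_ n) x - step P x| <= 2^-1 * (2 * M * 2^-1 ^+ n).
  apply: diff_le => //; first by exists (2 * M).
  by move=> y; rewrite distrC; exact: P_limit.
by rewrite exprS in h1; move: N0 h1 h2; set e := 2^-1 ^+ n; lra.
Qed.

End fixed_point.

(** * Solution formula for the resolvent equation *)

Section resolvent_equation.
Variables (R : realType) (k : R).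
Hypothesis k0 : 0 < k.
Local Notation RT := (measurableTypeR R).

Lemma measurable_shift_sub (K : R -> R) (x : R) : measurable_fun [set: RT] K ->
  measurable_fun [set: RT] (fun y : RT => K (x - y)).
Proof.
by move=> mK; apply: (measurableT_comp mK); exact: measurable_funB.
Qed.

Lemma rintegrable_expR_abs_sub (x : R) :
  rintegrable leb (fun y => expR (- (k * `|x - y|))).
Proof.
have := rintegrable_expR_abs k0 x.
by congr rintegrable; apply/funext => y; rewrite distrC.
Qed.

Lemma Rintegral_expR_abs_sub (x : R) :
  \int[leb]_y (expR (- (k * `|x - y|))) = 2 / k.
Proof.
rewrite -(Rintegral_expR_abs k0 x); apply: eq_Rintegral => y _.
by rewrite distrC.
Qed.

Lemma ae_neq (x : R) : {ae leb, forall y : RT, y != x}.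
Proof.
exists [set x]; split=> //; first exact: lebesgue_measure_set1.
by move=> y /= /negP; rewrite negbK => /eqP.
Qed.

Section kernel_bound.
Variables (K : R -> R) (c : R).
Hypothesis mK : measurable_fun [set: RT] K.
Hypothesis Kc : forall t, `|K t| <= c * expR (- (k * `|t|)).

Lemma L2_density_integrable (f : RT -> R) : square_integrable leb f ->
  rintegrable leb (fun y => expR (- (k * `|y|)) * `|f y|).
Proof.
move=> [mf fi].
apply: (@density_integrable _ _ k0 leb f (fun=> 1) (fun y => f y ^+ 2)) => //.
- by move=> y; exact: sqr_ge0.
- by move=> y; rewrite mul1r.
- move=> x; have := rintegrable_expR_abs_sub x.
  by congr rintegrable; apply/funext => y; rewrite mulr1.
Qed.

Lemma conv_L2 (f : RT -> R) : square_integrable leb f ->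
  square_integrable leb (convol leb f K) /\
  \int[leb]_x (convol leb f K x ^+ 2) <= c ^+ 2 * (2 / k) ^+ 2 * \int[leb]_y (f y ^+ 2).
Proof.
move=> [mf fi]; rewrite expr2 (mulrA (c ^+ 2)).
apply: (@conv_square_integrable _ _ k0 leb f (fun=> 1) (fun y => f y ^+ 2)) => //.
- by move=> y; exact: sqr_ge0.
- by move=> y; rewrite mul1r.
- move=> x; have := rintegrable_expR_abs_sub x.
  by congr rintegrable; apply/funext => y; rewrite mulr1.
- move=> x; under eq_Rintegral do rewrite mulr1.
  by rewrite Rintegral_expR_abs_sub.
Qed.

Lemma exp_weight_integrable (d : {sigma_finite_measure set RT -> \bar R})
    (g : RT -> R) (x : R) : rintegrable d g ->
  rintegrable d (fun y => expR (- (k * `|x - y|)) * `|g y|).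
Proof.
move=> gi; apply: (@rintegrable_bounded _ RT R d _ (fun y => `|g y|) 1).
- have -> : (fun y : RT => expR (- (k * `|x - y|))) =
      (fun y => expR (- (k * `|y - x|))).
    by apply/funext => y; rewrite distrC.
  exact: measurable_expR_abs.
- by move=> y; rewrite ger0_norm ?expR_ge0// (expR_abs_le1 k0).
- exact: rintegrable_norm.
Qed.

Lemma exp_density_integrable (d : {sigma_finite_measure set RT -> \bar R})
    (g : RT -> R) : rintegrable d g ->
  rintegrable d (fun y => expR (- (k * `|y|)) * `|g y|).
Proof.
move=> /(@exp_weight_integrable d g 0).
by congr rintegrable; apply/funext => y; rewrite sub0r normrN.
Qed.

Lemma conv_L1 (d : {sigma_finite_measure set RT -> \bar R}) (g : RT -> R) :
  rintegrable d g ->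
  square_integrable leb (convol d g K) /\
  \int[leb]_x (convol d g K x ^+ 2) <=
    c ^+ 2 * (2 / k) * (\int[d]_y `|g y|) ^+ 2.
Proof.
move=> gi; have mg := rintegrable_measurable gi.
rewrite expr2 (_ : c ^+ 2 * _ * _ =
  c ^+ 2 * (\int[d]_y `|g y|) * (2 / k) * (\int[d]_y `|g y|)); last by ring.
apply: (@conv_square_integrable _ _ k0 d g (fun y => `|g y|) (fun y => `|g y|)) => //.
- exact: measurableT_comp.
- exact: rintegrable_norm.
- by move=> y; rewrite -expr2 real_normK ?num_real.
- by move=> x; exact: exp_weight_integrable.
- move=> x; apply: le_Rintegral => //.
  + exact: exp_weight_integrable.
  + exact: rintegrable_norm.
  + by move=> y _; rewrite ler_piMl// (expR_abs_le1 k0).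
Qed.

End kernel_bound.

Let green_le (t : R) : `|green k t| <= (2 * k)^-1 * expR (- (k * `|t|)).
Proof. by rewrite norm_greenE. Qed.

Lemma green'_sqr_square_integrable (x : R) :
  square_integrable leb (fun y : RT => green' k (x - y)) /\
  \int[leb]_y (green' k (x - y) ^+ 2) = (4 * k)^-1.
Proof.
have k20 : 0 < 2 * k by rewrite mulr_gt0.
pose h (y : RT) : R := 4^-1 * expR (- (2 * k * `|y - x|)).
have hi : rintegrable leb h by apply: rintegrableZ; exact: rintegrable_expR_abs.
have mg := measurable_shift_sub x (measurable_green' k).
have sqrE y : green' k (x - y) ^+ 2 = (Num.sg (x - y)) ^+ 2 * h y.
  rewrite /green' /h sqrrN !exprMn distrC -mulrA; congr (_ * _).
  rewrite -expRM_natl mulrN (mulrA 2) mulrC; congr (_ * _).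
  by field.
have gi : rintegrable leb (fun y : RT => green' k (x - y) ^+ 2).
  apply: (@rintegrable_le _ RT R leb _ h) => //; first exact: measurable_funX.
  move=> y; have hy : 0 <= h y by rewrite mulr_ge0 ?expR_ge0.
  rewrite sqrE normrM (ger0_norm hy) ler_piMl// normrX normr_sg.
  by case: (_ == 0); rewrite ?expr0n ?expr1n.
split; first by split.
rewrite (@ae_eq_Rintegral _ RT R leb _ h gi hi); last first.
  apply: filterS (ae_neq x) => y yx; rewrite sqrE.
  by rewrite sqr_sg subr_eq0 eq_sym yx mul1r.
rewrite RintegralZl//; last exact: rintegrable_expR_abs.
by rewrite Rintegral_expR_abs//; field; rewrite gt_eqF.
Qed.

(** The constant is the squared norm of the kernel, by the Cauchy-Schwarz
    inequality; it is attained for [f y = green' k (x - y)]. *)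
Lemma conv_green'_bound (f : RT -> R) (x : R) : square_integrable leb f ->
  convol leb f (green' k) x ^+ 2 <= (4 * k)^-1 * \int[leb]_y (f y ^+ 2).
Proof.
move=> fi; have [si e] := green'_sqr_square_integrable x.
by rewrite -e; exact: Rintegral_cauchy_schwarz.
Qed.

Section solution.
Variables (mu : {finite_measure set RT -> \bar R}) (Gamma : set R).
Variables (f bp : RT -> R).
Hypothesis fi : square_integrable leb f.
Hypothesis bpi : rintegrable mu bp.
Hypothesis bp0 : forall y, ~ Gamma y -> bp y = 0.

(** The solution of [- psi'' + k^2 psi = f] whose differential has the singular
    part [bp mu], with its derivative [sol_P] and its second derivative
    [sol_P']. *)
Definition sol_psi (x : R) : R := convol leb f (green k) x - convol mu bp (green' k) x.
Definition sol_P (x : R) : R :=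
  convol leb f (green' k) x - k ^+ 2 * convol mu bp (green k) x.
Definition sol_P' (x : R) : R := k ^+ 2 * sol_psi x - f x.

Let fL := L2_density_integrable fi.
Let bpL := exp_density_integrable bpi.
Let mf : measurable_fun [set: RT] f. Proof. by case: fi. Qed.
Let mbp : measurable_fun [set: RT] bp. Proof. exact: rintegrable_measurable bpi. Qed.

Lemma sol_square_integrable : [/\ square_integrable leb sol_psi,
  square_integrable leb sol_P & square_integrable leb sol_P'].
Proof.
have h := (conv_L2 (measurable_green k) green_le fi).1.
have F := (conv_L2 (measurable_green' k) (norm_green'_le k) fi).1.
have Q := (conv_L1 (measurable_green k) green_le bpi).1.
have q := (conv_L1 (measurable_green' k) (norm_green'_le k) bpi).1.
have psi : square_integrable leb sol_psi by exact: square_integrableB.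
split=> //.
- by apply: square_integrableB => //; exact: square_integrableZ.
- by apply: square_integrableB => //; exact: square_integrableZ.
Qed.

Lemma sol_psi_bound : \int[leb]_x (sol_psi x ^+ 2) <=
  2 * ((2 * k)^-1 ^+ 2 * (2 / k) ^+ 2 * \int[leb]_y (f y ^+ 2)) +
  2 * (2^-1 ^+ 2 * (2 / k) * (\int[mu]_y `|bp y|) ^+ 2).
Proof.
have [h hb] := conv_L2 (measurable_green k) green_le fi.
have [q qb] := conv_L1 (measurable_green' k) (norm_green'_le k) bpi.
have -> : \int[leb]_x (sol_psi x ^+ 2) = \int[leb]_x ((convol leb f (green k) x +
    (-1) * convol mu bp (green' k) x) ^+ 2).
  by apply: eq_Rintegral => x _; rewrite mulN1r.
apply: Rintegral_sqrB_le => //; first exact: square_integrableZ.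
under eq_Rintegral do rewrite mulN1r sqrrN.
exact: qb.
Qed.

Let green_f_int (K : R -> R) (c : R) (s x : R) : s <= x ->
  measurable_fun [set: RT] K ->
  (forall t, `|K t| <= c * expR (- (k * `|t|))) ->
  leb.-integrable `]s, x[ (EFin \o convol leb f K) /\
  leb.-integrable `]s, x[ (EFin \o convol mu bp K).
Proof.
move=> sx mK Kc; split.
  by have [_ []] := conv_fubini k0 mf fL mK Kc sx.
by have [_ []] := conv_fubini k0 mbp bpL mK Kc sx.
Qed.

Lemma sol_P_increment s x : s <= x ->
  sol_P x - sol_P s = \int[leb]_(t in `]s, x[) sol_P' t.
Proof.
move=> sx.
have e1 := conv_green_increment k0 mbp bpL sx.
have ae_f : {ae leb, forall y, f y != 0 -> y != s /\ y != x}.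
  by apply: filterS2 (ae_neq s) (ae_neq x) => y h1 h2 _; split.
have e2 : convol leb f (green' k) x - convol leb f (green' k) s =
    k ^+ 2 * \int[leb]_(t in `]s, x[) convol leb f (green k) t -
    \int[leb]_(y in `]s, x[) f y := conv_green'_increment k0 mf fL sx ae_f.
have [i1 _] := green_f_int sx (measurable_green k) green_le.
have [_ i2] := green_f_int sx (measurable_green' k) (norm_green'_le k).
have fo : leb.-integrable `]s, x[ (EFin \o f).
  by apply/rintegrable_indicE => //; exact: density_integrable_oo k0 leb f mf fL s x.
have i12 : leb.-integrable `]s, x[ (EFin \o sol_psi).
  exact: (integrableB _ i1 i2).
rewrite RintegralB//; last exact: (integrableZl _ _ i12).
rewrite RintegralZl// RintegralB// -e1.
transitivity ((convol leb f (green' k) x - convol leb f (green' k) s) -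
  k ^+ 2 * (convol mu bp (green k) x - convol mu bp (green k) s)).
  rewrite /sol_P; move: (convol leb f _ x) (convol leb f _ s).
  by move: (convol mu bp _ x) (convol mu bp _ s) => *; ring.
rewrite e2; move: (\int[leb]_(t in _) convol leb f _ t) (\int[leb]_(t in _) f t).
by move: (convol mu bp _ x - _) => *; ring.
Qed.

(** Only the convolution with [mu] contributes a singular part, through the
    jump of [green'].  The end points are off [Gamma], hence outside the
    support of [bp]. *)
Lemma sol_psi_increment s x : s <= x -> ~ Gamma s -> ~ Gamma x ->
  sol_psi x - sol_psi s =
  \int[leb]_(t in `]s, x[) sol_P t + \int[mu]_(y in `]s, x[) bp y.
Proof.
move=> sx gs gx.
have e1 : convol leb f (green k) x - convol leb f (green k) s =
    \int[leb]_(t in `]s, x[) convol leb f (green' k) t :=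
  conv_green_increment k0 mf fL sx.
have e2 : convol mu bp (green' k) x - convol mu bp (green' k) s =
    k ^+ 2 * \int[leb]_(t in `]s, x[) convol mu bp (green k) t -
    \int[mu]_(y in `]s, x[) bp y.
  apply: conv_green'_increment => //.
  apply: aeW => y; have [yG|/bp0->] := pselect (Gamma y); last by rewrite eqxx.
  by move=> _; split; apply/eqP => e; [apply: gs|apply: gx]; rewrite -e.
have [_ i1] := green_f_int sx (measurable_green k) green_le.
have [i2 _] := green_f_int sx (measurable_green' k) (norm_green'_le k).
rewrite RintegralB//; last exact: (integrableZl _ _ i1).
rewrite RintegralZl//.
transitivity ((convol leb f (green k) x - convol leb f (green k) s) -
  (convol mu bp (green' k) x - convol mu bp (green' k) s)).
  rewrite /sol_psi; move: (convol leb f _ x) (convol leb f _ s).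
  by move: (convol mu bp _ x) (convol mu bp _ s) => *; ring.
by rewrite e1 e2; ring.
Qed.

End solution.
End resolvent_equation.

(** * The first order system and its solutions for a small parameter *)

Section increments.
Variable R : realType.
Local Notation RT := (measurableTypeR R).

Lemma L2_integrable_oo (a : RT -> R) (s x : R) : square_integrable leb a ->
  leb.-integrable `]s, x[ (EFin \o a).
Proof.
move=> ai; apply/rintegrable_indicE => //; apply: square_integrableM => //.
split=> //; have := rintegrable_indic_oo s x.
congr rintegrable; apply/funext => t.
by rewrite indicE; case: (_ \in _); rewrite ?expr1n ?expr0n.
Qed.

(** The Cauchy-Schwarz inequality against the indicator function of the
    interval. *)
Lemma L2_increment_le (a : RT -> R) (s x : R) : square_integrable leb a ->
  s <= x -> (\int[leb]_(t in `]s, x[) a t) ^+ 2 <= (x - s) * \int[leb]_t (a t ^+ 2).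
Proof.
move=> ai sx; rewrite Rintegral_indic.
have i1 := rintegrable_indic_oo s x.
have E : (fun t : RT => (\1_(`]s, x[) t : R) ^+ 2) = \1_(`]s, x[).
  apply/funext => t.
  by rewrite indicE; case: (_ \in _); rewrite ?expr1n ?expr0n.
have si : square_integrable leb (\1_(`]s, x[) : RT -> R).
  by split=> //; rewrite E.
have := Rintegral_cauchy_schwarz si ai; rewrite E.
suff -> : \int[leb]_t (\1_(`]s, x[) t : R) = x - s by [].
rewrite /Rintegral integral_indic//= setIT lebesgue_measure_itv/= lte_fin.
by move: sx; rewrite le_eqVlt => /predU1P[->|->//]; rewrite ltxx subrr.
Qed.

Lemma increment_continuous (u : R -> R) (a : RT -> R) (x0 e : R) :
  square_integrable leb a -> 0 < e ->
  (forall s x, ball x0 e s -> ball x0 e x -> s < x ->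
    u x - u s = \int[leb]_(t in `]s, x[) a t) ->
  {for x0, continuous u}.
Proof.
move=> ai e0 du.
set N := \int[leb]_t (a t ^+ 2).
have N0 : 0 <= N by exact: Rintegral_sqr_ge0.
have le x : ball x0 e x -> (u x0 - u x) ^+ 2 <= `|x0 - x| * N.
  have b0 : ball x0 e x0 by exact: ballxx.
  move=> xe; have [xx|xx|->] := ltgtP x x0.
  - rewrite (du _ _ xe b0 xx) gtr0_norm ?subr_gt0//.
    exact: L2_increment_le (ltW xx).
  - rewrite -opprB sqrrN (du _ _ b0 xe xx) ltr0_norm ?subr_lt0// opprB.
    exact: L2_increment_le (ltW xx).
  - by rewrite !subrr expr0n normr0 mul0r.
apply/cvgrPdist_lt => eps eps0.
near=> x.
rewrite -(@ltr_pXn2r _ 2%N) ?nnegrE ?(ltW eps0)//.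
rewrite real_normK ?num_real//.
have xe : ball x0 e x by near: x; exact: (nbhsx_ballx x0 e e0).
apply: (le_lt_trans (le x xe)).
apply: (@le_lt_trans _ _ (`|x0 - x| * (N + 1))).
  by rewrite ler_wpM2l// lerDl.
rewrite -ltr_pdivlMr ?ltr_wpDl//.
near: x; apply: (nbhsx_ballx x0 (eps ^+ 2 / (N + 1))).
by rewrite divr_gt0 ?exprn_gt0// ltr_wpDl.
Unshelve. all: by end_near. Qed.

End increments.

Section delta'_operator.
Variables (R : realType) (Gamma : set R).
Local Notation RT := (measurableTypeR R).
Variables (mu : {finite_measure set RT -> \bar R}) (b : RT -> R).

(** [P] is the continuous extension of the derivative of [psi], [p2] its
    second derivative, and [b * P] the density of the singular part of the
    differential of [psi]. *)
Definition delta'_data (psi P p2 : R -> R) : Prop :=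
  [/\ square_integrable leb psi, square_integrable leb P,
      square_integrable leb p2, continuous P &
      forall s x, ~ Gamma s -> ~ Gamma x -> s < x ->
        P x - P s = \int[leb]_(t in `]s, x[) p2 t /\
        psi x - psi s = \int[leb]_(t in `]s, x[) P t +
                        \int[mu]_(y in `]s, x[) (b y * P y)].

Hypothesis bi : rintegrable mu b.
Hypothesis b0 : forall y, ~ Gamma y -> b y = 0.


(** If the unknown [p] is reproduced by the solution formula on [Gamma], then
    the singular density [b p] is [b P], as the system demands. *)
Lemma sol_delta'_data (k : R) (f p : RT -> R) (M : R) :
  0 < k -> square_integrable leb f -> measurable_fun [set: RT] p ->
  (forall y, `|p y| <= M) ->
  let bp := fun y => b y * p y in
  (forall y, Gamma y -> sol_P k mu f bp y = p y) ->
  delta'_data (sol_psi k mu f bp) (sol_P k mu f bp) (sol_P' k mu f bp).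
Proof.
move=> k0 fi mp pM bp hp.
have bpi : rintegrable mu bp := bounded_mul_integrable bi mp pM.
have bp0 y : ~ Gamma y -> bp y = 0 by move=> /b0; rewrite /bp => ->; rewrite mul0r.
have [s1 s2 s3] := sol_square_integrable k0 fi bpi.
have dP := sol_P_increment k0 fi bpi.
split=> //.
  move=> x; apply: (@increment_continuous _ _ (sol_P' k mu f bp) x 1) => //.
  by move=> s t _ _ /ltW st; exact: dP.
move=> s x gs gx /ltW sx; split; first exact: dP.
rewrite (sol_psi_increment k0 fi bpi bp0 sx gs gx); congr (_ + _).
apply: eq_Rintegral => y _; rewrite /bp.
by have [/hp->//|/b0->] := pselect (Gamma y); rewrite !mul0r.
Qed.

Let B := \int[mu]_y `|b y|.
Let B0 : 0 <= B. Proof. by apply: Rintegral_ge0. Qed.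

(** For a small spectral parameter the integral equation for [P] on the
    support is a contraction. *)
Lemma solve_small : exists2 k : R, 0 < k & forall (f : RT -> R) (M : R),
  square_integrable leb f ->
  (forall x, `|convol leb f (green' k) x| <= M) ->
  exists psi P p2, [/\ delta'_data psi P p2,
    forall x, p2 x = k ^+ 2 * psi x - f x &
    forall x, `|P x - convol leb f (green' k) x| <= M / 2].
Proof.
(* The kernel is bounded by [k / 2], so this makes the operator a contraction. *)
pose k := (2 * (B + 1))^-1.
have B1 : 0 < B + 1 by rewrite ltr_wpDl.
have k0 : 0 < k by rewrite invr_gt0 mulr_gt0.
exists k => // f M fi FM.
pose K (z : RT * RT) : R := - k ^+ 2 * green k (z.1 - z.2).
have mK : measurable_fun [set: RT * RT] K.
  apply: measurable_funM => //; apply: (measurableT_comp (measurable_green k)).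
  exact: measurable_funB.
have Kc z : `|K z| <= k / 2.
  rewrite /K normrM norm_greenE// normrN (ger0_norm (sqr_ge0 _)).
  apply: (@le_trans _ _ (k ^+ 2 * ((2 * k)^-1 * 1))).
    rewrite ler_wpM2l ?sqr_ge0// ler_wpM2l ?invr_ge0 ?mulr_ge0 ?(ltW k0)//.
    exact: expR_abs_le1.
  by rewrite le_eqVlt; apply/orP; left; apply/eqP; field; rewrite gt_eqF.
have kB : k / 2 * B <= 4^-1.
  have : k * (B + 1) = 2^-1.
    by rewrite /k; field; rewrite gt_eqF.
  by have := k0; lra.
have M0 : 0 <= M by exact: le_trans (normr_ge0 _) (FM 0).
have mF : measurable_fun [set: RT] (convol leb f (green' k) : RT -> R).
  exact: (measurable_conv k0 (proj1 fi) (L2_density_integrable k0 fi)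
    (measurable_green' k) (norm_green'_le k)).
have contr : k / 2 * \int[mu]_y `|b y| <= 2^-1 by rewrite -/B; lra.
have [p [mp pM pE]] := fixed_point bi mK Kc contr mF FM.
pose bp y := b y * p y.
have bpi : rintegrable mu bp := bounded_mul_integrable bi mp pM.
have PE x : sol_P k mu f bp x = p x.
  rewrite pE /sol_P; congr (_ + _).
  rewrite /convol -mulNr -RintegralZl//; last first.
    apply: (conv_integrable k0 (rintegrable_measurable bpi)
      (exp_density_integrable k0 bpi) (measurable_green k)) => t.
    by rewrite norm_greenE.
  by apply: eq_Rintegral => y _; rewrite mulrA.
exists (sol_psi k mu f bp), (sol_P k mu f bp), (sol_P' k mu f bp); split=> //.
  exact: (sol_delta'_data k0 fi mp pM).
move=> x; rewrite PE pE addrAC subrr add0r.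
have := kernel_integral_le bi mK Kc x _ mp pM.
move=> /(_ (divr_ge0 (ltW k0) (ltW (ltr0Sn _ 1))))/le_trans; apply.
by rewrite -/B; nra.
Qed.

End delta'_operator.

(** * Solutions for an arbitrary parameter, under one linear condition *)

Section adjoint_equation.
Variable R : realType.
Local Notation RT := (measurableTypeR R).
Variable m : {sigma_finite_measure set RT -> \bar R}.
Variables (b : RT -> R) (K : RT * RT -> R) (c : R).
Hypothesis bi : rintegrable m b.
Hypothesis mK : measurable_fun [set: RT * RT] K.
Hypothesis Kc : forall z, `|K z| <= c.

(** Both sides are obtained from the double integral of
    [K (x, y) * (b x * q x) * (b y * P y)] by substituting one of the two
    equations. *)
Lemma adjoint_pairing (P q F G : RT -> R) (M : R) :
  measurable_fun [set: RT] P -> (forall x, `|P x| <= M) ->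
  measurable_fun [set: RT] q -> (forall x, `|q x| <= M) ->
  (forall x, P x = F x + \int[m]_y (K (x, y) * (b y * P y))) ->
  (forall y, q y = G y + \int[m]_x (K (x, y) * (b x * q x))) ->
  \int[m]_x (b x * q x * F x) = \int[m]_y (b y * G y * P y).
Proof.
move=> mP PM mq qM PE qE.
have mK' : measurable_fun [set: RT * RT] (fun z => K (z.2, z.1)).
  by apply: (measurableT_comp mK); exact: measurable_fun_pair.
have bP := bounded_mul_integrable bi mP PM.
have bq := bounded_mul_integrable bi mq qM.
pose f (z : RT * RT) := K z * (b z.1 * q z.1) * (b z.2 * P z.2).
have mf : measurable_fun [set: RT * RT] f.
  apply: measurable_funM; first apply: measurable_funM => //.
    exact: (measurableT_comp (rintegrable_measurable bq)).
  exact: (measurableT_comp (rintegrable_measurable bP)).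
have c0 : 0 <= c by exact: le_trans (normr_ge0 _) (Kc (0, 0)).
have ai := rintegrableZ c (rintegrable_norm bq).
have ci := rintegrable_norm bP.
have fac x y : `|f (x, y)| <= c * `|b x * q x| * `|b y * P y|.
  by rewrite /f /= 2!normrM ler_wpM2r// ler_wpM2r.
have e1 x : \int[m]_y f (x, y) = b x * q x * \int[m]_y (K (x, y) * (b y * P y)).
  rewrite -RintegralZl//; last exact: (kernel_integrable mK Kc).
  by apply: eq_Rintegral => y _; rewrite /f /=; ring.
have e2 y : \int[m]_x f (x, y) = \int[m]_x (K (x, y) * (b x * q x)) * (b y * P y).
  rewrite -RintegralZr//.
  exact: (kernel_integrable mK' (fun z => Kc (z.2, z.1)) y bq).
have bqP : rintegrable m (fun x => b x * q x * P x).
  exact: (bounded_mul_integrable bq mP PM).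
have i1 := rintegrable_fubini1 mf ai ci fac.
have mf' : measurable_fun [set: RT * RT] (fun z => f (z.2, z.1)).
  by apply: (measurableT_comp mf); exact: measurable_fun_pair.
have fac' x y : `|f (y, x)| <= `|b x * P x| * (c * `|b y * q y|).
  by rewrite mulrC.
have i2 := rintegrable_fubini1 mf' ci ai fac'.
transitivity (\int[m]_x (b x * q x * P x) - \int[m]_x \int[m]_y f (x, y)).
  rewrite -RintegralB//; apply: eq_Rintegral => x _.
  by rewrite e1 PE; ring.
rewrite (fubini_dominated mf ai ci fac) -RintegralB//.
apply: eq_Rintegral => y _; rewrite e2 {1}qE; ring.
Qed.

End adjoint_equation.

Section volterra.
Variables (R : realType) (Gamma : set R).
Local Notation RT := (measurableTypeR R).
Variables (mu : {finite_measure set RT -> \bar R}) (b : RT -> R) (a : R).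
Hypothesis bi : rintegrable mu b.
Hypothesis b0 : forall y, ~ Gamma y -> b y = 0.
Hypothesis Gamma_a : forall y, Gamma y -> `|y| <= a.
Variable k : R.
Hypothesis k0 : 0 < k.

Let B := \int[mu]_y `|b y|.
Let B0 : 0 <= B. Proof. by apply: Rintegral_ge0. Qed.
(* [V] is the Volterra part of the kernel, conjugated by the exponential of
   rate [L = k + H]; [H] is chosen to make [V] as small as [V_le] says. *)
Let H := 2 * k ^+ 2 * (B + 1).
Let L := k + H.
Let H0 : 0 < H. Proof. by rewrite !mulr_gt0 ?exprn_gt0// ltr_wpDl. Qed.
Let L0 : 0 < L. Proof. by rewrite addr_gt0. Qed.

Let V (t : R) := k / 2 * (expR (k * t) - expR (- (k * t))) * expR (- (L * t)).
Let K (z : RT * RT) : R := V (Num.max (z.1 - z.2) 0).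

Let V0 : V 0 = 0. Proof. by rewrite /V !mulr0 oppr0 subrr mulr0 mul0r. Qed.

Let V_le t : 0 <= t -> `|V t| <= (2 * (B + 1))^-1.
Proof.
move=> t0.
have kt : 0 <= k * t by rewrite mulr_ge0// ltW.
have e1 : expR (- (k * t)) <= expR (k * t).
  by rewrite ler_expR; lra.
rewrite ger0_norm; last first.
  by rewrite !mulr_ge0 ?expR_ge0 ?subr_ge0// ltW.
have -> : V t = k / 2 * (1 - expR (- (2 * k * t))) * expR (- (H * t)).
  rewrite /V /L /H -!mulrA; congr (_ * (_ * _)).
  by rewrite !mulrBl mul1r -!expRD; congr (expR _ - expR _); ring.
have h1 : 1 - expR (- (2 * k * t)) <= 2 * k * t.
  by have := expR_ge1Dx (- (2 * k * t)); lra.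
have h2 : H * t * expR (- (H * t)) <= 1.
  rewrite expRN ler_pdivrMr ?expR_gt0// mul1r.
  by have := expR_ge1Dx (H * t); lra.
have h3 := expR_ge0 (- (H * t)).
apply: (@le_trans _ _ (k / 2 * (2 * k * t) * expR (- (H * t)))).
  by rewrite ler_wpM2r// ler_wpM2l// divr_ge0// ltW.
have -> : k / 2 * (2 * k * t) * expR (- (H * t)) =
    (2 * (B + 1))^-1 * (H * t * expR (- (H * t))).
  by rewrite /H; field; rewrite gt_eqF// ltr_wpDl.
by rewrite ler_piMr// invr_ge0 mulr_ge0// addr_ge0.
Qed.

Let mV : measurable_fun [set: RT] (V : RT -> R).
Proof.
have me (c : R) : measurable_fun [set: RT] (fun t : RT => expR (c * t)).
  by apply: measurableT_comp => //; exact: measurable_funM.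
apply: measurable_funM; last by under eq_fun do rewrite -mulNr; exact: me.
apply: measurable_funM => //; apply: measurable_funB; first exact: me.
by under eq_fun do rewrite -mulNr; exact: me.
Qed.

Let mK : measurable_fun [set: RT * RT] K.
Proof.
apply: (measurableT_comp mV); apply: measurable_maxr => //.
exact: measurable_funB.
Qed.

Let Kc z : `|K z| <= (2 * (B + 1))^-1.
Proof. by apply: V_le; rewrite le_max lexx orbT. Qed.

Let contr : (2 * (B + 1))^-1 * B <= 2^-1.
Proof.
rewrite invfM -mulrA ler_piMr// mulrC ler_pdivrMr ?ltr_wpDl//; lra.
Qed.

Let KE (x y : R) : - k ^+ 2 * green k (x - y) =
  expR (L * (x - y)) * K (x, y) - k / 2 * expR (k * (x - y)).
Proof.
rewrite /K /green /=; have [xy|xy] := leP x y.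
  rewrite max_r ?subr_le0// V0 mulr0 ler0_norm ?subr_le0// mulrN opprK sub0r.
  by field; rewrite gt_eqF.
rewrite max_l ?subr_ge0 ?ltW// gtr0_norm ?subr_gt0// /V.
have e : expR (L * (x - y)) * expR (- (L * (x - y))) = 1.
  by rewrite -expRD subrr expR0.
rewrite [in RHS]mulrCA e mulr1.
by field; rewrite gt_eqF.
Qed.

Let chi (x : R) : R := \1_(`[- a, a]) x.
Let chi1 x : Gamma x -> chi x = 1.
Proof.
move=> /Gamma_a; rewrite ler_norml => xa.
by rewrite /chi indicE mem_set//= in_itv/=.
Qed.

Let cut_exp_le (c x : R) : `|chi x * expR (c * x)| <= expR (`|c| * a).
Proof.
rewrite /chi indicE; case: (boolP (x \in _)) => [|_]; last first.
  by rewrite mul0r normr0 expR_ge0.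
rewrite inE/= in_itv/= mul1r -ler_norml => xa.
rewrite ger0_norm ?expR_ge0// ler_expR (le_trans (ler_norm _))// normrM.
by rewrite ler_wpM2l.
Qed.

Let m_cut_exp (c : R) : measurable_fun [set: RT] (fun x : RT => chi x * expR (c * x)).
Proof.
apply: measurable_funM; first exact: measurable_indic.
by apply: measurableT_comp => //; exact: measurable_funM.
Qed.

(** Splitting off the growing exponential from the resolvent kernel leaves a
    Volterra kernel, which an exponential weight turns into a contraction.
    The single condition on [f] is the vanishing of the exponential moment of
    the solution, read on [f] through the adjoint equation. *)
Lemma solve_ker : exists (w : RT -> R) (C : R), rintegrable mu w /\
  forall f, square_integrable leb f ->
    \int[mu]_y (w y * convol leb f (green' k) y) = 0 ->
    exists psi P p2, [/\ delta'_data Gamma mu b psi P p2,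
      forall x, p2 x = k ^+ 2 * psi x - f x &
      \int[leb]_x (psi x ^+ 2) <= C * \int[leb]_x (f x ^+ 2)].
Proof.
pose G (y : RT) := chi y * expR (H * y).
have mK' : measurable_fun [set: RT * RT] (fun z => K (z.2, z.1)).
  by apply: (measurableT_comp mK); exact: measurable_fun_pair.
have [q [mq qM qE]] := fixed_point bi mK' (fun z => Kc (z.2, z.1)) contr
  (m_cut_exp H) (cut_exp_le H).
(* [q] solves the adjoint equation whose free term is the exponential that
   has to be integrated against [bp], conjugated by the weight. *)
pose w y := b y * q y * (chi y * expR (- L * y)).
have wi : rintegrable mu w.
  exact (bounded_mul_integrable (bounded_mul_integrable bi mq qM)
    (m_cut_exp (- L)) (cut_exp_le (- L))).
pose c1 := 2 * ((2 * k)^-1 ^+ 2 * (2 / k) ^+ 2).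
pose c2 := 2 * (2^-1 ^+ 2 * (2 / k)).
pose E := expR (`|L| * a).
exists w, (c1 + c2 * ((B * (2 * E * E)) ^+ 2 * (4 * k)^-1)); split=> // f fi wf.
pose F := convol leb f (green' k).
pose N := \int[leb]_x (f x ^+ 2).
have N0 : 0 <= N by exact: Rintegral_sqr_ge0.
pose M := Num.sqrt ((4 * k)^-1 * N).
have M0 : 0 <= M by exact: sqrtr_ge0.
have FM x : `|F x| <= M.
  rewrite -(@ler_pXn2r _ 2%N) ?nnegrE// real_normK ?num_real//.
  rewrite sqr_sqrtr ?mulr_ge0 ?invr_ge0 ?mulr_ge0 ?(ltW k0)//.
  exact: conv_green'_bound.
have mF : measurable_fun [set: RT] (F : RT -> R).
  exact: (measurable_conv k0 (proj1 fi) (L2_density_integrable k0 fi)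
    (measurable_green' k) (norm_green'_le k)).
pose Ft (x : RT) := chi x * expR (- L * x) * F x.
have mFt : measurable_fun [set: RT] Ft.
  by apply: measurable_funM => //; exact: m_cut_exp.
have FtM x : `|Ft x| <= E * M.
  rewrite /Ft normrM ler_pM//; have := cut_exp_le (- L) x.
  by rewrite normrN.
have [pt [mpt ptM ptE]] := fixed_point bi mK Kc contr mFt FtM.
pose p (x : RT) := chi x * expR (L * x) * pt x.
have mp : measurable_fun [set: RT] p.
  by apply: measurable_funM => //; exact: m_cut_exp.
have pM x : `|p x| <= E * (2 * (E * M)).
  by rewrite /p normrM ler_pM//; exact: cut_exp_le.
pose bp y := b y * p y.
have bpi : rintegrable mu bp := bounded_mul_integrable bi mp pM.
have b_off (u v : R -> R) y : (Gamma y -> u y = v y) -> b y * u y = b y * v y.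
  move=> uv; have [/uv->//|/b0->] := pselect (Gamma y).
  by rewrite !mul0r.
(* This removes the rank one part of the kernel from the equation for [p]. *)
have moment : \int[mu]_y (expR (- (k * y)) * bp y) = 0.
  rewrite -wf.
  pose M2 := Num.max (2 * (E * M)) (2 * expR (`|H| * a)).
  have ptM2 x : `|pt x| <= M2 by rewrite (le_trans (ptM x))// le_max lexx.
  have qM2 x : `|q x| <= M2 by rewrite (le_trans (qM x))// le_max lexx orbT.
  have pairE := adjoint_pairing bi mK Kc mpt ptM2 mq qM2 ptE qE.
  transitivity (\int[mu]_y (b y * (chi y * expR (H * y)) * pt y)).
    apply: eq_Rintegral => y _.
    have -> : expR (H * y) = expR (- (k * y)) * expR (L * y).
      by rewrite -expRD; congr expR; rewrite /L; ring.
    by rewrite /bp /p; ring.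
  apply: (etrans (esym pairE)); apply: eq_Rintegral => y _; rewrite /w /Ft -/(F y); ring.
have PE x : Gamma x -> sol_P k mu f bp x = p x.
  move=> xG; rewrite /p ptE /Ft chi1// !mul1r mulrDr mulrA -expRD mulNr subrr.
  rewrite expR0 mul1r /sol_P; congr (_ + _).
  have gi : rintegrable mu (fun y => green k (x - y) * bp y).
    apply: (conv_integrable k0 (rintegrable_measurable bpi)
      (exp_density_integrable k0 bpi) (measurable_green k)) => t.
    by rewrite norm_greenE.
  have bpt := bounded_mul_integrable bi mpt ptM.
  have ki := kernel_integrable mK Kc x bpt.
  have eE y : expR (- (k * y)) * bp y = b y * ((chi y * expR (- k * y)) * p y).
    have [yG|/b0 b0y] := pselect (Gamma y); last by rewrite /bp b0y; ring.
    by rewrite chi1// mulNr /bp; ring.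
  have ei : rintegrable mu (fun y => expR (- (k * y)) * bp y).
    have h := @bounded_mul_integrable _ mu b bi
      (fun y => (chi y * expR (- k * y)) * p y)
      (expR (`|- k| * a) * (E * (2 * (E * M)))).
    rewrite (funext eE); apply: h; last by move=> y; rewrite normrM ler_pM.
    by apply: measurable_funM => //; exact: m_cut_exp.
  rewrite /convol -mulNr -RintegralZl// -RintegralZl//.
  rewrite -[RHS]subr0 -(mulr0 (k / 2 * expR (k * x))) -moment -RintegralZl//.
  rewrite -RintegralB//; [|exact: rintegrableZ|exact: rintegrableZ].
  apply: eq_Rintegral => y _; rewrite mulrA KE mulrBl; congr (_ - _).
    have [yG|/b0 b0y] := pselect (Gamma y); last by rewrite /bp b0y; ring.
    have -> : expR (L * (x - y)) = expR (L * x) * expR (- (L * y)).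
      by rewrite -expRD; congr expR; ring.
    have e : expR (- (L * y)) * expR (L * y) = 1 by rewrite -expRD addNr expR0.
    rewrite /bp /p chi1// mul1r.
    transitivity (expR (L * x) * (expR (- (L * y)) * expR (L * y)) *
      (K (x, y) * (b y * pt y))); first by ring.
    by rewrite e mulr1.
  have -> : expR (k * (x - y)) = expR (k * x) * expR (- (k * y)).
    by rewrite -expRD; congr expR; ring.
  by ring.
exists (sol_psi k mu f bp), (sol_P k mu f bp), (sol_P' k mu f bp); split=> //.
  exact (sol_delta'_data bi b0 k0 fi mp pM PE).
apply: (le_trans (sol_psi_bound k0 fi bpi)).
have X0 : 0 <= \int[mu]_y `|bp y| by apply: Rintegral_ge0.
have bpB : \int[mu]_y `|bp y| <= B * (2 * E * E) * M.
  have nb := rintegrable_norm bi.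
  apply: (@le_trans _ _ (\int[mu]_y (`|b y| * (E * (2 * (E * M)))))).
    apply: le_Rintegral => //.
    - exact: rintegrable_norm.
    - have := rintegrableZ (E * (2 * (E * M))) nb.
      by congr rintegrable; apply/funext => y; rewrite mulrC.
    - by move=> y _; rewrite normrM ler_wpM2l.
  rewrite RintegralZr// -/B le_eqVlt; apply/orP; left; apply/eqP; ring.
have : (\int[mu]_y `|bp y|) ^+ 2 <= (B * (2 * E * E)) ^+ 2 * ((4 * k)^-1 * N).
  rewrite -(sqr_sqrtr (_ : 0 <= (4 * k)^-1 * N)) -?/M -?exprMn.
    by rewrite ler_pXn2r// nnegrE// (le_trans X0).
  by rewrite mulr_ge0// invr_ge0 mulr_ge0// ltW.
rewrite -/N; set X := (\int[mu]_y `|bp y|) ^+ 2 => hX.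
rewrite [leRHS]mulrDl; apply: lerD; first by rewrite /c1 !mulrA.
have -> : 2 * (2^-1 ^+ 2 * (2 / k) * X) = c2 * X by rewrite /c2; ring.
rewrite -[leRHS]mulrA; apply: ler_wpM2l; last by rewrite -[leRHS]mulrA.
have k20 : 0 <= 2 / k by rewrite divr_ge0// ltW.
by rewrite /c2; apply: mulr_ge0 => //; apply: mulr_ge0 => //; exact: sqr_ge0.
Qed.

End volterra.

(** * Integration by parts against singular differentials *)

(** Fubini's theorem on the triangle [s < y < x < n], for the product of the
    Lebesgue measure and an arbitrary measure. *)
Section triangle.
Variable R : realType.
Local Notation RT := (measurableTypeR R).
Variable m : {sigma_finite_measure set RT -> \bar R}.
Variables (p c : RT -> R) (s n : R).
Hypothesis pi : leb.-integrable `]s, n[ (EFin \o p).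
Hypothesis ci : m.-integrable `]s, n[ (EFin \o c).

Let pi' : rintegrable leb (fun x => \1_(`]s, n[) x * p x).
Proof. exact: integrable_indicM. Qed.
Let ci' : rintegrable m (fun x => \1_(`]s, n[) x * c x).
Proof. exact: integrable_indicM. Qed.

Let lt2 (z : RT * RT) : R := (z.2 < z.1)%R%:R.
Let mlt2 : measurable_fun [set: RT * RT] lt2.
Proof.
rewrite (_ : lt2 = fun z => if z.2 < z.1 then 1 else 0); last first.
  by apply/funext => z; rewrite /lt2; case: ifP.
apply: measurable_fun_ifT => //.
by apply: measurable_fun_ltr; [exact: measurable_snd|exact: measurable_fst].
Qed.

Let f (z : RT * RT) := lt2 z * (\1_(`]s, n[) z.1 * p z.1) * (\1_(`]s, n[) z.2 * c z.2).

Let mf : measurable_fun [set: RT * RT] f.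
Proof.
apply: measurable_funM; first apply: measurable_funM => //.
  exact: (measurableT_comp (rintegrable_measurable pi')).
exact: (measurableT_comp (rintegrable_measurable ci')).
Qed.

Let fac x y : `|f (x, y)| <= `|\1_(`]s, n[) x * p x| * `|\1_(`]s, n[) y * c y|.
Proof.
rewrite /f 2!normrM /= ler_wpM2r// ler_piMl// /lt2.
by case: (_ < _); rewrite ?normr1 ?normr0.
Qed.

Let fE1 x : \int[m]_y f (x, y) = \1_(`]s, n[) x * (p x * \int[m]_(y in `]s, x[) c y).
Proof.
have [xs|xs] := boolP (x \in `]s, n[%classic); last first.
  rewrite indicE (negbTE xs) mul0r (_ : (fun y => f (x, y)) = fun=> 0).
    by rewrite Rintegral_cst// mul0r.
  by apply/funext => y; rewrite /f /= indicE (negbTE xs) !(mul0r, mulr0).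
rewrite indicE xs mul1r; move: (xs); rewrite inE/= in_itv/= => /andP[sx xn].
have cx : rintegrable m (fun y => \1_(`]s, x[) y * c y).
  apply: integrable_indicM => //; apply: integrableS ci => //.
  by apply: subset_itvl; rewrite bnd_simp ltW.
rewrite [in RHS]Rintegral_indic -RintegralZl//; apply: eq_Rintegral => y _.
rewrite /f /lt2 /= !indicE xs mul1r !mem_setE !in_itv/=.
have [yx|xy] := ltP y x; last by rewrite andbF !(mul0r, mulr0).
by rewrite (lt_trans yx xn); case: (s < y); rewrite !(mul0r, mulr0, mul1r).
Qed.

Let fE2 y : \int[leb]_x f (x, y) = \1_(`]s, n[) y * (c y * \int[leb]_(x in `]y, n[) p x).
Proof.
have [ys|ys] := boolP (y \in `]s, n[%classic); last first.
  rewrite indicE (negbTE ys) mul0r (_ : (fun x => f (x, y)) = fun=> 0).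
    by rewrite Rintegral_cst// mul0r.
  apply/funext => x.
  by rewrite /f /= [X in _ * (X * _)]indicE (negbTE ys) !(mul0r, mulr0).
rewrite indicE ys mul1r; move: (ys); rewrite inE/= in_itv/= => /andP[sy yn].
have py : rintegrable leb (fun x => \1_(`]y, n[) x * p x).
  apply: integrable_indicM => //; apply: integrableS pi => //.
  by apply: subset_itvr; rewrite bnd_simp ltW.
rewrite [in RHS]Rintegral_indic -RintegralZl//; apply: eq_Rintegral => x _.
rewrite /f /lt2 /= !indicE ys mul1r !mem_setE !in_itv/=.
have [yx|xy] := ltP y x; last by rewrite /= !(mul0r, mulr0).
by rewrite (lt_trans sy yx)/=; case: (x < n); rewrite !(mul0r, mulr0, mul1r)// mulrC.
Qed.

Lemma triangle : [/\
  leb.-integrable `]s, n[ (EFin \o (fun x => p x * \int[m]_(y in `]s, x[) c y)),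
  m.-integrable `]s, n[ (EFin \o (fun y => c y * \int[leb]_(x in `]y, n[) p x)) &
  \int[leb]_(x in `]s, n[) (p x * \int[m]_(y in `]s, x[) c y) =
  \int[m]_(y in `]s, n[) (c y * \int[leb]_(x in `]y, n[) p x)].
Proof.
have ai := rintegrable_norm pi'; have bi := rintegrable_norm ci'.
split.
- apply/rintegrable_indicE => //.
  by rewrite -(funext fE1); exact: rintegrable_fubini1 mf ai bi fac.
- apply/rintegrable_indicE => //; rewrite -(funext fE2).
  have mf' : measurable_fun [set: RT * RT] (fun z => f (z.2, z.1)).
    by apply: (measurableT_comp mf); exact: measurable_fun_pair.
  have fac' x y : `|f (y, x)| <= `|\1_(`]s, n[) x * c x| * `|\1_(`]s, n[) y * p y|.
    by rewrite mulrC; exact: fac.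
  exact: (rintegrable_fubini1 mf' bi ai fac').
rewrite Rintegral_indic [RHS]Rintegral_indic.
under eq_Rintegral do rewrite -fE1.
under [RHS]eq_Rintegral do rewrite -fE2.
exact: fubini_dominated mf ai bi fac.
Qed.

End triangle.

Section by_parts.
Variables (R : realType) (Gamma : set R).
Local Notation RT := (measurableTypeR R).
Variable mu : {finite_measure set RT -> \bar R}.
Hypothesis Gamma0 : {ae leb, forall x : RT, ~ Gamma x}.

(** A Lebesgue null set contains no interval. *)
Lemma null_dense (u v : R) : u < v -> exists2 y, u < y < v & ~ Gamma y.
Proof.
move=> uv; apply: contrapT => h.
have sub y : u < y < v -> Gamma y.
  by move=> uy; apply: contrapT => ny; apply: h; exists y.
have : leb.-negligible (`]u, v[%classic : set RT).
  apply: negligibleS Gamma0 => y /=; rewrite in_itv/= => /sub Gy; exact.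
move=> neg; have : lebesgue_measure (`]u, v[%classic : set RT) = 0%E.
  by apply/negligibleP.
rewrite lebesgue_measure_itv/= lte_fin uv => -[] /eqP.
by rewrite subr_eq0 gt_eqF.
Qed.

Variables (p a c : RT -> R) (Phi psi : R -> R) (s n : R).
Hypothesis sn : s < n.
Hypothesis pi : leb.-integrable `]s, n[ (EFin \o p).
Hypothesis ai : leb.-integrable `]s, n[ (EFin \o a).
Hypothesis ci : rintegrable mu c.
Hypothesis dPhi : forall x y, x <= y -> Phi y - Phi x = \int[leb]_(t in `]x, y[) p t.
Hypothesis dpsi : forall x, s < x -> ~ Gamma x ->
  psi x - psi s = \int[leb]_(t in `]s, x[) a t + \int[mu]_(y in `]s, x[) c y.
Hypothesis gn : ~ Gamma n.
Hypothesis ppsi : leb.-integrable `]s, n[ (EFin \o (fun t => p t * psi t)).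

(** Integration by parts against a function whose differential has a singular
    part, by Fubini's theorem on a triangle. *)
Lemma by_parts : [/\
  leb.-integrable `]s, n[ (EFin \o (fun t => Phi t * a t)),
  mu.-integrable `]s, n[ (EFin \o (fun t => Phi t * c t)) &
  Phi n * psi n - Phi s * psi s =
  \int[leb]_(t in `]s, n[) (p t * psi t) + \int[leb]_(t in `]s, n[) (Phi t * a t) +
  \int[mu]_(t in `]s, n[) (Phi t * c t)].
Proof.
have mI : measurable (`]s, n[%classic : set RT) by exact: measurable_itv.
have cis : mu.-integrable `]s, n[ (EFin \o c).
  by apply: integrableS ci.
have [pa1 pa2 pa3] := triangle pi ai.
have [pc1 pc2 pc3] := triangle pi cis.
have PhiE y : s < y < n -> \int[leb]_(t in `]y, n[) p t = Phi n - Phi y.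
  by move=> /andP[_ /ltW yn]; rewrite dPhi.
have za : leb.-integrable `]s, n[ (EFin \o (fun t => Phi n * a t)).
  exact: (integrableZl mI (Phi n) ai).
have zc : mu.-integrable `]s, n[ (EFin \o (fun t => Phi n * c t)).
  exact: (integrableZl mI (Phi n) cis).
have phia : leb.-integrable `]s, n[ (EFin \o (fun t => Phi t * a t)).
  have := integrableB mI za pa2.
  apply: (eq_integrable mI) => y; rewrite inE/= in_itv/= => /PhiE e.
  by rewrite e -EFinB; congr EFin; ring.
have phic : mu.-integrable `]s, n[ (EFin \o (fun t => Phi t * c t)).
  have := integrableB mI zc pc2.
  apply: (eq_integrable mI) => y; rewrite inE/= in_itv/= => /PhiE e.
  by rewrite e -EFinB; congr EFin; ring.
split; [exact: phia|exact: phic|].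
have ip : leb.-integrable `]s, n[ (EFin \o (fun t => psi s * p t)).
  exact: (integrableZl mI (psi s) pi).
pose A t := \int[leb]_(y in `]s, t[) a y.
pose C t := \int[mu]_(y in `]s, t[) c y.
have iac : leb.-integrable `]s, n[ (EFin \o (fun t => p t * A t + p t * C t)).
  exact: (integrableD mI pa1 pc1).
have i3 : leb.-integrable `]s, n[
    (EFin \o (fun t => psi s * p t + (p t * A t + p t * C t))).
  exact: (integrableD mI ip iac).
have -> : \int[leb]_(t in `]s, n[) (p t * psi t) =
    \int[leb]_(t in `]s, n[) (psi s * p t + (p t * A t + p t * C t)).
  rewrite Rintegral_indic [RHS]Rintegral_indic; apply: ae_eq_Rintegral.
  - exact: integrable_indicM.
  - exact: integrable_indicM.
  apply: filterS Gamma0 => t gt; rewrite indicE.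
  case: (boolP (t \in _)) => [|_]; last by rewrite !mul0r.
  rewrite inE/= in_itv/= => /andP[st _]; rewrite !mul1r.
  rewrite -(subrK (psi s) (psi t)) (dpsi st gt) -/(A t) -/(C t); ring.
rewrite (RintegralD mI ip iac) (RintegralD mI pa1 pc1) (RintegralZl (psi s) mI pi) pa3 pc3.
have -> : \int[leb]_(y in `]s, n[) (a y * \int[leb]_(x in `]y, n[) p x) =
    Phi n * \int[leb]_(t in `]s, n[) a t - \int[leb]_(t in `]s, n[) (Phi t * a t).
  rewrite -(RintegralZl (Phi n) mI ai) -(RintegralB mI za phia).
  apply: eq_Rintegral => y; rewrite inE/= in_itv/= => /PhiE ->; ring.
have -> : \int[mu]_(y in `]s, n[) (c y * \int[leb]_(x in `]y, n[) p x) =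
    Phi n * \int[mu]_(t in `]s, n[) c t - \int[mu]_(t in `]s, n[) (Phi t * c t).
  rewrite -(RintegralZl (Phi n) mI cis) -(RintegralB mI zc phic).
  apply: eq_Rintegral => y; rewrite inE/= in_itv/= => /PhiE ->; ring.
have en := dpsi sn gn.
rewrite -(dPhi (ltW sn)).
have -> : Phi n * psi n - Phi s * psi s =
  psi s * (Phi n - Phi s) + Phi n * (psi n - psi s) by ring.
by rewrite en; ring.
Qed.

End by_parts.

(** * Symmetry and uniqueness for the first order system *)

Section data_properties.
Variables (R : realType) (Gamma : set R).
Local Notation RT := (measurableTypeR R).
Variables (mu : {finite_measure set RT -> \bar R}) (b : RT -> R) (a : R).
Hypothesis bi : rintegrable mu b.
Hypothesis b0 : forall y, ~ Gamma y -> b y = 0.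
Hypothesis Gamma_a : forall y, Gamma y -> `|y| <= a.
Hypothesis Gamma0 : {ae leb, forall x : RT, ~ Gamma x}.
Hypothesis Gamma_closed : closed Gamma.

Local Notation data := (delta'_data Gamma mu b).

Lemma continuous_singular_integrable (P : R -> R) : continuous P ->
  rintegrable mu (fun y => b y * P y).
Proof.
move=> cP.
have [M PM] : exists M, forall x, x \in `[- a, a] -> `|P x| <= M.
  have := @segment_compact R (- a) a.
  move=> /(continuous_compact (continuous_subspaceT (cP : continuous P))).
  move=> /compact_bounded[M [_ /(_ (M + 1))]]; rewrite ltrDl ltr01 => /(_ isT) h.
  by exists (M + 1) => x xa; apply: h; exists x.
pose p (y : RT) := \1_(`[- a, a]) y * P y.
have mp : measurable_fun [set: RT] p.
  apply: measurable_funM; first exact: measurable_indic.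
  exact: continuous_measurable_fun.
have pM y : `|p y| <= Num.max M 0.
  rewrite /p indicE; case: (boolP (y \in _)) => [|_].
    by rewrite mul1r inE/= le_max => /PM ->.
  by rewrite mul0r normr0 le_max lexx orbT.
have := bounded_mul_integrable bi mp pM.
congr rintegrable; apply/funext => y.
have [/Gamma_a|/b0->] := pselect (Gamma y); last by rewrite !mul0r.
rewrite ler_norml => ya; rewrite /p indicE mem_set ?mul1r//=.
Qed.

(** The increment formula is postulated off [Gamma] only; density of the
    complement and continuity extend it to all end points. *)
Lemma data_P_increment psi P p2 : data psi P p2 -> forall s x, s <= x ->
  P x - P s = \int[leb]_(t in `]s, x[) p2 t.
Proof.
move=> [_ _ p2i cP dP] s x; rewrite le_eqVlt => /predU1P[->|sx].
  by rewrite subrr set_itvoo0 ?Rintegral_set0.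
apply/eqP; rewrite -subr_eq0 -normr_le0; apply/ler_addgt0Pr => e e0.
rewrite add0r.
pose N := \int[leb]_t (p2 t ^+ 2).
have N0 : 0 <= N by exact: Rintegral_sqr_ge0.
have N1 : 0 < N + 1 by rewrite ltr_wpDl.
have e4 : 0 < e / 4 by rewrite divr_gt0.
have small (y z : R) : y < z -> z - y < (e / 4) ^+ 2 / (N + 1) ->
    `|\int[leb]_(t in `]y, z[) p2 t| <= e / 4.
  move=> yz yze; rewrite -(@ler_pXn2r _ 2%N) ?nnegrE ?(ltW e4)//.
  rewrite real_normK ?num_real// (le_trans (L2_increment_le p2i (ltW yz)))//.
  rewrite -/N (@le_trans _ _ ((z - y) * (N + 1)))//.
    by rewrite ler_wpM2l ?subr_ge0 ?(ltW yz)// lerDl.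
  by rewrite -ler_pdivlMr// ltW.
have /cvgrPdist_lt/(_ _ e4)/nbhs_ballP[d1 /= d10 hd1] := cP s.
have /cvgrPdist_lt/(_ _ e4)/nbhs_ballP[d2 /= d20 hd2] := cP x.
pose d3 := (e / 4) ^+ 2 / (N + 1).
have d30 : 0 < d3 by rewrite divr_gt0// exprn_gt0.
pose r := Num.min (Num.min d1 d2) (Num.min d3 ((x - s) / 2)).
have r0 : 0 < r by rewrite !lt_min d10 d20 d30/= divr_gt0// subr_gt0.
have [r1 r2 r3 r4] : [/\ r <= d1, r <= d2, r <= d3 & r <= (x - s) / 2].
  by rewrite /r !ge_min !lexx ?orbT.
have [s' /andP[ss' s'r] gs'] : exists2 y, s < y < s + r & ~ Gamma y.
  by apply: (null_dense Gamma0); rewrite ltrDl.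
have [x' /andP[xr' x'x] gx'] : exists2 y, x - r < y < x & ~ Gamma y.
  by apply: (null_dense Gamma0); rewrite ltrBlDr ltrDl.
have s'x' : s' < x' by lra.
have h1 : `|P s - P s'| < e / 4.
  by apply: hd1; rewrite /ball/= distrC gtr0_norm ?subr_gt0//; lra.
have h2 : `|P x - P x'| < e / 4.
  by apply: hd2; rewrite /ball/= gtr0_norm ?subr_gt0//; lra.
have h3 : `|\int[leb]_(t in `]s, s'[) p2 t| <= e / 4.
  by apply: small => //; rewrite -/d3; lra.
have h4 : `|\int[leb]_(t in `]x', x[) p2 t| <= e / 4.
  by apply: small => //; rewrite -/d3; lra.
have pI := L2_integrable_oo s x p2i.
rewrite (Rintegral_oo_split (y := s') _ _ pI) ?(ltW ss')//; last by lra.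
rewrite (Rintegral_oo_split (y := x') _ _ (L2_integrable_oo s' x p2i)) ?(ltW s'x') ?(ltW x'x)//.
rewrite -(dP _ _ gs' gx' s'x').1.
move: h1 h2 h3 h4; set A := \int[leb]_(t in _) _; set B := \int[leb]_(t in _) _.
rewrite ltr_norml => /andP[? ?]; rewrite ltr_norml => /andP[? ?].
rewrite ler_norml => /andP[? ?]; rewrite ler_norml => /andP[? ?].
by rewrite ler_norml; apply/andP; split; lra.
Qed.

(** An integrable function cannot stay above [e] in absolute value on a set of
    large measure. *)
Lemma small_value (w : RT -> R) (u v e : R) : rintegrable leb w -> u < v -> 0 < e ->
  \int[leb]_t `|w t| < e * (v - u) ->
  exists2 x, u < x < v & ~ Gamma x /\ `|w x| < e.
Proof.
move=> wi uv e0 we; apply: contrapT => h.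
have nw := rintegrable_norm wi.
suff : e * (v - u) <= \int[leb]_t `|w t| by rewrite leNgt we.
have iu := rintegrableZ e (rintegrable_indic_oo u v).
have -> : e * (v - u) = \int[leb]_t (e * \1_(`]u, v[) t).
  rewrite RintegralZl//; last exact: rintegrable_indic_oo.
  congr (_ * _).
  rewrite /Rintegral integral_indic//= setIT lebesgue_measure_itv/= lte_fin.
  by rewrite uv.
rewrite -lee_fin -!rintegrable_fin//.
apply: ae_ge0_le_integral => //.
- by move=> t _; rewrite lee_fin mulr_ge0// ltW.
- by apply/measurable_EFinP; exact: rintegrable_measurable iu.
- by apply/measurable_EFinP; exact: rintegrable_measurable nw.
apply: filterS Gamma0 => t gt _; rewrite lee_fin indicE.
case: (boolP (t \in _)) => [|_]; last by rewrite mulr0.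
rewrite inE/= in_itv/= mulr1 leNgt => tuv; apply/negP => wt.
by apply: h; exists t.
Qed.

Lemma Rintegral_exhaust (d : RT -> R) (s_ x_ : nat -> R) : rintegrable leb d ->
  (forall n, s_ n < - n%:R) -> (forall n, n%:R < x_ n) ->
  (fun n => \int[leb]_(t in `]s_ n, x_ n[) d t) @ \oo --> \int[leb]_t d t.
Proof.
move=> di sn xn.
have md := rintegrable_measurable di.
pose f_ n (t : RT) := ((\1_(`]s_ n, x_ n[) t * d t)%:E : \bar R).
have fi n : rintegrable leb (fun t => \1_(`]s_ n, x_ n[) t * d t).
  exact: rintegrable_indic.
have h : (\int[leb]_t f_ n t)%E @[n --> \oo] --> (\int[leb]_t (d t)%:E)%E.
  apply: (@dominated_cvg _ RT R leb setT measurableT f_ _ (fun t => (`|d t|)%:E)) => //.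
  - by move=> n; apply/measurable_EFinP; exact: rintegrable_measurable (fi n).
  - move=> t _; apply: cvg_near_cst.
    have [N _ hN] := nbhs_infty_gtr `|t|.
    exists N => // n /hN /= tn; rewrite /f_ indicE mem_set ?mul1r//=.
    rewrite in_itv/=; move: tn; rewrite ltr_norml => /andP[t1 t2].
    by rewrite (lt_trans (sn n) t1) (lt_trans t2 (xn n)).
  - exact: rintegrable_norm.
  - move=> n t _; rewrite lee_fin normrM ler_piMl//; exact: norm_indic.
rewrite rintegrable_fin// in h.
have -> : (fun n => \int[leb]_(t in `]s_ n, x_ n[) d t) =
    fine \o (fun n => \int[leb]_t f_ n t)%E.
  by apply/funext => n; rewrite Rintegral_indic.
exact: fine_cvg h.
Qed.

(** Green's formula on intervals whose end points are chosen so that the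
    boundary terms tend to zero; the singular terms of the two integrations by
    parts are equal. *)
Lemma data_symmetric psi P p2 phi Q q2 : data psi P p2 -> data phi Q q2 ->
  \int[leb]_t (p2 t * phi t) = \int[leb]_t (psi t * q2 t).
Proof.
move=> D1 D2.
have dP := data_P_increment D1; have dQ := data_P_increment D2.
have [psii Pi p2i cP dpsi] := D1; have [phii Qi q2i cQ dphi] := D2.
have bP := continuous_singular_integrable cP.
have bQ := continuous_singular_integrable cQ.
pose w t := P t * phi t - Q t * psi t.
pose d t := p2 t * phi t - psi t * q2 t.
have wi : rintegrable leb w.
  by apply: rintegrableB; exact: square_integrableM.
have i1 := square_integrableM p2i phii.
have i2 := square_integrableM psii q2i.
have di : rintegrable leb d by exact: rintegrableB.
have wd s n : s < n -> ~ Gamma s -> ~ Gamma n ->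
    w n - w s = \int[leb]_(t in `]s, n[) d t.
  move=> sn gs gn.
  have i1' : leb.-integrable `]s, n[ (EFin \o (fun t => p2 t * phi t)).
    by apply: integrableS i1.
  have i2' : leb.-integrable `]s, n[ (EFin \o (fun t => q2 t * psi t)).
    have -> : (fun t => q2 t * psi t) = (fun t => psi t * q2 t).
      by apply/funext => t; rewrite mulrC.
    by apply: integrableS i2.
  have [_ _ e1] := by_parts Gamma0 sn (L2_integrable_oo s n p2i)
    (L2_integrable_oo s n Qi) bQ dP (fun x sx gx => (dphi s x gs gx sx).2) gn i1'.
  have [_ _ e2] := by_parts Gamma0 sn (L2_integrable_oo s n q2i)
    (L2_integrable_oo s n Pi) bP dQ (fun x sx gx => (dpsi s x gs gx sx).2) gn i2'.
  rewrite /d RintegralB//; last by apply: integrableS i2.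
  have -> : w n - w s = (P n * phi n - P s * phi s) - (Q n * psi n - Q s * psi s).
    by rewrite /w; ring.
  rewrite e1 e2.
  have -> : \int[leb]_(t in `]s, n[) (Q t * P t) =
      \int[leb]_(t in `]s, n[) (P t * Q t).
    by apply: eq_Rintegral => t _; rewrite mulrC.
  have -> : \int[mu]_(t in `]s, n[) (Q t * (b t * P t)) =
      \int[mu]_(t in `]s, n[) (P t * (b t * Q t)).
    by apply: eq_Rintegral => t _; ring.
  have -> : \int[leb]_(t in `]s, n[) (q2 t * psi t) =
      \int[leb]_(t in `]s, n[) (psi t * q2 t).
    by apply: eq_Rintegral => t _; rewrite mulrC.
  by ring.
suff d0 : \int[leb]_t d t = 0.
  by move: d0; rewrite RintegralB// => /eqP; rewrite subr_eq0 => /eqP.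
pose W := \int[leb]_t `|w t|.
have W0 : 0 <= W by apply: Rintegral_ge0.
have sv (n : nat) : W < n.+1%:R^-1 * ((W + 1) * n.+1%:R).
  by rewrite mulrCA mulVf// mulr1; lra.
have T0 (n : nat) : 0 < (W + 1) * n.+1%:R by rewrite mulr_gt0// ltr_wpDl.
have ex n : exists x, [/\ n%:R < x, ~ Gamma x & `|w x| < n.+1%:R^-1].
  have [|||x /andP[nx _] [gx wx]] := @small_value w n%:R (n%:R + (W + 1) * n.+1%:R) n.+1%:R^-1 wi.
  - by rewrite ltrDl.
  - by [].
  - by rewrite addrAC subrr add0r; exact: sv.
  by exists x.
have es n : exists x, [/\ x < - n%:R, ~ Gamma x & `|w x| < n.+1%:R^-1].
  have [|||x /andP[_ nx] [gx wx]] := @small_value w (- n%:R - (W + 1) * n.+1%:R) (- n%:R) n.+1%:R^-1 wi.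
  - by rewrite ltrBlDr ltrDl.
  - by [].
  - by rewrite opprB addrC subrK; exact: sv.
  by exists x.
(* End points off [Gamma] at which the boundary term is less than [1 / (n + 1)]. *)
pose x_ n := projT1 (cid (ex n)); pose s_ n := projT1 (cid (es n)).
have hx n : [/\ n%:R < x_ n, ~ Gamma (x_ n) & `|w (x_ n)| < n.+1%:R^-1].
  by rewrite /x_; case: cid.
have hs n : [/\ s_ n < - n%:R, ~ Gamma (s_ n) & `|w (s_ n)| < n.+1%:R^-1].
  by rewrite /s_; case: cid.
have lim1 := Rintegral_exhaust di (fun n => let: And3 h _ _ := hs n in h)
  (fun n => let: And3 h _ _ := hx n in h).
have lim2 : (fun n => \int[leb]_(t in `]s_ n, x_ n[) d t) @ \oo --> (0 : R).
  apply: norm_cvg0; apply: (@squeeze_cvgr _ _ _ _ (fun=> 0) (fun n => 2 * n.+1%:R^-1)).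
  - apply: nearW => n; rewrite normr_ge0/=.
    have [sn gs ws] := hs n; have [xn gx wx] := hx n.
    have n0 : (0 : R) <= n%:R by [].
    rewrite -wd//; last by lra.
    by rewrite (le_trans (ler_normB _ _))// mulr_natl mulr2n lerD// ltW.
  - exact: cvg_cst.
  - rewrite -(mulr0 2); apply: cvgMr; exact: cvg_harmonic.
exact: cvg_unique lim1 lim2.
Qed.

(** If [P] did not vanish at a point, it would keep a constant sign nearby, and
    there, on a small interval free of points of [Gamma], [psi] would be
    strictly monotone. *)
Lemma data_vanish psi P p2 (u v : R) : data psi P p2 ->
  {ae leb, forall t : RT, u < t < v -> psi t = 0} ->
  forall t, u < t < v -> P t = 0.
Proof.
move=> [psii Pi p2i cP dpsi] psi0 y /andP[uy yv]; apply/eqP/contraT => Py.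
have bP := continuous_singular_integrable cP.
have Py0 : 0 < `|P y| / 2 by rewrite divr_gt0// normr_gt0.
have /cvgrPdist_lt/(_ _ Py0)/nbhs_ballP[d1 /= d10 hd1] := cP y.
pose r := Num.min d1 (v - y).
have r0 : 0 < r by rewrite lt_min d10 subr_gt0.
have [r1 r2] : r <= d1 /\ r <= v - y by rewrite /r !ge_min !lexx ?orbT.
have [y' /andP[yy' y'r] gy'] : exists2 t, y < t < y + r & ~ Gamma t.
  by apply: (null_dense Gamma0); rewrite ltrDl.
have /nbhs_ballP[d2 /= d20 hd2] : nbhs y' (~` Gamma).
  by apply: open_nbhs_nbhs; split=> //; exact: closed_openC.
pose q := Num.min d2 (Num.min (y' - y) (y + r - y')).
have q0 : 0 < q by rewrite !lt_min d20 !subr_gt0 yy' y'r.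
have [q1 q2 q3] : [/\ q <= d2, q <= y' - y & q <= y + r - y'].
  by rewrite /q !ge_min !lexx ?orbT.
have psi0' : {ae leb, forall t : RT, ~ ~ (u < t < v -> psi t = 0)}.
  by move: psi0; apply: filterS => t h; exact.
have [s /andP[s1 s2] hs] : exists2 t, y' - q < t < y' & ~ ~ (u < t < v -> psi t = 0).
  by apply: (null_dense psi0'); rewrite ltrBlDr ltrDl.
have [x /andP[x1 x2] hx] : exists2 t, y' < t < y' + q & ~ ~ (u < t < v -> psi t = 0).
  by apply: (null_dense psi0'); rewrite ltrDl.
have ps : psi s = 0.
  apply: (contrapT hs); apply/andP; split; lra.
have px : psi x = 0.
  apply: (contrapT hx); apply/andP; split; lra.
have sx : s < x by lra.
have gsx t : s <= t -> t <= x -> ~ Gamma t.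
  move=> st tx; apply: hd2; rewrite /ball/= ltr_norml; apply/andP; split; lra.
have gs : ~ Gamma s by apply: gsx => //; exact: ltW.
have gx : ~ Gamma x by apply: gsx => //; exact: ltW.
have [_] := dpsi s x gs gx sx.
rewrite ps px subrr (_ : \int[mu]_(t in `]s, x[) (b t * P t) = 0); last first.
  transitivity (\int[mu]_(t in `]s, x[) (0 : R)); last first.
    by rewrite Rintegral_cst ?mul0r//; exact: measurable_itv.
  apply: eq_Rintegral => t; rewrite inE/= in_itv/= => /andP[st tx].
  by rewrite b0 ?mul0r//; apply: gsx; exact: ltW.
rewrite addr0 => /esym intP.
have cD : continuous (fun t => P y - P t).
  by move=> t; apply: cvgB; [exact: cvg_cst|exact: cP].
have iD := continuous_integrable_oo s x cD.
have iP := continuous_integrable_oo s x cP.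
have iC := continuous_integrable_oo s x (@cst_continuous R R (P y)).
have mI : measurable (`]s, x[%classic : set RT) by exact: measurable_itv.
have leng : fine (lebesgue_measure (`]s, x[%classic : set RT)) = x - s.
  by rewrite lebesgue_measure_itv/= lte_fin sx.
have e1 : \int[leb]_(t in `]s, x[) (P y - P t) = P y * (x - s).
  by rewrite RintegralB// intP subr0 Rintegral_cst// leng.
have : `|\int[leb]_(t in `]s, x[) (P y - P t)| <= `|P y| / 2 * (x - s).
  rewrite (le_trans (le_normr_Rintegral mI iD))//.
  have <- : \int[leb]_(t in `]s, x[) (`|P y| / 2) = `|P y| / 2 * (x - s).
    by rewrite Rintegral_cst// leng.
  apply: le_Rintegral => //.
  - exact: integrable_norm iD.
  - exact: (continuous_integrable_oo s x (@cst_continuous R R (`|P y| / 2))).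
  - move=> t /=; rewrite in_itv/= => /andP[st tx]; apply/ltW/hd1.
    by rewrite /ball/= ltr_norml; apply/andP; split; lra.
rewrite e1 normrM (gtr0_norm (_ : 0 < x - s)) ?subr_gt0//.
rewrite ler_pM2r ?subr_gt0//.
have : 0 < `|P y| by rewrite normr_gt0.
by move=> *; lra.
Qed.

(** All the integrals of [p2] over intervals vanish, so Lebesgue
    differentiation applies. *)
Lemma data_zero psi P p2 : data psi P p2 -> (forall t, P t = 0) ->
  {ae leb, forall t : RT, p2 t = 0}.
Proof.
move=> D P0; have dP := data_P_increment D.
have [_ _ p2i _ _] := D.
have int0 s x : s <= x -> \int[leb]_(t in `]s, x[) p2 t = 0.
  by move=> sx; rewrite -dP// !P0 subrr.
have h (n : nat) : {ae leb, forall t : RT, - n%:R < t < n%:R -> p2 t = 0}.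
  pose g t := \1_(`]- n%:R, n%:R[) t * p2 t.
  have gi : rintegrable leb g.
    by apply: integrable_indicM => //; exact: L2_integrable_oo.
  have loc : locally_integrable [set: R] g.
    have := integrable_locally measurableT gi.
    by rewrite (_ : g \_ [set: R] = g)//; apply/funext => t; rewrite patchE in_setT.
  have giy y : leb.-integrable `]-oo, y] (EFin \o g) by apply: integrableS gi.
  have F0 y : \int[leb]_(t in `]-oo, y]) g t = 0.
    have nn : (0 : R) <= n%:R by [].
    pose z := Num.max (Num.min y n%:R) (- n%:R).
    have nz : - n%:R <= z by rewrite /z le_max lexx orbT.
    have iz : rintegrable leb (fun t => \1_(`]- n%:R, z[) t * p2 t).
      by apply: integrable_indicM => //; exact: L2_integrable_oo.
    have iy : rintegrable leb (fun t => \1_(`]-oo, y]) t * g t).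
      by apply: integrable_indicM => //; exact: giy.
    rewrite Rintegral_indic (ae_eq_Rintegral iy iz).
      by rewrite -Rintegral_indic int0.
    apply: filterS (ae_neq y) => t ty; rewrite /g mulrA; congr (_ * _).
    rewrite !indicE !mem_setE !in_itv/= /z.
    rewrite lt_max lt_min -natrM mulnb; congr (_%:R); congr (nat_of_bool _).
    rewrite [t <= y]le_eqVlt (negbTE ty)/=.
    by case: (ltP t y); case: (ltP (- n%:R) t); case: (ltP t n%:R) => //= *; lra.
  have := @FTC1Ny R g giy loc.
  apply: filterS; first exact: (ae_filter_ringOfSetsType leb).
  move=> t /= [_ ft] tn; move: ft.
  rewrite (_ : (fun x => \int[leb]_(t in `]-oo, x]) g t) = cst 0); last exact/funext.
  have tn' : t \in `]- n%:R, n%:R[%classic by rewrite mem_setE in_itv.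
  by rewrite derive1_cst /g indicE tn' mul1r => <-.
move: (ae_foralln h); apply: filterS => t ht.
have [N _ /(_ N (leqnn N)) /= hN] := nbhs_infty_gtr `|t|.
by apply: (ht N); rewrite -ltr_norml.
Qed.

End data_properties.

(** * Smooth functions and cutoffs *)

Section compactly_supported_smooth.
Variables (R : realType) (S : set R).
Local Notation RT := (measurableTypeR R).
Hypothesis cS : compact S.

(** A test function on the line whose support lies in [S]. *)
Definition smooth_in (f : R -> R) : Prop :=
  (forall n x, derivable (f^`(n))%classic x 1) /\ (forall x, ~ S x -> f x = 0).

Let closedS : closed S.
Proof. exact: compact_closed (@Rhausdorff R) cS. Qed.

Lemma smooth_in_derive f : smooth_in f -> smooth_in (f^`())%classic.
Proof.
move=> [df f0]; split=> [n x|x xS].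
  by have := df n.+1 x; rewrite derive1Sn.
rewrite derive1E; have : (0 : R) = 'D_1 (cst 0 : R -> R) x by rewrite derive_cst.
move=> ->; apply: near_eq_derive.
have : nbhs x (~` S) by apply: open_nbhs_nbhs; split=> //; exact: closed_openC.
by apply: filterS => y yS; rewrite f0.
Qed.

Lemma smooth_in_is_derive (f : R -> R) (x : R) : smooth_in f -> is_derive x 1 f (f^`() x)%classic.
Proof.
move=> [/(_ 0%N x) df _]; rewrite derive1E.
by apply: DeriveDef.
Qed.

Lemma smooth_in_continuous f : smooth_in f -> continuous f.
Proof.
move=> [df _] x; apply: differentiable_continuous; apply/derivable1_diffP.
exact: (df 0%N x).
Qed.

Lemma smooth_in_increment (f : R -> R) (x y : R) : smooth_in f -> x <= y ->
  f y - f x = \int[leb]_(t in `]x, y[) (f^`() t)%classic.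
Proof.
move=> sf xy; rewrite (Rintegral_oo_FTC xy _ (fun t => smooth_in_is_derive t sf))//.
exact: smooth_in_continuous (smooth_in_derive sf).
Qed.

Lemma smooth_in_bounded f : smooth_in f -> exists c : R, forall x, `|f x| <= c.
Proof.
move=> sf; have cf := smooth_in_continuous sf.
have := continuous_compact (continuous_subspaceT cf) cS.
move=> /compact_bounded[M [_ /(_ (M + 1))]]; rewrite ltrDl ltr01 => /(_ isT) h.
exists (Num.max (M + 1) 0) => x; have [xS|xS] := pselect (S x).
  by rewrite le_max; apply/orP; left; apply: h; exists x.
by rewrite (proj2 sf _ xS) normr0 le_max lexx orbT.
Qed.

Lemma smooth_in_square_integrable f : smooth_in f -> square_integrable leb f.
Proof.
move=> sf; have cf := smooth_in_continuous sf.
have mf : measurable_fun [set: RT] f by exact: continuous_measurable_fun.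
split=> //.
have [N SN] : exists N, forall x, S x -> `|x| < N.
  move: (compact_bounded cS) => [M [_ /(_ (M + 1))]].
  rewrite ltrDl ltr01 => /(_ isT) h; exists (M + 2) => x /h/= xM.
  by apply: (le_lt_trans xM); rewrite ltrD2l ltr1n.
have [c fc] := smooth_in_bounded sf.
have := @bounded_integrable_oo R (fun x => f x ^+ 2) (c ^+ 2) (- N) N
  (measurable_funX 2%N mf).
have h x : `|f x ^+ 2| <= c ^+ 2.
  by rewrite normrX ler_pXn2r// ?nnegrE// (le_trans (normr_ge0 _) (fc x)).
move=> /(_ h); congr rintegrable; apply/funext => x.
rewrite indicE; case: (boolP (x \in _)); first by rewrite mul1r.
rewrite mul0r notin_setE/= in_itv/= => /negP xN.
have [/SN|/(proj2 sf)->] := pselect (S x); last by rewrite expr0n.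
by rewrite ltr_norml (negbTE xN).
Qed.

End compactly_supported_smooth.

Section cutoff_data.
Variables (R : realType) (Gamma : set R).
Local Notation RT := (measurableTypeR R).
Variables (mu : {finite_measure set RT -> \bar R}) (b : RT -> R) (a : R).
Hypothesis bi : rintegrable mu b.
Hypothesis b0 : forall y, ~ Gamma y -> b y = 0.
Hypothesis Gamma_a : forall y, Gamma y -> `|y| <= a.
Hypothesis Gamma0 : {ae leb, forall x : RT, ~ Gamma x}.
Hypothesis Gamma_closed : closed Gamma.

Local Notation data := (delta'_data Gamma mu b).

Lemma square_integrable_bounded (k f : RT -> R) (c : R) :
  measurable_fun [set: RT] k -> (forall x, `|k x| <= c) ->
  square_integrable leb f -> square_integrable leb (fun x => k x * f x).
Proof.
move=> mk kc [mf fi]; split; first exact: measurable_funM.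
have := @rintegrable_bounded _ RT R leb (fun x => k x ^+ 2) _ (c ^+ 2)
  (measurable_funX 2%N mk) _ fi.
have h x : `|k x ^+ 2| <= c ^+ 2.
  by rewrite normrX ler_pXn2r// ?nnegrE// (le_trans (normr_ge0 _) (kc x)).
by move=> /(_ h); congr rintegrable; apply/funext => x; rewrite exprMn.
Qed.

Lemma singular_integral0 (P : RT -> R) (s x : R) :
  (forall t, s < t < x -> ~ Gamma t) -> \int[mu]_(t in `]s, x[) (b t * P t) = 0.
Proof.
move=> gsx; transitivity (\int[mu]_(t in `]s, x[) (0 : R)); last first.
  by rewrite Rintegral_cst ?mul0r//; exact: measurable_itv.
apply: eq_Rintegral => t; rewrite inE/= in_itv/= => /gsx/b0->.
by rewrite mul0r.
Qed.

Lemma data_psi_continuous psi P p2 x : data psi P p2 -> ~ Gamma x ->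
  {for x, continuous psi}.
Proof.
move=> [psii Pi p2i cP dpsi] gx.
have /nbhs_ballP[e /= e0 he] : nbhs x (~` Gamma).
  by apply: open_nbhs_nbhs; split=> //; exact: closed_openC.
apply: (@increment_continuous _ _ P x e) => // s t se te st.
have [_ ->] := dpsi s t (he _ se) (he _ te) st.
rewrite singular_integral0 ?addr0// => y /andP[sy yt]; apply: he.
move: se te; rewrite /ball/= !ltr_norml => /andP[? ?] /andP[? ?].
by apply/andP; split; lra.
Qed.

Lemma smooth_data (S : set R) (f : R -> R) : compact S -> smooth_in S f ->
  (forall x, Gamma x -> (f^`() x)%classic = 0) ->
  data f (f^`())%classic ((f^`())^`())%classic.
Proof.
move=> cS sf f10.
have s1 := smooth_in_derive cS sf; have s2 := smooth_in_derive cS s1.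
split.
- exact (smooth_in_square_integrable cS sf).
- exact (smooth_in_square_integrable cS s1).
- exact (smooth_in_square_integrable cS s2).
- exact: smooth_in_continuous s1.
move=> s x _ _ /ltW sx; split; first exact (smooth_in_increment cS s1 sx).
rewrite (smooth_in_increment cS sf sx) -[LHS]addr0; congr (_ + _).
transitivity (\int[mu]_(t in `]s, x[) (0 : R)).
  by rewrite Rintegral_cst ?mul0r//; exact: measurable_itv.
apply: eq_Rintegral => t _.
by have [/f10->|/b0->] := pselect (Gamma t); rewrite ?mulr0 ?mul0r.
Qed.

(** The derivative of the product acquires the term [chi' psi], which is
    continuous although [psi] is not: near [Gamma] the factor [chi'] vanishes. *)
Lemma cutoff_data (S : set R) (chi : R -> R) psi P p2 :
  compact S -> smooth_in S chi ->
  (forall x, Gamma x -> \forall y \near x, (chi^`() y)%classic = 0) ->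
  data psi P p2 ->
  let chi1 := (chi^`())%classic in let chi2 := (chi1^`())%classic in
  data (fun x => chi x * psi x) (fun x => chi x * P x + chi1 x * psi x)
    (fun x => chi x * p2 x + 2 * (chi1 x * P x) + chi2 x * psi x).
Proof.
move=> cS sc0 near0 D chi1 chi2.
have chi10 x : Gamma x -> chi1 x = 0 by move=> /near0/nbhs_singleton.
have sc1 : smooth_in S chi1 := smooth_in_derive cS sc0.
have sc2 : smooth_in S chi2 := smooth_in_derive cS sc1.
have [c0 hc0] := smooth_in_bounded cS sc0.
have [c1 hc1] := smooth_in_bounded cS sc1.
have [c2 hc2] := smooth_in_bounded cS sc2.
have m0 : measurable_fun [set: RT] chi.
  exact: continuous_measurable_fun (smooth_in_continuous sc0).
have m1 : measurable_fun [set: RT] chi1.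
  exact: continuous_measurable_fun (smooth_in_continuous sc1).
have m2 : measurable_fun [set: RT] chi2.
  exact: continuous_measurable_fun (smooth_in_continuous sc2).
have [psii Pi p2i cP dpsi] := D.
have dP := data_P_increment Gamma0 D.
have s0psi := square_integrable_bounded m0 hc0 psii.
have s0P := square_integrable_bounded m0 hc0 Pi.
have s0p2 := square_integrable_bounded m0 hc0 p2i.
have s1psi := square_integrable_bounded m1 hc1 psii.
have s1P := square_integrable_bounded m1 hc1 Pi.
have s2psi := square_integrable_bounded m2 hc2 psii.
have sP2 := square_integrableD (square_integrableD s0p2 (square_integrableZ 2 s1P)) s2psi.
split=> //.
- exact: square_integrableD.
- move=> x; apply: cvgD.
    by apply: cvgM; [exact: smooth_in_continuous sc0 x|exact: cP].
  have [xG|xG] := pselect (Gamma x); last first.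
    apply: cvgM; [exact: smooth_in_continuous sc1 x|].
    exact: (data_psi_continuous D xG).
  rewrite (chi10 _ xG) mul0r; apply: cvg_near_cst.
  by apply: filterS (near0 _ xG) => y; rewrite /chi1 => ->; rewrite mul0r.
move=> s x gs gx sx.
have bP := continuous_singular_integrable bi b0 Gamma_a cP.
have L f : square_integrable leb f -> leb.-integrable `]s, x[ (EFin \o f).
  exact: L2_integrable_oo.
have sm f : smooth_in S f -> leb.-integrable `]s, x[ (EFin \o f).
  by move=> sf; apply: L; exact (smooth_in_square_integrable cS sf).
have dpsi' t (st : s < t) (gt : ~ Gamma t) := (dpsi s t gs gt st).2.
have dP' t (st : s < t) (gt : ~ Gamma t) :
    P t - P s = \int[leb]_(y in `]s, t[) p2 y + \int[mu]_(y in `]s, t[) (0 : R).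
  rewrite (dP _ _ (ltW st)) Rintegral_cst; last exact: measurable_itv.
  by rewrite mul0r addr0.
have z0 : rintegrable mu (fun=> 0 : R).
  have := rintegrableZ 0 bi.
  by congr rintegrable; apply/funext => t; rewrite mul0r.
have [_ _ e1] := by_parts Gamma0 sx (sm _ sc1) (L _ Pi) bP
  (fun u v => smooth_in_increment cS sc0) dpsi' gx (L _ s1psi).
have [_ _ e2] := by_parts Gamma0 sx (sm _ sc1) (L _ p2i) z0
  (fun u v => smooth_in_increment cS sc0) dP' gx (L _ s1P).
have [_ _ e3] := by_parts Gamma0 sx (sm _ sc2) (L _ Pi) bP
  (fun u v => smooth_in_increment cS sc1) dpsi' gx (L _ s2psi).
have q0 : \int[mu]_(t in `]s, x[) (chi t * 0) = 0.
  under eq_Rintegral do rewrite mulr0.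
  by rewrite Rintegral_cst ?mul0r//; exact: measurable_itv.
have q1 : \int[mu]_(t in `]s, x[) (chi1 t * (b t * P t)) = 0.
  transitivity (\int[mu]_(t in `]s, x[) (0 : R)); last first.
    by rewrite Rintegral_cst ?mul0r//; exact: measurable_itv.
  apply: eq_Rintegral => t _.
  by have [/chi10->|/b0->] := pselect (Gamma t); rewrite !(mul0r, mulr0).
rewrite q0 addr0 in e2; rewrite q1 addr0 in e3.
split.
- rewrite RintegralD//; [|exact: (L _ (square_integrableD s0p2 (square_integrableZ 2 s1P)))|exact: L].
  rewrite RintegralD//; [|exact: L|exact: (L _ (square_integrableZ 2 s1P))].
  rewrite RintegralZl//; last exact: L.
  transitivity ((chi x * P x - chi s * P s) + (chi1 x * psi x - chi1 s * psi s)).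
    by ring.
  by rewrite e2 e3; ring.
- rewrite e1 RintegralD//; [|exact: L|exact: L].
  rewrite [_ + \int[leb]_(t in _) (chi1 t * _)]addrC; congr (_ + _).
  apply: eq_Rintegral => t _; rewrite mulrDr.
  have [/chi10->|/b0->] := pselect (Gamma t); ring.
Qed.

End cutoff_data.

(** * Weak derivatives and continuous extensions *)

Lemma ae_rintegrable d (T : measurableType d) (R : realType)
    (m : {measure set T -> \bar R}) (f g : T -> R) :
  measurable_fun [set: T] f -> rintegrable m g ->
  {ae m, forall t, f t = g t} -> rintegrable m f.
Proof.
move=> mf gi fg; apply/integrableP; split; first exact/measurable_EFinP.
have /integrableP[mg] := rintegrable_norm gi.
apply: le_lt_trans; apply: ae_ge0_le_integral => //.
- apply/measurable_EFinP; exact: measurableT_comp.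
- by apply: measurableT_comp => //; exact: mg.
- by apply: filterS fg => t e _ /=; rewrite e normr_id.
Qed.

Section parts.
Variables (R : realType) (Gamma : set R).
Local Notation RT := (measurableTypeR R).
Variables (mu : {finite_measure set RT -> \bar R}) (b : RT -> R) (a : R).
Hypothesis bi : rintegrable mu b.
Hypothesis b0 : forall y, ~ Gamma y -> b y = 0.
Hypothesis Gamma_a : forall y, Gamma y -> `|y| <= a.
Hypothesis Gamma0 : {ae leb, forall x : RT, ~ Gamma x}.
Hypothesis Gamma_closed : closed Gamma.

Local Notation data := (delta'_data Gamma mu b).

Lemma measurable_off : measurable (~` Gamma : set RT).
Proof. by apply: open_measurable; exact: closed_openC. Qed.

Lemma Rintegral_off (f : RT -> R) : rintegrable leb f ->
  \int[leb]_(t in ~` Gamma) f t = \int[leb]_t f t.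
Proof.
move=> fi; rewrite Rintegral_indic; apply: ae_eq_Rintegral => //.
  by apply: rintegrable_indic => //; exact: measurable_off.
by apply: filterS Gamma0 => t gt; rewrite indicE mem_set// mul1r.
Qed.

(** The boundary terms vanish outside the support of [phi], and the singular
    term vanishes because [phi] is zero on [Gamma]. *)
Lemma weak_parts (S : set R) (phi : R -> R) (psi p c : RT -> R) :
  compact S -> smooth_in S phi -> (forall t, Gamma t -> phi t = 0) ->
  square_integrable leb psi -> square_integrable leb p ->
  rintegrable mu c -> (forall y, ~ Gamma y -> c y = 0) ->
  (forall s x, ~ Gamma s -> ~ Gamma x -> s < x ->
    psi x - psi s = \int[leb]_(t in `]s, x[) p t +
                    \int[mu]_(y in `]s, x[) c y) ->
  \int[leb]_(t in ~` Gamma) (psi t * (phi^`() t)%classic) =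
  - \int[leb]_(t in ~` Gamma) (p t * phi t).
Proof.
move=> cS sphi phi0 psii pi ci c0 dpsi.
have s1 := smooth_in_derive cS sphi.
have i0 := smooth_in_square_integrable cS sphi.
have i1 := smooth_in_square_integrable cS s1.
have [N aN SN] : exists2 N, a < N & forall x, S x -> `|x| < N.
  move: (compact_bounded cS) => [M [_ /(_ (M + 1))]].
  rewrite ltrDl ltr01 => /(_ isT) h; exists (Num.max (a + 1) (M + 2)).
    by rewrite lt_max ltrDl ltr01.
  move=> x /h/= xM; rewrite lt_max; apply/orP; right.
  by apply: (le_lt_trans xM); rewrite ltrD2l ltr1n.
have gN x : `|x| = N -> ~ Gamma x by move=> xN /Gamma_a; rewrite xN leNgt aN.
have SN0 x : `|x| = N -> ~ S x by move=> xN /SN; rewrite xN ltxx.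
have [N0|N0] := leP N 0.
  have phi00 x : phi x = 0.
    apply: (proj2 sphi) => /SN; rewrite ltNge (le_trans N0)//.
  have phi10 x : (phi^`() x)%classic = 0.
    by apply: (proj2 s1) => /SN; rewrite ltNge (le_trans N0)//.
  under eq_Rintegral do rewrite phi10 mulr0.
  under [in RHS]eq_Rintegral do rewrite phi00 mulr0.
  by rewrite !Rintegral_cst ?mul0r ?oppr0//; exact: measurable_off.
have NN : - N < N by lra.
have nN : `|- N| = N by rewrite normrN gtr0_norm.
have pN : `|N| = N by rewrite gtr0_norm.
have e0 : rintegrable leb (fun t => (phi^`() t)%classic * psi t).
  exact (square_integrableM i1 psii).
have e1 : rintegrable leb (fun t => phi t * p t).
  exact (square_integrableM i0 pi).
have mI : measurable (`]- N, N[%classic : set RT) by exact: measurable_itv.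
have e0I : leb.-integrable `]- N, N[ (EFin \o (fun t => (phi^`() t)%classic * psi t)).
  by apply: integrableS e0.
have [_ _] := by_parts Gamma0 NN (L2_integrable_oo (- N) N i1)
  (L2_integrable_oo (- N) N pi) ci (fun u v => smooth_in_increment cS sphi)
  (fun x sx gx => dpsi _ _ (gN _ nN) gx sx) (gN _ pN) e0I.
rewrite !(proj2 sphi _ (SN0 _ nN)) !(proj2 sphi _ (SN0 _ pN)) !mul0r subrr.
have -> : \int[mu]_(t in `]- N, N[) (phi t * c t) = 0.
  transitivity (\int[mu]_(t in `]- N, N[) (0 : R)).
    apply: eq_Rintegral => t _.
    by have [/phi0->|/c0->] := pselect (Gamma t); rewrite ?mulr0 ?mul0r.
  by rewrite Rintegral_cst ?mul0r.
have restr (f g : R -> R) : (forall x, ~ S x -> f x = 0) ->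
    rintegrable leb (fun t => f t * g t) ->
    \int[leb]_(t in `]- N, N[) (f t * g t) = \int[leb]_(t in ~` Gamma) (g t * f t).
  move=> f0 fgi.
  have -> : (fun t => g t * f t) = (fun t => f t * g t).
    by apply/funext => t; rewrite mulrC.
  rewrite Rintegral_off// Rintegral_indic; apply: eq_Rintegral => t _.
  rewrite indicE; case: (boolP (t \in _)); first by rewrite mul1r.
  rewrite mul0r notin_setE/= in_itv/= => /negP tN.
  rewrite f0 ?mul0r// => /SN; rewrite ltr_norml => tS.
  by rewrite tS in tN.
rewrite (restr _ _ (proj2 s1) e0) (restr _ _ (proj2 sphi) e1) addr0 => /eqP.
by rewrite eq_sym addr_eq0 => /eqP.
Qed.

Lemma data_weak (S : set R) (phi : R -> R) psi P p2 : data psi P p2 ->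
  compact S -> smooth_in S phi -> (forall t, Gamma t -> phi t = 0) ->
  (\int[leb]_(t in ~` Gamma) (psi t * (phi^`() t)%classic) =
    - \int[leb]_(t in ~` Gamma) (P t * phi t)) /\
  (\int[leb]_(t in ~` Gamma) (P t * (phi^`() t)%classic) =
    - \int[leb]_(t in ~` Gamma) (p2 t * phi t)).
Proof.
move=> D cS sphi phi0; have [psii Pi p2i cP dpsi] := D.
split.
- apply: (weak_parts cS sphi phi0 psii Pi
    (continuous_singular_integrable bi b0 Gamma_a cP)).
    by move=> y /b0->; rewrite mul0r.
  by move=> s x gs gx sx; have [] := dpsi s x gs gx sx.
- have z0 : rintegrable mu (fun=> 0 : R).
    have := rintegrableZ 0 bi.
    by congr rintegrable; apply/funext => t; rewrite mul0r.
  apply: (weak_parts cS sphi phi0 Pi p2i z0) => //.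
  move=> s x gs gx sx; rewrite (dpsi s x gs gx sx).1 Rintegral_cst.
    by rewrite mul0r addr0.
  exact: measurable_itv.
Qed.

(** The function [p] is constrained on the complement of [Gamma] only; its
    continuous extension is obtained by integrating [p2] from a base point to
    the left of [Gamma]. *)
Lemma continuous_extension (p p2 : R -> R) :
  measurable_fun (~` Gamma : set RT) p ->
  leb.-integrable (~` Gamma) (EFin \o (fun t => p t ^+ 2)) ->
  square_integrable leb p2 ->
  (forall s x, ~ Gamma s -> ~ Gamma x -> s < x ->
    p x - p s = \int[leb]_(t in `]s, x[) p2 t) ->
  exists P : R -> R, [/\ square_integrable leb P, continuous P,
    (forall x, ~ Gamma x -> P x = p x) &
    forall s x, s < x -> P x - P s = \int[leb]_(t in `]s, x[) p2 t].
Proof.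
move=> mp pi p2i dp.
pose x0 := - (`|a| + 1).
have gx0 x : x <= x0 -> ~ Gamma x.
  move=> xx0 /Gamma_a; rewrite leNgt => /negP; apply.
  rewrite ltr0_norm; last by have := normr_ge0 a; move: xx0; rewrite /x0; lra.
  by have := ler_norm a; move: xx0; rewrite /x0; lra.
pose P x := if x <= x0 then p x else p x0 + \int[leb]_(t in `]x0, x[) p2 t.
have dP s x : s < x -> P x - P s = \int[leb]_(t in `]s, x[) p2 t.
  move=> sx; rewrite /P.
  have [xx0|x0x] := leP x x0.
    have sx0 : s <= x0 by lra.
    by rewrite sx0 (dp s x) //; exact: gx0.
  have [sx0|x0s] := leP s x0.
    rewrite (Rintegral_oo_split sx0 (ltW x0x) (L2_integrable_oo s x p2i)).
    move: sx0; rewrite le_eqVlt => /predU1P[->|sx0].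
      by rewrite set_itvoo0 ?Rintegral_set0; ring.
    by rewrite -(dp s x0) //; [ring|apply: gx0; exact: ltW|exact: gx0].
  rewrite (Rintegral_oo_split (ltW x0s) (ltW sx) (L2_integrable_oo x0 x p2i)).
  ring.
have Pp x : ~ Gamma x -> P x = p x.
  move=> gx; rewrite /P; case: leP => // x0x.
  by rewrite -(dp x0 x) //; [ring|exact: gx0].
have cP : continuous P.
  move=> x; apply: (@increment_continuous _ _ p2 x 1) => //.
  by move=> s t _ _ st; exact: dP.
exists P; split=> //; split; first exact: continuous_measurable_fun.
have mP2 : measurable_fun [set: RT] (fun t : RT => P t ^+ 2).
  apply: measurable_funX.
  exact: continuous_measurable_fun.
have i1 : rintegrable leb (fun t => \1_(~` Gamma) t * (P t) ^+ 2).
  apply: integrable_indicM; first exact: measurable_off.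
  apply: eq_integrable pi; first exact: measurable_off.
  by move=> t; rewrite inE/= => gt; rewrite Pp.
apply: (ae_rintegrable mP2 i1).
by apply: filterS Gamma0 => t gt; rewrite indicE mem_set// mul1r.
Qed.

End parts.

(** * Reduction of the operator to real functions *)

Section integral_null.
Context d (T : measurableType d) (R : realType).
Variable m : {measure set T -> \bar R}.
Import HBNNSimple.

(** Stated for arbitrary functions because a second derivative on the
    complement of [Gamma] comes with arbitrary values on [Gamma].  The simple
    functions below [f] can be cut off on [N] without changing their
    integrals. *)
Lemma integral_off_null (D N : set T) (f : T -> \bar R) : measurable N ->
  m N = 0%E -> (\int[m]_(x in D) f x = \int[m]_(x in D) (f \_ (~` N)) x)%E.
Proof.
move=> mN N0.
have key (F G : T -> \bar R) : (forall x, (0 <= G x)%E) -> (forall x, (G x <= F x)%E) ->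
    (forall x, ~ N x -> G x = F x) ->
    ereal_sup [set sintegral m h | h in [set h : {nnsfun T >-> R} | forall x, ((h x)%:E <= F x)%E]] =
    ereal_sup [set sintegral m h | h in [set h : {nnsfun T >-> R} | forall x, ((h x)%:E <= G x)%E]].
  move=> G0 GF GE; apply/eqP; rewrite eq_le; apply/andP; split; last first.
    apply: le_ereal_sup => _ [h hG <-]; exists h => // x.
    exact: le_trans (hG x) (GF x).
  apply: ge_ereal_sup => _ [h hF <-].
  apply: ereal_sup_ubound; exists (proj_nnsfun h (measurableC mN)).
    move=> x; rewrite /= mindicE; case: (boolP (x \in _)) => [|_].
      by rewrite inE/= mulr1 => /GE->.
    by rewrite mulr0.
  have -> : sintegral m h = (\int[m]_x (h x)%:E)%E by rewrite integral_nnsfun// patch_setT.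
  have mC := measurableC mN.
  transitivity (\int[m]_x (proj_nnsfun h mC x)%:E)%E.
    by rewrite integral_nnsfun// patch_setT.
  apply: ae_eq_integral => //; try by apply/measurable_EFinP.
  exists N; split=> // x /= hx; apply: contrapT => xN; apply: hx => _.
  by rewrite mindicE mem_set// mulr1.
rewrite /integral /=; congr (_ - _)%E; apply: key.
- by move=> x; rewrite funeposE le_max lexx orbT.
- move=> x; rewrite !funeposE !patchE; case: (x \in D); last by [].
  by case: (x \in ~` N); rewrite ?maxxx// le_max lexx orbT.
- by move=> x xN; rewrite !funeposE !patchE (mem_set (xN : (~` N) x)).
- by move=> x; rewrite funenegE le_max lexx orbT.
- move=> x; rewrite !funenegE !patchE; case: (x \in D); last by [].
  by case: (x \in ~` N); rewrite ?oppe0 ?maxxx// le_max lexx orbT.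
- by move=> x xN; rewrite !funenegE !patchE (mem_set (xN : (~` N) x)).
Qed.

End integral_null.

Section complex_parts.
Variable R : realType.
Local Notation RT := (measurableTypeR R).

Lemma cReM (x y : R[i]) : complex.Re (x * y) =
  complex.Re x * complex.Re y - complex.Im x * complex.Im y.
Proof. by case: x => ? ?; case: y. Qed.

Lemma cImM (x y : R[i]) : complex.Im (x * y) =
  complex.Re x * complex.Im y + complex.Im x * complex.Re y.
Proof. by case: x => ? ?; case: y. Qed.

Lemma cReD (x y : R[i]) : complex.Re (x + y) = complex.Re x + complex.Re y.
Proof. by case: x => ? ?; case: y. Qed.

Lemma cImD (x y : R[i]) : complex.Im (x + y) = complex.Im x + complex.Im y.
Proof. by case: x => ? ?; case: y. Qed.

Lemma cReN (x : R[i]) : complex.Re (- x) = - complex.Re x.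
Proof. by case: x. Qed.

Lemma cImN (x : R[i]) : complex.Im (- x) = - complex.Im x.
Proof. by case: x. Qed.

Lemma cReZ (r : R) (x : R[i]) : complex.Re (r%:C * x) = r * complex.Re x.
Proof. by rewrite cReM mul0r subr0. Qed.

Lemma cImZ (r : R) (x : R[i]) : complex.Im (r%:C * x) = r * complex.Im x.
Proof. by rewrite cImM mul0r addr0. Qed.

Lemma complexP (x y : R[i]) : complex.Re x = complex.Re y ->
  complex.Im x = complex.Im y -> x = y.
Proof. by case: x => ? ?; case: y => ? ? /= -> ->. Qed.

Lemma half_complex : (2^-1 : R[i]) = (2^-1)%:C.
Proof.
by rewrite fmorphV rmorph_nat.
Qed.

Definition L2_part (D : set R) (f : R -> R) : Prop :=
  measurable_fun (D : set RT) f /\ leb.-integrable (D : set RT) (EFin \o (fun t => f t ^+ 2)).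

Lemma L2_parts (D : set R) (u : R -> R[i]) : measurable (D : set RT) ->
  L2 D u <-> L2_part D (re u) /\ L2_part D (im u).
Proof.
move=> mD; have sum0 (x : R) : (0 <= ((re u x) ^+ 2 + (im u x) ^+ 2)%:E)%E.
  by rewrite lee_fin addr_ge0// sqr_ge0.
split=> [[mr mi fin]|[[mr ir] [mi ii]]].
  have sI : leb.-integrable (D : set RT) (EFin \o (fun t => re u t ^+ 2 + im u t ^+ 2)).
    apply/integrableP; split.
      by apply/measurable_EFinP; apply: measurable_funD; exact: measurable_funX.
    move: fin; rewrite /sqnorm; apply: le_lt_trans; rewrite le_eqVlt; apply/orP; left; apply/eqP.
    by apply: eq_integral => x _; rewrite /= ger0_norm// addr_ge0// sqr_ge0.
  split; split=> //; apply: le_integrable sI => //.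
  - by apply/measurable_EFinP; exact: measurable_funX.
  - move=> x _; rewrite lee_fin !ger0_norm ?sqr_ge0 ?addr_ge0 ?sqr_ge0//.
    by rewrite lerDl sqr_ge0.
  - by apply/measurable_EFinP; exact: measurable_funX.
  - move=> x _; rewrite lee_fin !ger0_norm ?sqr_ge0 ?addr_ge0 ?sqr_ge0//.
    by rewrite lerDr sqr_ge0.
split=> //; have /integrableP[_] := integrableD mD ir ii.
rewrite /sqnorm; apply: le_lt_trans; rewrite le_eqVlt; apply/orP; left; apply/eqP.
by apply: eq_integral => x _; rewrite /= ger0_norm// addr_ge0// sqr_ge0.
Qed.

Lemma test_function_parts (Omega : set R) (phi : R -> R[i]) :
  test_function Omega phi -> exists S, [/\ compact S, S `<=` Omega,
    smooth_in S (re phi) & smooth_in S (im phi)].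
Proof.
move=> [dr di cS SO]; exists (closure [set x | phi x != 0]); split=> //.
- split=> // x xS; rewrite /re; suff -> : phi x = 0 by [].
  by apply/eqP/contraT => px; exfalso; apply: xS; exact: subset_closure.
- split=> // x xS; rewrite /im; suff -> : phi x = 0 by [].
  by apply/eqP/contraT => px; exfalso; apply: xS; exact: subset_closure.
Qed.

End complex_parts.

Lemma mean_value_parts (R : realType) (Gamma : set R) (psi : R -> R[i]) x :
  complex.Re (mean_value Gamma psi x) =
    (lim (re psi @ within (~` Gamma) x^'+) +
     lim (re psi @ within (~` Gamma) x^'-)) / 2 /\
  complex.Im (mean_value Gamma psi x) =
    (lim (im psi @ within (~` Gamma) x^'+) +
     lim (im psi @ within (~` Gamma) x^'-)) / 2.
Proof.
by rewrite /mean_value half_complex mulrC cReZ cImZ cReD cImD; split; rewrite mulrC.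
Qed.

Section bridge.
Variables (R : realType) (Gamma : set R).
Local Notation RT := (measurableTypeR R).
Variables (mu : {finite_measure set RT -> \bar R}) (beta : RT -> R) (a : R).
Hypothesis betai : mu.-integrable Gamma (EFin \o beta).
Hypothesis Gamma_a : forall y, Gamma y -> `|y| <= a.
Hypothesis Gamma0 : {ae leb, forall x : RT, ~ Gamma x}.
Hypothesis Gamma_closed : closed Gamma.

Let b := beta \_ Gamma.

Let mG : measurable (Gamma : set RT).
Proof. exact: closed_measurable. Qed.

Lemma patch_rintegrable : rintegrable mu b.
Proof. by have := integrable_indicM mG betai; rewrite indicM_patch. Qed.

Lemma patch_off y : ~ Gamma y -> b y = 0.
Proof. by move=> gy; rewrite /b patchE memNset. Qed.

Local Notation data := (delta'_data Gamma mu b).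

(** The restriction of the operator to real functions; a vector of the domain
    is identified almost everywhere with the first component of a solution of
    the system. *)
Definition real_op (u v : RT -> R) : Prop :=
  [/\ square_integrable leb u, square_integrable leb v &
    exists psi P p2, [/\ data psi P p2,
      {ae leb, forall t, u t = psi t} & {ae leb, forall t, v t = - p2 t}]].

Lemma within_off_proper (F : R -> set_system R) x :
  Filter (F x) -> (forall A, F x A -> exists u v, u < v /\ `]u, v[ `<=` A) ->
  ProperFilter (within (~` Gamma) (F x)).
Proof.
move=> FF h; apply: Build_ProperFilter_ex => A /h[u [v [uv uvA]]].
have [y uyv gy] := null_dense Gamma0 uv.
by exists y; apply: (uvA y _ gy); rewrite /= in_itv.
Qed.

Lemma lim_off (P p : R -> R) (F : R -> set_system R) x :
  Filter (F x) -> (forall A, F x A -> exists u v, u < v /\ `]u, v[ `<=` A) ->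
  (F x --> x) ->
  continuous P -> (forall y, ~ Gamma y -> P y = p y) ->
  lim (p @ within (~` Gamma) (F x)) = P x.
Proof.
move=> FF h Fx cP Pp; have pF := within_off_proper FF h.
apply: cvg_lim => //.
have h1 : P @ within (~` Gamma) (F x) --> P x.
  by apply: cvg_trans (cP x); apply: cvg_app; apply: cvg_trans Fx; exact: cvg_within.
apply: cvg_trans h1; apply: near_eq_cvg.
by rewrite near_withinE; apply: (@filterE _ (F x)) => y gy; rewrite Pp.
Qed.

(** Both one-sided limits along the complement of [Gamma] exist, since that
    complement is dense and [p] has a continuous extension. *)
Lemma mean_off (P p : R -> R) x :
  continuous P -> (forall y, ~ Gamma y -> P y = p y) ->
  (lim (p @ within (~` Gamma) x^'+) + lim (p @ within (~` Gamma) x^'-)) / 2 = P x.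
Proof.
move=> cP Pp.
rewrite (@lim_off P p (fun x => x^'+))//; last first.
- exact: cvg_within.
- move=> A /nbhs_ballP[e /= e0 he]; exists x, (x + e); split.
    by rewrite ltrDl.
  move=> y /=; rewrite in_itv/= => /andP[xy ye]; apply: he => //.
  by rewrite /ball/= ltr0_norm ?subr_lt0// opprB; lra.
rewrite (@lim_off P p (fun x => x^'-))//; last first.
- exact: cvg_within.
- move=> A /nbhs_ballP[e /= e0 he]; exists (x - e), x; split.
    by rewrite ltrBlDr ltrDl.
  move=> y /=; rewrite in_itv/= => /andP[xy ye]; apply: he => //.
  by rewrite /ball/= gtr0_norm ?subr_gt0//; lra.
by lra.
Qed.

Lemma Rintegral_singular (f h : RT -> R) (s x : R) :
  mu.-integrable Gamma (EFin \o f) -> rintegrable mu h ->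
  (forall y, ~ Gamma y -> h y = 0) -> {ae mu, forall y : RT, Gamma y -> f y = h y} ->
  \int[mu]_(t in `]s, x[ `&` Gamma) f t = \int[mu]_(t in `]s, x[) h t.
Proof.
move=> fi hi h0 fh.
have mI : measurable (`]s, x[%classic : set RT) by exact: measurable_itv.
rewrite Rintegral_indic [RHS]Rintegral_indic; apply: ae_eq_Rintegral.
- apply: integrable_indicM; first exact: measurableI.
  by apply: integrableS fi => //; exact: measurableI.
- exact: rintegrable_indic.
apply: filterS fh => y fhy; rewrite !indicE in_setI.
have [gy|gy] := pselect (Gamma y); first by rewrite fhy// (mem_set gy) andbT.
by rewrite h0// (memNset gy) andbF !(mul0r, mulr0).
Qed.

(** The singular part of the second differential being zero, the derivative
    extends continuously, and the boundary condition identifies the singular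
    density of [psi] with [b P]. *)
Lemma real_op_of_parts (u v psi psi1 psi2 f g : R -> R) :
  square_integrable leb u -> square_integrable leb v ->
  L2_part (~` Gamma) psi -> L2_part (~` Gamma) psi1 -> L2_part (~` Gamma) psi2 ->
  mu.-integrable Gamma (EFin \o f) -> mu.-integrable Gamma (EFin \o g) ->
  (forall s x, ~ Gamma s -> ~ Gamma x -> s < x ->
    psi x = psi s + \int[leb]_(t in `]s, x[) psi1 t +
            \int[mu]_(t in `]s, x[ `&` Gamma) f t) ->
  (forall s x, ~ Gamma s -> ~ Gamma x -> s < x ->
    psi1 x = psi1 s + \int[leb]_(t in `]s, x[) psi2 t +
            \int[mu]_(t in `]s, x[ `&` Gamma) g t) ->
  {ae mu, forall x : RT, Gamma x -> g x = 0} ->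
  {ae mu, forall x : RT, Gamma x -> f x = beta x *
     ((lim (psi1 @ within (~` Gamma) x^'+) +
       lim (psi1 @ within (~` Gamma) x^'-)) / 2)} ->
  {ae leb, forall x : RT, ~ Gamma x -> u x = psi x} ->
  {ae leb, forall x : RT, ~ Gamma x -> v x = - psi2 x} -> real_op u v.
Proof.
move=> ui vi psii psi1i psi2i fi gi dpsi dpsi1 g0 fE upsi vpsi2.
have mO := measurable_off Gamma_closed.
have ext (h : R -> R) : L2_part (~` Gamma) h -> square_integrable leb (h \_ (~` Gamma)).
  move=> [mh hi]; split.
    exact (proj1 (@measurable_restrictT _ _ RT R (~` Gamma) h mO) mh).
  have := integrable_indicM mO hi; rewrite indicM_patch.
  by congr rintegrable; apply/funext => t; rewrite !patchE; case: ifP => // _; rewrite expr0n.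
pose p2 := psi2 \_ (~` Gamma).
have p2i : square_integrable leb p2 := ext _ psi2i.
have psii' := ext _ psii; have psi1i' := ext _ psi1i.
have G0 : leb (Gamma : set RT) = 0%E.
  apply/negligibleP => //; apply: negligibleS Gamma0 => y /= Gy; exact.
have offE (h : R -> R) s x : \int[leb]_(t in `]s, x[) h t =
    \int[leb]_(t in `]s, x[) (h \_ (~` Gamma)) t.
  rewrite /Rintegral; congr fine.
  by rewrite (integral_off_null _ _ mG G0) restrict_EFin.
have dp2 s x : ~ Gamma s -> ~ Gamma x -> s < x ->
    psi1 x - psi1 s = \int[leb]_(t in `]s, x[) p2 t.
  move=> gs gx sx; rewrite (dpsi1 s x gs gx sx) offE.
  suff -> : \int[mu]_(t in `]s, x[ `&` Gamma) g t = 0.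
    by rewrite addr0 addrAC subrr add0r.
  have z0 : rintegrable mu (fun=> 0 : R).
    have := rintegrableZ 0 patch_rintegrable.
    by congr rintegrable; apply/funext => t; rewrite mul0r.
  rewrite (Rintegral_singular (h := fun=> 0) s x gi z0)//.
  by rewrite Rintegral_cst ?mul0r//; exact: measurable_itv.
have [P [Pi cP Pp dP]] := continuous_extension Gamma_a Gamma0 Gamma_closed (proj1 psi1i) (proj2 psi1i) p2i dp2.
split=> //; exists (psi \_ (~` Gamma)), P, p2; split.
- split=> // s x gs gx sx; split; first exact: dP.
  rewrite !patchE !mem_set//.
  rewrite (dpsi s x gs gx sx) offE.
  have -> : \int[leb]_(t in `]s, x[) (psi1 \_ (~` Gamma)) t = \int[leb]_(t in `]s, x[) P t.
    rewrite Rintegral_indic [RHS]Rintegral_indic; apply: ae_eq_Rintegral.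
    - by apply: integrable_indicM; [exact: measurable_itv|exact: L2_integrable_oo].
    - by apply: integrable_indicM; [exact: measurable_itv|exact: L2_integrable_oo].
    by apply: filterS Gamma0 => t gt; rewrite patchE mem_set// Pp.
  rewrite (Rintegral_singular (h := fun y => b y * P y) s x fi)//.
  - by rewrite addrAC [X in X - _ + _]addrC addrK.
  - exact (continuous_singular_integrable patch_rintegrable patch_off Gamma_a cP).
  - by move=> y /patch_off ->; rewrite mul0r.
  apply: filterS fE => y fy gy; rewrite fy// (mean_off y cP Pp).
  by rewrite /b patchE mem_set.
- by apply: filterS2 Gamma0 upsi => t gt ->//; rewrite patchE mem_set.
- by apply: filterS2 Gamma0 vpsi2 => t gt ->//; rewrite /p2 patchE mem_set.
Qed.

Lemma L_op_real u v : L_op Gamma mu beta u v ->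
  real_op (re u) (re v) /\ real_op (im u) (im v).
Proof.
have mO := measurable_off Gamma_closed.
move=> [/(L2_parts _ measurableT)[ur ui] /(L2_parts _ measurableT)[vr vi]].
move=> [psi [psi1 [psi2 [f [g [[W df dg] g0 fE upsi vpsi]]]]]].
have {}g0 : {ae mu, forall x : RT, Gamma x -> g x = 0} := g0.
have {}fE : {ae mu, forall x : RT, Gamma x ->
    f x = (beta x)%:C * mean_value Gamma psi1 x} := fE.
have {}upsi : {ae leb, forall x : RT, ~ Gamma x -> u x = psi x} := upsi.
have {}vpsi : {ae leb, forall x : RT, ~ Gamma x -> v x = - psi2 x} := vpsi.
have [[+ + +] _ _ _] := W.
move=> /(L2_parts _ mO)[pr pi] /(L2_parts _ mO)[p1r p1i] /(L2_parts _ mO)[p2r p2i].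
have [[fr fi] df'] := df; have [[gr gi] dg'] := dg.
split.
- apply: (@real_op_of_parts _ _ (re psi) (re psi1) (re psi2) (re f) (re g)) => //.
  + by move=> s x gs gx sx; rewrite /re (df' s x gs gx sx) !cReD.
  + by move=> s x gs gx sx; rewrite /re (dg' s x gs gx sx) !cReD.
  + by apply: filterS g0 => x gx /gx; rewrite /re => ->.
  + apply: filterS fE => x fx /fx; rewrite /re => ->.
    by rewrite cReZ (mean_value_parts _ _ _).1.
  + by apply: filterS upsi => x ux /ux; rewrite /re => ->.
  + by apply: filterS vpsi => x ux /ux; rewrite /re => ->; rewrite cReN.
- apply: (@real_op_of_parts _ _ (im psi) (im psi1) (im psi2) (im f) (im g)) => //.
  + by move=> s x gs gx sx; rewrite /im (df' s x gs gx sx) !cImD.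
  + by move=> s x gs gx sx; rewrite /im (dg' s x gs gx sx) !cImD.
  + by apply: filterS g0 => x gx /gx; rewrite /im => ->.
  + apply: filterS fE => x fx /fx; rewrite /im => ->.
    by rewrite cImZ (mean_value_parts _ _ _).2.
  + by apply: filterS upsi => x ux /ux; rewrite /im => ->.
  + by apply: filterS vpsi => x ux /ux; rewrite /im => ->; rewrite cImN.
Qed.

Lemma square_integrable_part (D : set R) f : measurable (D : set RT) ->
  square_integrable leb f -> L2_part D f.
Proof.
move=> mD [mf fi]; split; first exact: measurable_funS mf.
by apply: integrableS fi.
Qed.

(** A complex test function mixes real and imaginary parts, so the two weak
    derivatives have to be combined. *)
Lemma weak_complex (psi1 psi2 p1 p2 : R -> R) :
  square_integrable leb psi1 -> square_integrable leb psi2 ->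
  square_integrable leb p1 -> square_integrable leb p2 ->
  (forall (S : set R) (phi : R -> R), compact S -> smooth_in S phi ->
    (forall t, Gamma t -> phi t = 0) ->
    \int[leb]_(t in ~` Gamma) (psi1 t * (phi^`() t)%classic) =
      - \int[leb]_(t in ~` Gamma) (p1 t * phi t)) ->
  (forall (S : set R) (phi : R -> R), compact S -> smooth_in S phi ->
    (forall t, Gamma t -> phi t = 0) ->
    \int[leb]_(t in ~` Gamma) (psi2 t * (phi^`() t)%classic) =
      - \int[leb]_(t in ~` Gamma) (p2 t * phi t)) ->
  weak_derivative (~` Gamma) (fun t => psi1 t +i* psi2 t) (fun t => p1 t +i* p2 t).
Proof.
move=> i1 i2 j1 j2 w1 w2 phi /test_function_parts[S [cS SO sr si]].
have mO := measurable_off Gamma_closed.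
have z (h : R -> R) t : smooth_in S h -> Gamma t -> h t = 0.
  by move=> sh gt; apply: (proj2 sh) => /SO.
have dr := smooth_in_derive cS sr; have di := smooth_in_derive cS si.
have ir := smooth_in_square_integrable cS sr.
have ii := smooth_in_square_integrable cS si.
have idr := smooth_in_square_integrable cS dr.
have idi := smooth_in_square_integrable cS di.
have I (f g : R -> R) : square_integrable leb f -> square_integrable leb g ->
    leb.-integrable (~` Gamma : set RT) (EFin \o (fun t => f t * g t)).
  by move=> fi gi; apply: integrableS (square_integrableM fi gi).
have w1r := w1 S _ cS sr (fun t => z _ t sr); have w1i := w1 S _ cS si (fun t => z _ t si).
have w2r := w2 S _ cS sr (fun t => z _ t sr); have w2i := w2 S _ cS si (fun t => z _ t si).
apply: complexP; rewrite /cintegral /=.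
- transitivity (\int[leb]_(t in ~` Gamma) (psi1 t * ((re phi)^`() t)%classic -
      psi2 t * ((im phi)^`() t)%classic)).
    by apply: eq_Rintegral => t _; rewrite /re /cderiv cReM.
  rewrite RintegralB//; [|exact: I|exact: I].
  rewrite w1r w2i -opprD; congr (- _).
  transitivity (\int[leb]_(t in ~` Gamma) (p1 t * re phi t - p2 t * im phi t)); last first.
    by apply: eq_Rintegral => t _; rewrite /re /im cReM.
  by rewrite RintegralB//; [exact: I|exact: I].
- transitivity (\int[leb]_(t in ~` Gamma) (psi1 t * ((im phi)^`() t)%classic +
      psi2 t * ((re phi)^`() t)%classic)).
    by apply: eq_Rintegral => t _; rewrite /im /cderiv cImM.
  rewrite RintegralD//; [|exact: I|exact: I].
  rewrite w1i w2r -opprD; congr (- _).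
  transitivity (\int[leb]_(t in ~` Gamma) (p1 t * im phi t + p2 t * re phi t)); last first.
    by apply: eq_Rintegral => t _; rewrite /re /im cImM.
  by rewrite RintegralD//; [exact: I|exact: I].
Qed.

Lemma continuous_within_off (f : R -> R) :
  (forall x, ~ Gamma x -> {for x, continuous f}) -> {within ~` Gamma, continuous f}.
Proof.
move=> cf; rewrite continuous_open_subspace; last exact: closed_openC.
by move=> x; rewrite inE => /cf.
Qed.

Lemma real_op_L u v : real_op (re u) (re v) -> real_op (im u) (im v) ->
  L_op Gamma mu beta u v.
Proof.
have mO := measurable_off Gamma_closed.
move=> [ur vr [psi [P [p2 [D upsi vp2]]]]] [ui vi [phi [Q [q2 [E uphi vq2]]]]].
split; [by apply/L2_parts|by apply/L2_parts|].
have [psii Pi p2i cP dpsi] := D; have [phii Qi q2i cQ dphi] := E.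
have bP := continuous_singular_integrable patch_rintegrable patch_off Gamma_a cP.
have bQ := continuous_singular_integrable patch_rintegrable patch_off Gamma_a cQ.
have dw := data_weak patch_rintegrable patch_off Gamma_a Gamma0 Gamma_closed.
have S h : square_integrable leb h -> L2_part (~` Gamma) h.
  exact: square_integrable_part.
have bint h : rintegrable mu h -> mu.-integrable Gamma (EFin \o h).
  by move=> hi; apply: integrableS hi.
have z0 : rintegrable mu (fun=> 0 : R).
  have := rintegrableZ 0 patch_rintegrable.
  by congr rintegrable; apply/funext => t; rewrite mul0r.
have sing h s x : rintegrable mu h -> (forall y, ~ Gamma y -> h y = 0) ->
    \int[mu]_(t in `]s, x[ `&` Gamma) h t = \int[mu]_(t in `]s, x[) h t.
  by move=> hi h0; apply: Rintegral_singular => //; [exact: bint|exact: aeW].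
exists (fun t => psi t +i* phi t), (fun t => P t +i* Q t), (fun t => p2 t +i* q2 t).
exists (fun t => (b t * P t) +i* (b t * Q t)), (fun=> 0); split.
- split; first split.
  + by split; apply/L2_parts => //; split; exact: S.
  + split.
      apply: weak_complex => // S' h cS sh h0.
        by have [] := dw _ _ _ _ _ D cS sh h0.
      by have [] := dw _ _ _ _ _ E cS sh h0.
    apply: weak_complex => // S' h cS sh h0.
      by have [] := dw _ _ _ _ _ D cS sh h0.
    by have [] := dw _ _ _ _ _ E cS sh h0.
  + split; apply: continuous_within_off => x gx.
      exact: (data_psi_continuous patch_off Gamma_closed D gx).
    exact: (data_psi_continuous patch_off Gamma_closed E gx).
  + split; apply: continuous_within_off => x gx; [exact: cP|exact: cQ].
- split; first by split; exact: bint.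
  move=> s x gs gx sx; apply: complexP; rewrite /cintegral/=.
  + rewrite (sing _ _ _ bP) => [|y /patch_off->]; last by rewrite mul0r.
    have [_ e] := dpsi s x gs gx sx; rewrite -addrA -e; ring.
  + rewrite (sing _ _ _ bQ) => [|y /patch_off->]; last by rewrite mul0r.
    have [_ e] := dphi s x gs gx sx; rewrite -addrA -e; ring.
- split; first by split; exact: bint.
  move=> s x gs gx sx; apply: complexP; rewrite /cintegral/=.
  + rewrite (sing _ _ _ z0)// Rintegral_cst ?mul0r; last exact: measurable_itv.
    have [e _] := dpsi s x gs gx sx; rewrite -addrA -e; ring.
  + rewrite (sing _ _ _ z0)// Rintegral_cst ?mul0r; last exact: measurable_itv.
    have [e _] := dphi s x gs gx sx; rewrite -addrA -e; ring.
- exact: aeW.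
- apply: aeW => x gx; apply: complexP; rewrite ?cReZ ?cImZ.
  + by rewrite (mean_value_parts _ _ _).1 (mean_off x cP) //= /b patchE mem_set.
  + by rewrite (mean_value_parts _ _ _).2 (mean_off x cQ) //= /b patchE mem_set.
- apply: filterS2 upsi uphi => t e1 e2 _.
  by apply: complexP; [exact: e1|exact: e2].
- apply: filterS2 vp2 vq2 => t e1 e2 _.
  by apply: complexP; [exact: e1|exact: e2].
Qed.

Lemma L_opE u v : L_op Gamma mu beta u v <->
  real_op (re u) (re v) /\ real_op (im u) (im v).
Proof. by split=> [/L_op_real//|[]]; exact: real_op_L. Qed.

End bridge.

(** * The Hilbert space of square integrable functions *)

Section L2space.
Variable R : realType.
Local Notation RT := (measurableTypeR R).

Lemma square_integral0 (f : RT -> R) : square_integrable leb f ->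
  \int[leb]_t (f t ^+ 2) = 0 <-> {ae leb, forall t : RT, f t = 0}.
Proof.
move=> [mf fi]; split=> [f0|f0].
  have e0 : (\int[leb]_t `|(f t ^+ 2)%:E| = 0)%E.
    transitivity (\int[leb]_t (f t ^+ 2)%:E)%E.
      by apply: eq_integral => t _; rewrite /= ger0_norm// sqr_ge0.
    by rewrite rintegrable_fin// f0.
  have m2 : measurable_fun [set: RT] (EFin \o (fun t => f t ^+ 2)).
    exact: measurable_int fi.
  have := proj1 (ae_eq_integral_abs leb measurableT m2) e0.
  by apply: filterS => t /(_ Logic.I) /= [] /eqP; rewrite sqrf_eq0 => /eqP.
have z0 : rintegrable leb (fun=> 0 : R).
  have := rintegrableZ 0 fi.
  by congr rintegrable; apply/funext => t; rewrite mul0r.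
transitivity (\int[leb]_t (0 : R)); last by rewrite Rintegral_cst// mul0r.
apply: (ae_eq_Rintegral fi z0).
by apply: filterS f0 => t ->; rewrite expr0n.
Qed.

Definition L2_pred : {pred R -> R[i]} := fun u => `[< L2 setT u >].

Lemma L2P (u : R -> R[i]) : L2 setT u <->
  square_integrable leb (re u) /\ square_integrable leb (im u).
Proof. exact (L2_parts u measurableT). Qed.

Lemma L2_comb (a : R[i]) (u v : R -> R[i]) : L2 setT u -> L2 setT v ->
  L2 setT (fun x => a * u x + v x).
Proof.
move=> /L2P[ur ui] /L2P[vr vi]; apply/L2P; split.
- have := square_integrableD (square_integrableB (square_integrableZ (complex.Re a) ur)
    (square_integrableZ (complex.Im a) ui)) vr.
  by congr square_integrable; apply/funext => x; rewrite /re cReD cReM.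
- have := square_integrableD (square_integrableD (square_integrableZ (complex.Re a) ui)
    (square_integrableZ (complex.Im a) ur)) vi.
  by congr square_integrable; apply/funext => x; rewrite /im cImD cImM.
Qed.

Lemma square_integrable0 : square_integrable leb (fun=> 0 : R).
Proof.
split=> //; have := @integrable0 _ RT R leb setT.
by congr (_.-integrable); apply/funext => x; rewrite /= expr0n.
Qed.

Lemma L2_submod : submod_closed L2_pred.
Proof.
split; first by apply/asboolP/L2P; split; exact: square_integrable0.
by move=> a u v /asboolP Lu /asboolP Lv; apply/asboolP; exact: L2_comb.
Qed.
HB.instance Definition _ := GRing.isSubmodClosed.Build R[i] (R -> R[i]) L2_pred L2_submod.

(** Almost everywhere equal functions are not identified: the scalar product
    is degenerate on this space, as allowed for the abstract results. *)
Record L2vec := MkL2vec { L2fun :> R -> R[i]; L2funP : L2fun \in L2_pred }.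
HB.instance Definition _ := [isSub of L2vec for L2fun].
HB.instance Definition _ := [Choice of L2vec by <:].
HB.instance Definition _ := [SubChoice_isSubLmodule of L2vec by <:].

Definition to_L2 (u : R -> R[i]) (Lu : L2 setT u) : L2vec := MkL2vec (asboolT Lu).

Lemma L2vecP (u : L2vec) : L2 setT u.
Proof. by have /asboolP := L2funP u. Qed.

Lemma L2re (u : L2vec) : square_integrable leb (re u).
Proof. by have /L2P[] := L2vecP u. Qed.

Lemma L2im (u : L2vec) : square_integrable leb (im u).
Proof. by have /L2P[] := L2vecP u. Qed.

Lemma L2funB (u v : L2vec) x : L2fun (u - v) x = u x - v x.
Proof. by []. Qed.

Definition dot (u v : L2vec) : R :=
  \int[leb]_t (re u t * re v t) + \int[leb]_t (im u t * im v t).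

Lemma dotC u v : dot u v = dot v u.
Proof. by rewrite /dot; congr (_ + _); apply: eq_Rintegral => t _; rewrite mulrC. Qed.

Let I (f g : RT -> R) : square_integrable leb f -> square_integrable leb g ->
  leb.-integrable setT (EFin \o (fun t => f t * g t)).
Proof. exact: square_integrableM. Qed.

Lemma dotDl u v w : dot (u + v) w = dot u w + dot v w.
Proof.
have [ur ui] := (L2re u, L2im u); have [vr vi] := (L2re v, L2im v).
have [wr wi] := (L2re w, L2im w).
rewrite /dot addrACA.
transitivity (\int[leb]_t (re u t * re w t + re v t * re w t) +
  \int[leb]_t (im u t * im w t + im v t * im w t)).
  by congr (_ + _); apply: eq_Rintegral => t _; rewrite /re /im ?cReD ?cImD mulrDl.
by congr (_ + _); rewrite RintegralD//; exact: I.
Qed.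

Lemma dot_complex (a b : R) u v (Hu := L2re u) :
  dot ((a +i* b) *: u) v = a * dot u v +
  b * (\int[leb]_t (re u t * im v t) - \int[leb]_t (im u t * re v t)).
Proof.
have [ur ui] := (L2re u, L2im u); have [vr vi] := (L2re v, L2im v).
rewrite /dot.
transitivity (\int[leb]_t (a * (re u t * re v t) - b * (im u t * re v t)) +
  \int[leb]_t (a * (im u t * im v t) + b * (re u t * im v t))).
  congr (_ + _); apply: eq_Rintegral => t _.
    by rewrite /re cReM/=; ring.
  by rewrite /im cImM/=; ring.
rewrite RintegralB//; try (apply: rintegrableZ; exact: I).
rewrite RintegralD//; try (apply: rintegrableZ; exact: I).
rewrite !RintegralZl//; try exact: I.
by ring.
Qed.

Lemma dotJ (a : R[i]) u v : dot (a *: u) v = dot u (Num.conj a *: v).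
Proof.
case: a => a b; have -> : Num.conj (a +i* b) = a +i* - b by [].
rewrite dot_complex [dot u (_ *: v)]dotC dot_complex (dotC v u).
have -> : \int[leb]_t (re v t * im u t) = \int[leb]_t (im u t * re v t).
  by apply: eq_Rintegral => t _; rewrite mulrC.
have -> : \int[leb]_t (im v t * re u t) = \int[leb]_t (re u t * im v t).
  by apply: eq_Rintegral => t _; rewrite mulrC.
by ring.
Qed.

Lemma dotR (r : R) u v : dot (r%:C *: u) v = r * dot u v.
Proof. by rewrite dot_complex mul0r addr0. Qed.

Lemma dotE u : dot u u = \int[leb]_t (re u t ^+ 2) + \int[leb]_t (im u t ^+ 2).
Proof. by congr (_ + _); apply: eq_Rintegral => t _; rewrite expr2. Qed.

Lemma dot_ge0 u : 0 <= dot u u.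
Proof. by rewrite dotE addr_ge0//; apply: Rintegral_sqr_ge0. Qed.

Lemma dot_complete (u_ : nat -> L2vec) :
  (forall n, dot (u_ n.+1 - u_ n) (u_ n.+1 - u_ n) <= 4^-1 ^+ n) ->
  exists (u : L2vec) (K : R), forall n, dot (u_ n - u) (u_ n - u) <= K * 4^-1 ^+ n.
Proof.
move=> hu.
have [n|n|r ri hr] := @riesz_fischer _ RT R leb (fun n => re (u_ n)).
- exact: L2re.
- apply: le_trans (hu n); rewrite dotE.
  have -> : re (u_ n.+1 - u_ n) = fun t => re (u_ n.+1) t - re (u_ n) t.
    by apply/funext => t; rewrite /re cReD cReN.
  by rewrite lerDl; apply: Rintegral_sqr_ge0.
have [n|n|i ii hi] := @riesz_fischer _ RT R leb (fun n => im (u_ n)).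
- exact: L2im.
- apply: le_trans (hu n); rewrite dotE.
  have -> : im (u_ n.+1 - u_ n) = fun t => im (u_ n.+1) t - im (u_ n) t.
    by apply/funext => t; rewrite /im cImD cImN.
  by rewrite lerDr; apply: Rintegral_sqr_ge0.
have Lu : L2 setT (fun t => r t +i* i t) by apply/L2P; split.
exists (to_L2 Lu), 8 => n; rewrite dotE.
have -> : (8 : R) * 4^-1 ^+ n = 4 * 4^-1 ^+ n + 4 * 4^-1 ^+ n by ring.
have -> : re (u_ n - to_L2 Lu) = fun t => re (u_ n) t - r t.
  by apply/funext => t; rewrite /re cReD cReN.
have -> : im (u_ n - to_L2 Lu) = fun t => im (u_ n) t - i t.
  by apply/funext => t; rewrite /im cImD cImN.
exact: lerD.
Qed.

Lemma sqnormE (u : L2vec) : sqnorm setT u = (dot u u)%:E.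
Proof.
have [ur ui] := (L2re u, L2im u).
rewrite dotE -RintegralD//; [|exact: (proj2 ur)|exact: (proj2 ui)].
by rewrite -rintegrable_fin//; apply: rintegrableD; [exact: (proj2 ur)|exact: (proj2 ui)].
Qed.

Lemma eqL2E (u v : L2vec) : eqL2 setT u v <-> dot (u - v) (u - v) = 0.
Proof.
rewrite dotE; have r0 := Rintegral_sqr_ge0 leb (re (u - v)).
have i0 := Rintegral_sqr_ge0 leb (im (u - v)).
split=> [uv|uv].
  have h : {ae leb, forall t : RT, re (u - v) t = 0} /\
      {ae leb, forall t : RT, im (u - v) t = 0}.
    by split; apply: filterS uv => t /(_ Logic.I); rewrite /re /im L2funB => ->;
      rewrite subrr.
  have [/(square_integral0 (L2re _))-> /(square_integral0 (L2im _))->] := h.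
  by rewrite addr0.
move/eqP: uv; rewrite paddr_eq0// => /andP[/eqP hr /eqP hi].
move: hr hi => /(square_integral0 (L2re _)) hr /(square_integral0 (L2im _)) hi.
apply: filterS2 hr hi => t; rewrite /re /im L2funB cReD cImD cReN cImN => /eqP + /eqP + _.
by rewrite !subr_eq0 => /eqP e1 /eqP e2; apply: complexP.
Qed.

(** The imaginary part of the complex scalar product is its real part at
    [- i u]. *)
Lemma innerE (u v : L2vec) :
  inner setT u v = dot u v +i* dot ((0 +i* -1) *: u) v.
Proof.
have [ur ui] := (L2re u, L2im u); have [vr vi] := (L2re v, L2im v).
rewrite dot_complex mul0r add0r mulN1r opprB.
apply: complexP; rewrite /= /inner /cintegral /=.
- rewrite /dot -RintegralD//; try exact: I.
  by apply: eq_Rintegral => t _; rewrite /re cReM /re /im; case: (v t) => ? ? /=; ring.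
- rewrite -RintegralB//; try exact: I.
  by apply: eq_Rintegral => t _; rewrite /im cImM /re /im; case: (v t) => ? ? /=; ring.
Qed.

End L2space.

(** * The operator on the Hilbert space *)

Section real_operator.
Variables (R : realType) (Gamma : set R).
Local Notation RT := (measurableTypeR R).
Variables (mu : {finite_measure set RT -> \bar R}) (beta : RT -> R) (a : R).
Hypothesis betai : mu.-integrable Gamma (EFin \o beta).
Hypothesis Gamma_a : forall y, Gamma y -> `|y| <= a.
Hypothesis Gamma0 : {ae leb, forall x : RT, ~ Gamma x}.
Hypothesis Gamma_closed : closed Gamma.

Let b := beta \_ Gamma.
Local Notation data := (delta'_data Gamma mu b).
Local Notation rop := (real_op Gamma mu beta).

Let bi : rintegrable mu b := patch_rintegrable betai Gamma_closed.
Let b0 y : ~ Gamma y -> b y = 0. Proof. exact: patch_off. Qed.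

Lemma data_comb r psi P p2 phi Q q2 : data psi P p2 -> data phi Q q2 ->
  data (fun x => r * psi x + phi x) (fun x => r * P x + Q x)
    (fun x => r * p2 x + q2 x).
Proof.
move=> [psii Pi p2i cP dpsi] [phii Qi q2i cQ dphi].
have bP := continuous_singular_integrable bi b0 Gamma_a cP.
have bQ := continuous_singular_integrable bi b0 Gamma_a cQ.
split.
- exact (square_integrableD (square_integrableZ r psii) phii).
- exact (square_integrableD (square_integrableZ r Pi) Qi).
- exact (square_integrableD (square_integrableZ r p2i) q2i).
- by move=> x; apply: cvgD; [apply: cvgMr; exact: cP|exact: cQ].
move=> s x gs gx sx.
have mI : measurable (`]s, x[%classic : set RT) by exact: measurable_itv.
have comb (h k : RT -> R) : square_integrable leb h -> square_integrable leb k ->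
    \int[leb]_(t in `]s, x[) (r * h t + k t) =
    r * \int[leb]_(t in `]s, x[) h t + \int[leb]_(t in `]s, x[) k t.
  move=> hi ki; rewrite RintegralD//; first last.
  - exact: L2_integrable_oo.
  - exact: (L2_integrable_oo s x (square_integrableZ r hi)).
  by rewrite RintegralZl//; exact: L2_integrable_oo.
have [e1 e2] := dpsi s x gs gx sx; have [f1 f2] := dphi s x gs gx sx.
split; first by rewrite comb// -e1 -f1; ring.
rewrite comb//.
have -> : \int[mu]_(y in `]s, x[) (b y * (r * P y + Q y)) =
    r * \int[mu]_(y in `]s, x[) (b y * P y) + \int[mu]_(y in `]s, x[) (b y * Q y).
  have iP : mu.-integrable `]s, x[ (EFin \o (fun y => b y * P y)).
    by apply: integrableS bP.
  have iQ : mu.-integrable `]s, x[ (EFin \o (fun y => b y * Q y)).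
    by apply: integrableS bQ.
  rewrite -RintegralZl// -RintegralD//; last exact: (integrableZl mI r iP).
  by apply: eq_Rintegral => y _; ring.
transitivity (r * (psi x - psi s) + (phi x - phi s)); first by ring.
by rewrite e2 f2; ring.
Qed.

Lemma real_op_comb r u v u' v' : rop u v -> rop u' v' ->
  rop (fun x => r * u x + u' x) (fun x => r * v x + v' x).
Proof.
move=> [ui vi [psi [P [p2 [D upsi vp2]]]]] [ui' vi' [phi [Q [q2 [E uphi vq2]]]]].
split.
- exact (square_integrableD (square_integrableZ r ui) ui').
- exact (square_integrableD (square_integrableZ r vi) vi').
exists (fun x => r * psi x + phi x), (fun x => r * P x + Q x), (fun x => r * p2 x + q2 x).
split; first exact: data_comb.
- by apply: filterS2 upsi uphi => t -> ->.
- by apply: filterS2 vp2 vq2 => t -> ->; ring.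
Qed.

Lemma real_op_ae u v u' v' : rop u v ->
  square_integrable leb u' -> square_integrable leb v' ->
  {ae leb, forall t : RT, u t = u' t} -> {ae leb, forall t : RT, v t = v' t} ->
  rop u' v'.
Proof.
move=> [ui vi [psi [P [p2 [D upsi vp2]]]]] ui' vi' uu' vv'.
split=> //; exists psi, P, p2; split=> //.
- by apply: filterS2 upsi uu' => t -> ->.
- by apply: filterS2 vp2 vv' => t -> ->.
Qed.

(** This is why the operator is single-valued on classes of almost everywhere
    equal functions. *)
Lemma real_op_vanish u v : rop u v -> {ae leb, forall t : RT, u t = 0} ->
  {ae leb, forall t : RT, v t = 0}.
Proof.
move=> [ui vi [psi [P [p2 [D upsi vp2]]]]] u0.
have P0 t : P t = 0.
  apply: (data_vanish bi b0 Gamma_a Gamma0 Gamma_closed D (u := t - 1) (v := t + 1)).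
    by apply: filterS2 upsi u0 => y -> ->.
  by apply/andP; split; lra.
have := data_zero Gamma0 D P0; apply: filterS2 vp2 => y -> ->.
by rewrite oppr0.
Qed.

Lemma real_op_symmetric u v w z : rop u v -> rop w z ->
  \int[leb]_t (v t * w t) = \int[leb]_t (u t * z t).
Proof.
move=> [ui vi [psi [P [p2 [D upsi vp2]]]]] [wi zi [phi [Q [q2 [E uphi vq2]]]]].
have sym := data_symmetric bi b0 Gamma_a Gamma0 D E.
have [psii _ p2i _ _] := D; have [phii _ q2i _ _] := E.
have i1 := square_integrableM p2i phii; have i2 := square_integrableM psii q2i.
transitivity (\int[leb]_t (-1 * (p2 t * phi t))).
  apply: ae_eq_Rintegral.
  - exact: square_integrableM.
  - exact: rintegrableZ.
  by apply: filterS2 vp2 uphi => t -> ->; rewrite mulN1r mulNr.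
transitivity (\int[leb]_t (-1 * (psi t * q2 t))).
  by rewrite !RintegralZl//; congr (_ * _); exact: sym.
apply: ae_eq_Rintegral.
- exact: rintegrableZ.
- exact: square_integrableM.
by apply: filterS2 upsi vq2 => t -> ->; rewrite mulN1r mulrN.
Qed.

Lemma real_op_solve k psi P p2 f : square_integrable leb f -> data psi P p2 ->
  (forall x, p2 x = k ^+ 2 * psi x - f x) ->
  rop psi (fun x => f x + - k ^+ 2 * psi x).
Proof.
move=> fi D p2E; have [psii _ _ _ _] := D; split=> //.
  exact (square_integrableD fi (square_integrableZ (- k ^+ 2) psii)).
exists psi, P, p2; split=> //; first exact: aeW.
by apply: aeW => t; rewrite p2E; ring.
Qed.

End real_operator.

Section L2_operator.
Variables (R : realType) (Gamma : set R).
Local Notation RT := (measurableTypeR R).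
Variables (mu : {finite_measure set RT -> \bar R}) (beta : RT -> R) (a : R).
Hypothesis betai : mu.-integrable Gamma (EFin \o beta).
Hypothesis Gamma_a : forall y, Gamma y -> `|y| <= a.
Hypothesis Gamma0 : {ae leb, forall x : RT, ~ Gamma x}.
Hypothesis Gamma_closed : closed Gamma.

Local Notation L := (L_op Gamma mu beta).
Local Notation rop := (real_op Gamma mu beta).

Let opE := L_opE betai Gamma_a Gamma0 Gamma_closed.

Lemma L_comb (c : R[i]) u v u' v' : L u v -> L u' v' ->
  L (fun x => c * u x + u' x) (fun x => c * v x + v' x).
Proof.
move=> /opE[ur ui] /opE[ur' ui']; apply/opE; split.
- have := real_op_comb betai Gamma_a Gamma_closed (complex.Re c) ur
    (real_op_comb betai Gamma_a Gamma_closed (- complex.Im c) ui ur').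
  by congr real_op; apply/funext => x; rewrite /re /im cReD cReM; ring.
- have := real_op_comb betai Gamma_a Gamma_closed (complex.Re c) ui
    (real_op_comb betai Gamma_a Gamma_closed (complex.Im c) ur ui').
  by congr real_op; apply/funext => x; rewrite /re /im cImD cImM; ring.
Qed.

Definition L2_op (u v : L2vec R) : Prop := L u v.

Lemma L2_op_comb c (u v u' v' : L2vec R) : L2_op u v -> L2_op u' v' ->
  L2_op (c *: u + u') (c *: v + v').
Proof. exact: L_comb. Qed.

Lemma L_eq u v u' v' : L u v -> L2 setT u' -> L2 setT v' ->
  eqL2 setT u u' -> eqL2 setT v v' -> L u' v'.
Proof.
move=> /opE[ur ui] /L2P[ur' ui'] /L2P[vr' vi'] uu vv; apply/opE.
have part (f g : R -> R[i]) : eqL2 setT f g ->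
    {ae leb, forall t : RT, re f t = re g t} /\ {ae leb, forall t : RT, im f t = im g t}.
  by move=> fg; split; apply: filterS fg => t /(_ I); rewrite /re /im => ->.
have [ru iu] := part _ _ uu; have [rv iv] := part _ _ vv.
by split; [exact: real_op_ae ur _ _ ru rv|exact: real_op_ae ui _ _ iu iv].
Qed.

Lemma L2_op_eq (u v u' v' : L2vec R) : L2_op u v -> dot (u - u') (u - u') = 0 ->
  dot (v - v') (v - v') = 0 -> L2_op u' v'.
Proof.
move=> uv /eqL2E uu /eqL2E vv.
by apply: L_eq uv _ _ uu vv; exact: L2vecP.
Qed.

Lemma L2_op_vanish (u v : L2vec R) : L2_op u v -> dot u u = 0 -> dot v v = 0.
Proof.
move=> /opE[ur ui]; rewrite !dotE => /eqP.
rewrite paddr_eq0; try exact: Rintegral_sqr_ge0.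
move=> /andP[/eqP/(square_integral0 (L2re u)) r0 /eqP/(square_integral0 (L2im u)) i0].
have := real_op_vanish betai Gamma_a Gamma0 Gamma_closed ur r0.
have := real_op_vanish betai Gamma_a Gamma0 Gamma_closed ui i0.
move=> /(square_integral0 (L2im v)) -> /(square_integral0 (L2re v)) ->.
by rewrite addr0.
Qed.

Lemma L2_op_symmetric (u v w z : L2vec R) : L2_op u v -> L2_op w z -> dot v w = dot u z.
Proof.
move=> /opE[ur ui] /opE[wr wi]; congr (_ + _).
- exact: (real_op_symmetric betai Gamma_a Gamma0 Gamma_closed ur wr).
- exact: (real_op_symmetric betai Gamma_a Gamma0 Gamma_closed ui wi).
Qed.

(** Solutions for the real and the imaginary part of [f] combine into a
    solution for [f]. *)
Lemma L2_op_solve (r : R) (f : L2vec R) (u v : R -> R) :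
  square_integrable leb u -> square_integrable leb v ->
  rop u (fun x => re f x + r * u x) -> rop v (fun x => im f x + r * v x) ->
  exists2 w : L2vec R, L2_op w (f + r%:C *: w) & re w = u /\ im w = v.
Proof.
move=> ui vi ur vr.
have Lu : L2 setT (fun t => u t +i* v t) by apply/L2P; split.
exists (to_L2 Lu) => //; apply/opE; split.
- move: ur; congr real_op; apply/funext => x.
  by rewrite [in RHS]/re [RHS]cReD cReZ.
- move: vr; congr real_op; apply/funext => x.
  by rewrite [in RHS]/im [RHS]cImD cImZ.
Qed.

End L2_operator.

(** * Self-adjointness *)

Section main.
Variables (R : realType) (Gamma : set R).
Local Notation RT := (measurableTypeR R).
Variables (mu : {finite_measure set RT -> \bar R}) (beta : RT -> R) (a : R).
Hypothesis betai : mu.-integrable Gamma (EFin \o beta).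
Hypothesis Gamma_a : forall y, Gamma y -> `|y| <= a.
Hypothesis Gamma0 : {ae leb, forall x : RT, ~ Gamma x}.
Hypothesis Gamma_closed : closed Gamma.

Local Notation L := (L_op Gamma mu beta).
Local Notation rop := (real_op Gamma mu beta).
Local Notation L2_op := (L2_op Gamma mu beta).
Local Notation data := (delta'_data Gamma mu (beta \_ Gamma)).

Let opE := L_opE betai Gamma_a Gamma0 Gamma_closed.
Let bi := patch_rintegrable betai Gamma_closed.
Let b0 := @patch_off R Gamma beta.

Let AL := L2_op_comb betai Gamma_a Gamma0 Gamma_closed.
Let Aeq := L2_op_eq betai Gamma_a Gamma0 Gamma_closed.
Let Asv := L2_op_vanish betai Gamma_a Gamma0 Gamma_closed.
Let Asym := L2_op_symmetric betai Gamma_a Gamma0 Gamma_closed.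

Lemma conv_green'_sup (k : R) (f : RT -> R) (x : R) : 0 < k -> square_integrable leb f ->
  `|convol leb f (green' k) x| <= Num.sqrt ((4 * k)^-1 * \int[leb]_y (f y ^+ 2)).
Proof.
move=> k0 fi; rewrite -sqrtr_sqr; apply: ler_wsqrtr.
exact: conv_green'_bound.
Qed.

Lemma L2_op_onto : exists l0 : R, forall f : L2vec R, exists u, L2_op u (f + l0%:C *: u).
Proof.
have [k k0 solve] := solve_small bi b0.
exists (- k ^+ 2) => f.
have [psi [P [p2 [D e _]]]] := solve _ _ (L2re f) (fun x => conv_green'_sup x k0 (L2re f)).
have [phi [Q [q2 [E e' _]]]] := solve _ _ (L2im f) (fun x => conv_green'_sup x k0 (L2im f)).
have [w vw _] := L2_op_solve betai Gamma_a Gamma0 Gamma_closed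
  (let: And5 h _ _ _ _ := D in h) (let: And5 h _ _ _ _ := E in h)
  (real_op_solve (L2re f) D e) (real_op_solve (L2im f) E e').
by exists w.
Qed.

Lemma L_fun0 : L (fun=> 0) (fun=> 0).
Proof.
have [l0 onto] := L2_op_onto; have [u vu] := onto 0.
have := AL (-1) vu vu; rewrite !scaleN1r !addNr /L2_op.
by congr L_op.
Qed.

Lemma L_lift u v : L u v -> exists (u' v' : L2vec R), [/\ u = u', v = v' & L2_op u' v'].
Proof. by move=> uv; have [Lu Lv _] := uv; exists (to_L2 Lu), (to_L2 Lv). Qed.

Lemma L_linear : linear_operator setT L.
Proof.
split.
- by move=> u v [].
- exact: (L_eq betai Gamma_a Gamma0 Gamma_closed).
- move=> u v v' uv uv'; have [Lu Lv _] := uv; have [_ Lv' _] := uv'.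
  apply/(eqL2E (to_L2 Lv) (to_L2 Lv')).
  have := AL (-1) (u := to_L2 Lu) (v := to_L2 Lv') (u' := to_L2 Lu) (v' := to_L2 Lv) uv' uv.
  rewrite !scaleN1r addNr addrC => /Asv; apply.
  by have := dotR 0 (0 : L2vec R) 0; rewrite scaler0 mul0r.
- exact: L_fun0.
- exact: (L_comb betai Gamma_a Gamma0 Gamma_closed).
Qed.

(** An equality of complex scalar products amounts to two equalities for
    [dot], and the second is the first for [- i] times the vectors. *)
Lemma L_selfadjoint : selfadjoint setT L.
Proof.
have [l0 onto] := L2_op_onto.
split.
- exact: L_linear.
- move=> u e Lu e0.
  have [w [z wz] we] := domain_dense (@dotC R) (@dotDl R) (@dotR R) (@dot_ge0 R)
    (@dot_complete R) AL Asv Asym onto (to_L2 Lu) e0.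
  exists (w : R -> R[i]); first by exists z.
  by rewrite (sqnormE (to_L2 Lu - w)) lte_fin.
move=> u v; split=> [uv|[Lu Lv adj]].
  have [u1 [v1 [-> -> h]]] := L_lift uv.
  split; try exact: L2vecP.
  move=> w z wz; have [w1 [z1 [-> -> h1]]] := L_lift wz.
  rewrite !innerE (Asym h1 h); congr (_ +i* _).
  apply: Asym h; have := AL (0 +i* -1) h1 (L_fun0 : L2_op 0 0).
  by rewrite !addr0.
apply: (adjoint_sub (@dotC R) (@dotDl R) (@dotR R) Aeq Asym onto
  (u := to_L2 Lu) (v := to_L2 Lv)) => w z wz.
have := adj _ _ wz; rewrite (innerE z (to_L2 Lu)) (innerE w (to_L2 Lv)).
by case.
Qed.

End main.

(** * The [delta']-interaction *)

Section interaction.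
Variables (R : realType) (Gamma : set R).
Local Notation RT := (measurableTypeR R).
Variables (mu : {finite_measure set RT -> \bar R}) (beta : RT -> R) (a : R).
Hypothesis betai : mu.-integrable Gamma (EFin \o beta).
Hypothesis Gamma_a : forall y, Gamma y -> `|y| <= a.
Hypothesis Gamma0 : {ae leb, forall x : RT, ~ Gamma x}.
Hypothesis Gamma_closed : closed Gamma.

Local Notation L := (L_op Gamma mu beta).
Local Notation rop := (real_op Gamma mu beta).
Local Notation data := (delta'_data Gamma mu (beta \_ Gamma)).

Let opE := L_opE betai Gamma_a Gamma0 Gamma_closed.
Let bi := patch_rintegrable betai Gamma_closed.
Let b0 := @patch_off R Gamma beta.

Lemma real_op_smooth (S : set R) (f : R -> R) : compact S -> smooth_in S f ->
  (forall x, Gamma x -> (f^`() x)%classic = 0) ->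
  rop f (fun x => - ((f^`())^`() x)%classic).
Proof.
move=> cS sf f10; have D := smooth_data mu b0 cS sf f10.
have [fi _ f2i _ _] := D.
split=> //.
  have := square_integrableZ (-1) f2i.
  by congr square_integrable; apply/funext => x; rewrite mulN1r.
by exists f, (f^`())%classic, ((f^`())^`())%classic; split=> //; exact: aeW.
Qed.

Lemma real_op_cutoff (S : set R) (chi : R -> R) u v : compact S -> smooth_in S chi ->
  (forall x, Gamma x -> \forall y \near x, (chi^`() y)%classic = 0) ->
  rop u v -> exists w, rop (fun x => chi x * u x) w.
Proof.
move=> cS sc near0 [ui vi [psi [P [p2 [D upsi vp2]]]]].
have D' := cutoff_data bi b0 Gamma_a Gamma0 Gamma_closed cS sc near0 D.
have [psi'i _ p2'i _ _] := D'.
have [c chic] := smooth_in_bounded cS sc.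
exists (fun x => -1 * (chi x * p2 x + 2 * ((chi^`() x)%classic * P x) +
  ((chi^`())^`() x)%classic * psi x)); split.
- apply: (square_integrable_bounded _ chic ui).
  exact: continuous_measurable_fun (smooth_in_continuous sc).
- exact: (square_integrableZ (-1) p2'i).
eexists; eexists; eexists; split; first exact: D'.
- by apply: filterS upsi => t ->.
- by apply: aeW => t; rewrite mulN1r.
Qed.

Lemma cutoff_parts chi : cutoff Gamma chi -> exists S, [/\ compact S,
  smooth_in S (re chi), smooth_in S (im chi),
  forall x, Gamma x -> \forall y \near x, ((re chi)^`() y)%classic = 0 &
  forall x, Gamma x -> \forall y \near x, ((im chi)^`() y)%classic = 0].
Proof.
move=> [/test_function_parts[S [cS _ sr si]] /test_function_parts[S1 [cS1 S1G dr di]]].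
have near0 (f : R -> R) : smooth_in S1 f ->
    forall x, Gamma x -> \forall y \near x, f y = 0.
  move=> sf x gx.
  have : nbhs x (~` S1).
    apply: open_nbhs_nbhs; split; last by move=> /S1G.
    by apply: closed_openC; exact: compact_closed.
  by apply: filterS => y; exact: (proj2 sf).
by exists S; split=> //; [exact: near0 dr|exact: near0 di].
Qed.

Lemma L_contains_min u v : L_min Gamma u v -> L u v.
Proof.
move=> [Lu Lv [phi [/test_function_parts[S [cS SG sr si]] uphi vphi]]].
have d0 (f : R -> R) : smooth_in S f -> forall x, Gamma x -> (f^`() x)%classic = 0.
  move=> sf x gx; apply: (proj2 (smooth_in_derive cS sf)) => /SG; exact.
have h : L phi (fun x => - cderiv (cderiv phi) x).
  by apply/opE; split; [exact: real_op_smooth cS sr (d0 _ sr)|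
    exact: real_op_smooth cS si (d0 _ si)].
apply: (L_eq betai Gamma_a Gamma0 Gamma_closed h Lu Lv).
- by apply: filterS uphi => t e /e.
- by apply: filterS vphi => t e /e.
Qed.

Lemma L_cutoff_domain chi : cutoff Gamma chi -> domain L chi.
Proof.
move=> /cutoff_parts[S [cS sr si nr ni]].
exists (fun x => - cderiv (cderiv chi) x); apply/opE; split.
- by apply: real_op_smooth cS sr _ => x /nr/nbhs_singleton.
- by apply: real_op_smooth cS si _ => x /ni/nbhs_singleton.
Qed.

Lemma L_cutoff_mul u chi : domain L u -> cutoff Gamma chi ->
  domain L (fun x => chi x * u x).
Proof.
move=> [v /opE[ur ui]] /cutoff_parts[S [cS sr si nr ni]].
have [w1 h1] := real_op_cutoff cS sr nr ur; have [w2 h2] := real_op_cutoff cS si ni ui.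
have [w3 h3] := real_op_cutoff cS sr nr ui; have [w4 h4] := real_op_cutoff cS si ni ur.
have comb := real_op_comb betai Gamma_a Gamma_closed.
exists (fun x => (-1 * w2 x + w1 x) +i* (1 * w4 x + w3 x)); apply/opE; split.
- have := comb (-1) _ _ _ _ h2 h1.
  by congr real_op; apply/funext => x; rewrite [in RHS]/re cReM; ring.
- have := comb 1 _ _ _ _ h4 h3.
  by congr real_op; apply/funext => x; rewrite [in RHS]/im cImM; ring.
Qed.

Lemma L2_eq_on (D : set R) (u u' : R -> R[i]) : (forall x, D x -> u x = u' x) ->
  L2 D u -> L2 D u'.
Proof.
move=> uu [mr mi fin]; split.
- by apply: eq_measurable_fun mr => x /set_mem Dx; rewrite /re uu.
- by apply: eq_measurable_fun mi => x /set_mem Dx; rewrite /im uu.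
move: fin; congr (_ < _)%E; apply: eq_integral => x /set_mem Dx.
by rewrite /re /im uu.
Qed.

(** Splitting at [x0] would make the restriction to the right half-line of
    every vector of the domain belong to the domain. *)
Lemma splits_restrict x0 u v : splits_at L x0 -> L u v ->
  L (fun x => if x0 < x then u x else 0) (fun x => if x0 < x then v x else 0).
Proof.
move=> [A1 [A2 [[[_ eq1 _ A10 _] _ _] [[L2A2 eq2 _ _ _] _ _] LE]]].
move=> /LE[_ A2uv]; apply/LE.
have ml : measurable (`]-oo, x0[%classic : set RT) by exact: measurable_itv.
have mr : measurable (`]x0, +oo[%classic : set RT) by exact: measurable_itv.
have [Lu Lv] := L2A2 _ _ A2uv.
have z0 : L2 `]-oo, x0[ (fun=> 0 : R[i]).
  apply/L2_parts => //; split; apply: square_integrable_part => //;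
    exact: square_integrable0.
have lt0 (w : R -> R[i]) x : `]-oo, x0[%classic x -> 0 = if x0 < x then w x else 0.
  by rewrite /= in_itv/= => /ltW; rewrite leNgt => /negbTE->.
have gt0 (w : R -> R[i]) x : `]x0, +oo[%classic x -> w x = if x0 < x then w x else 0.
  by rewrite /= in_itv/= andbT => ->.
split.
- apply: eq1 A10 _ _ _ _; try exact: L2_eq_on (lt0 _) z0.
  + by apply: aeW => x; exact: lt0.
  + by apply: aeW => x; exact: lt0.
- apply: eq2 A2uv _ _ _ _; [exact: L2_eq_on (gt0 _) Lu|exact: L2_eq_on (gt0 _) Lv| |].
  + by apply: aeW => x; exact: gt0.
  + by apply: aeW => x; exact: gt0.
Qed.

Lemma continuous_eq0 (h : R -> R) (x : R) : continuous h ->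
  (forall e, 0 < e -> exists2 t, `|x - t| < e & h t = 0) -> h x = 0.
Proof.
move=> ch hx; apply/eqP/contraT => hx0.
have /cvgrPdist_lt/(_ `|h x|) := ch x.
rewrite normr_gt0 => /(_ hx0)/nbhs_ballP[e /= e0 he].
have [t te ht] := hx e e0.
by have := he _ te; rewrite /= ht subr0 ltxx.
Qed.

(** At [x0] the free term [convol leb f (green' k)] attains its maximum
    [(4 * k)^-1], while [P] differs from it by at most half of that bound. *)
Lemma no_splitting x0 : Gamma x0 -> ~ splits_at L x0.
Proof.
move=> gx0 split0.
have [k k0 solve] := solve_small bi b0.
have [fi e] := green'_sqr_square_integrable k0 x0.
pose f y := green' k (x0 - y).
have k4 : 0 < (4 * k)^-1 by rewrite invr_gt0 mulr_gt0.
have fb x : `|convol leb f (green' k) x| <= (4 * k)^-1.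
  rewrite -(@ler_pXn2r _ 2%N) ?nnegrE ?(ltW k4)//.
  rewrite real_normK ?num_real// (le_trans (conv_green'_bound k0 x fi))//.
  by rewrite e expr2.
have [psi [P [p2 [D p2E Pb]]]] := solve _ _ fi fb.
have cf : convol leb f (green' k) x0 = (4 * k)^-1.
  by rewrite -e; apply: eq_Rintegral => y _; rewrite expr2.
have Px0 : P x0 != 0.
  have := Pb x0; rewrite cf; apply: contraTneq => ->.
  rewrite sub0r normrN gtr0_norm//; rewrite -ltNge; lra.
have h : rop psi (fun x => f x + - k ^+ 2 * psi x) := real_op_solve fi D p2E.
have h0 : rop (fun=> 0) (fun=> 0).
  have [_ +] := proj1 (opE _ _) (L_fun0 betai Gamma_a Gamma0 Gamma_closed).
  by [].
have LL : L (fun x => (psi x)%:C) (fun x => (f x + - k ^+ 2 * psi x)%:C).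
  by apply/opE; split.
have /opE[[_ _ [phi [Q [q2 [E uphi _]]]]] _] := splits_restrict split0 LL.
have cP := let: And5 _ _ _ h _ := D in h.
have cQ := let: And5 _ _ _ h _ := E in h.
have Q0 : Q x0 = 0.
  apply: continuous_eq0 cQ _ => eps eps0; exists (x0 - eps / 2).
    by rewrite gtr0_norm; lra.
  apply: (data_vanish bi b0 Gamma_a Gamma0 Gamma_closed E
    (u := x0 - eps) (v := x0)); last by apply/andP; split; lra.
  apply: filterS uphi => t <- /andP[_ tx0].
  by rewrite /re ltNge (ltW tx0).
have PQ : P x0 = Q x0.
  have DE := data_comb betai Gamma_a Gamma_closed (-1) D E.
  suff : -1 * P x0 + Q x0 = 0 by lra.
  have cPQ := let: And5 _ _ _ h _ := DE in h.
  apply: (continuous_eq0 cPQ) => eps eps0; exists (x0 + eps / 2).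
    by rewrite ltr0_norm; lra.
  apply: (data_vanish bi b0 Gamma_a Gamma0 Gamma_closed DE
    (u := x0) (v := x0 + eps)); last by apply/andP; split; lra.
  apply: filterS uphi => t <- /andP[tx0 _].
  by rewrite /re tx0/=; ring.
by move: Px0; rewrite PQ Q0 eqxx.
Qed.

Lemma L_delta'_interaction : delta'_interaction Gamma L.
Proof.
split; [split| | |].
- exact: (L_selfadjoint betai Gamma_a Gamma0 Gamma_closed).
- exact: L_contains_min.
- exact: L_cutoff_mul.
- exact: no_splitting.
- exact: L_cutoff_domain.
Qed.

End interaction.

(** * The negative spectrum *)

Section spectrum.
Variables (R : realType) (Gamma : set R).
Local Notation RT := (measurableTypeR R).
Variables (mu : {finite_measure set RT -> \bar R}) (beta : RT -> R) (a : R).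
Hypothesis betai : mu.-integrable Gamma (EFin \o beta).
Hypothesis Gamma_a : forall y, Gamma y -> `|y| <= a.
Hypothesis Gamma0 : {ae leb, forall x : RT, ~ Gamma x}.
Hypothesis Gamma_closed : closed Gamma.

Local Notation L := (L_op Gamma mu beta).
Local Notation L2_op := (L2_op Gamma mu beta).

Let bi := patch_rintegrable betai Gamma_closed.
Let b0 := @patch_off R Gamma beta.

Let AL := L2_op_comb betai Gamma_a Gamma0 Gamma_closed.
Let Aeq := L2_op_eq betai Gamma_a Gamma0 Gamma_closed.
Let Asv := L2_op_vanish betai Gamma_a Gamma0 Gamma_closed.
Let Asym := L2_op_symmetric betai Gamma_a Gamma0 Gamma_closed.
Let Aonto := L2_op_onto betai Gamma_a Gamma0 Gamma_closed.

Lemma resolvent_setP z : in_resolvent (@dot R) L2_op z -> resolvent_set setT L z.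
Proof.
move=> [sur [c bnd]]; split.
- move=> f Lf; have [u vu] := sur (to_L2 Lf).
  exists (u : R -> R[i]), (to_L2 Lf + z *: u : L2vec R); split; first exact: vu.
  by apply: aeW => x _ /=; rewrite addrK.
exists c => u v uv; have [u1 [v1 [-> -> h]]] := L_lift uv.
by rewrite (sqnormE u1) (sqnormE (v1 - z *: u1)) -EFinM lee_fin; exact: bnd.
Qed.

Section functional.
Variables (k : R) (w : RT -> R).
Hypothesis k0 : 0 < k.
Hypothesis wi : rintegrable mu w.

(** The functional which has to vanish for the equation with right-hand side
    [f] to be solvable. *)
Definition defect (f : R -> R) : R :=
  \int[mu]_y (w y * convol leb f (green' k) y).

Lemma defect_integrable f : square_integrable leb f ->
  rintegrable mu (fun y => w y * convol leb f (green' k) y).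
Proof.
move=> fi; apply: (bounded_mul_integrable wi _ (fun y => conv_green'_sup y k0 fi)).
exact: (measurable_conv k0 (proj1 fi) (L2_density_integrable k0 fi)
    (measurable_green' k) (norm_green'_le k)).
Qed.

Lemma defect_comb r f g : square_integrable leb f -> square_integrable leb g ->
  defect (fun x => r * f x + g x) = r * defect f + defect g.
Proof.
move=> fi gi; have df := defect_integrable fi; have dg := defect_integrable gi.
rewrite /defect -RintegralZl// -RintegralD//; last exact: rintegrableZ.
apply: eq_Rintegral => y _.
have [si _] := green'_sqr_square_integrable k0 y.
rewrite [LHS](_ : _ = w y * (r * convol leb f (green' k) y + convol leb g (green' k) y)).
  by ring.
congr (_ * _); rewrite /convol.
have i1 := square_integrableM si fi; have i2 := square_integrableM si gi.
rewrite -RintegralZl// -RintegralD//; last exact: rintegrableZ.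
by apply: eq_Rintegral => x _; ring.
Qed.

Lemma defect_bound f : square_integrable leb f ->
  `|defect f| <= \int[mu]_y `|w y| * Num.sqrt ((4 * k)^-1 * \int[leb]_y (f y ^+ 2)).
Proof.
move=> fi; have df := defect_integrable fi; have nw := rintegrable_norm wi.
set s := Num.sqrt _.
have -> : \int[mu]_y `|w y| * s = \int[mu]_y (s * `|w y|).
  by rewrite RintegralZl// mulrC.
apply: le_norm_Rintegral => //; first exact: rintegrableZ.
move=> y; rewrite normrM mulrC ler_wpM2r//; exact: conv_green'_sup.
Qed.

Definition cdefect (f : L2vec R) : R[i] := defect (re f) +i* defect (im f).

Lemma cdefect_comb c (u v : L2vec R) : cdefect (c *: u + v) = c * cdefect u + cdefect v.
Proof.
have [ur ui] := (L2re u, L2im u); have [vr vi] := (L2re v, L2im v).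
have s (r : R) (f g : RT -> R) (fi : square_integrable leb f) (gi : square_integrable leb g) :
    square_integrable leb (fun x => r * f x + g x).
  exact (square_integrableD (square_integrableZ r fi) gi).
apply: complexP; rewrite /= ?cReD ?cImD ?cReM ?cImM/=.
- transitivity (defect (fun x => complex.Re c * re u x +
      (- complex.Im c * im u x + re v x))).
    by congr defect; apply/funext => x; rewrite [LHS]cReD cReM /re /im; ring.
  by rewrite !defect_comb//; [ring|exact: s].
- transitivity (defect (fun x => complex.Re c * im u x +
      (complex.Im c * re u x + im v x))).
    by congr defect; apply/funext => x; rewrite [LHS]cImD cImM /re /im; ring.
  by rewrite !defect_comb//; [ring|exact: s].
Qed.

Lemma cdefect_bound (u : L2vec R) : cabs (cdefect u) <=
  (2 * (\int[mu]_y `|w y| * Num.sqrt (4 * k)^-1)) * Num.sqrt (dot u u).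
Proof.
have k4 : 0 <= (4 * k)^-1 by rewrite invr_ge0 mulr_ge0// ltW.
have W0 : 0 <= \int[mu]_y `|w y| by apply: Rintegral_ge0.
have part (f : RT -> R) : square_integrable leb f ->
    \int[leb]_y (f y ^+ 2) <= dot u u ->
    `|defect f| <= (\int[mu]_y `|w y| * Num.sqrt (4 * k)^-1) * Num.sqrt (dot u u).
  move=> fi fu; rewrite (le_trans (defect_bound fi))// -mulrA ler_wpM2l//.
  by rewrite -sqrtrM// ler_wsqrtr// ler_wpM2l.
have hr : `|defect (re u)| <= (\int[mu]_y `|w y| * Num.sqrt (4 * k)^-1) * Num.sqrt (dot u u).
  by apply: part; [exact: L2re|rewrite dotE lerDl Rintegral_sqr_ge0].
have hi : `|defect (im u)| <= (\int[mu]_y `|w y| * Num.sqrt (4 * k)^-1) * Num.sqrt (dot u u).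
  by apply: part; [exact: L2im|rewrite dotE lerDr Rintegral_sqr_ge0].
have sqr_normD (x y : R) : x ^+ 2 + y ^+ 2 <= (`|x| + `|y|) ^+ 2.
  rewrite sqrrD !real_normK ?num_real//.
  by have := mulr_ge0 (normr_ge0 x) (normr_ge0 y); lra.
rewrite mulr_natl mulr2n mulrDl (le_trans _ (lerD hr hi))//.
rewrite -(@ler_pXn2r _ 2%N) ?nnegrE ?cabs_ge0 ?addr_ge0//.
rewrite cabs_sqr; exact: sqr_normD.
Qed.

End functional.

(** Below zero the range of the operator minus a real number has codimension
    at most one. *)
Lemma negative_defect l : l < 0 -> exists (ell : L2vec R -> R[i]) (M C : R), [/\
  forall c u v, ell (c *: u + v) = c * ell u + ell v,
  forall u, cabs (ell u) <= M * Num.sqrt (dot u u) &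
  forall f, ell f = 0 -> exists2 u, L2_op u (f + l%:C *: u) &
    Num.sqrt (dot u u) <= C * Num.sqrt (dot f f)].
Proof.
move=> l0; pose k := Num.sqrt (- l).
have k0 : 0 < k by rewrite sqrtr_gt0 oppr_gt0.
have kl : - k ^+ 2 = l by rewrite sqr_sqrtr ?opprK// oppr_ge0 ltW.
have [w [C [wi solve]]] := solve_ker bi b0 Gamma_a k0.
exists (cdefect k w), (2 * (\int[mu]_y `|w y| * Num.sqrt (4 * k)^-1)).
exists (Num.sqrt (Num.max C 0)); split.
- exact: cdefect_comb.
- exact: cdefect_bound.
move=> f [] /(solve _ (L2re f))[psi [P [p2 [D e le1]]]].
move=> /(solve _ (L2im f))[phi [Q [q2 [E e' le2]]]].
have [u vu [ur ui]] := L2_op_solve betai Gamma_a Gamma0 Gamma_closed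
  (let: And5 h _ _ _ _ := D in h) (let: And5 h _ _ _ _ := E in h)
  (real_op_solve (L2re f) D e) (real_op_solve (L2im f) E e').
exists u; first by rewrite -kl.
rewrite -sqrtrM ?le_max ?lexx ?orbT//; apply: ler_wsqrtr.
rewrite !dotE ur ui mulrDr; apply: lerD.
- by rewrite (le_trans le1)// ler_wpM2r ?Rintegral_sqr_ge0// le_max lexx.
- by rewrite (le_trans le2)// ler_wpM2r ?Rintegral_sqr_ge0// le_max lexx.
Qed.

Lemma L_discrete : discrete_negative_spectrum setT L.
Proof.
move=> l l0 sl; have [ell [M [C [ellL ellB ellS]]]] := negative_defect l0.
have [r0 onto] := Aonto.
have [e ve e0] : exists2 e, L2_op e (l%:C *: e) & dot e e != 0.
  apply: contrapT => noe; apply: sl; apply: resolvent_setP.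
  apply: (regular_value (@dotC R) (@dotDl R) (@dotJ R) (@dotR R) (@dot_ge0 R)
    (@dot_complete R) AL Aeq Asym onto ellL ellB ellS).
  move=> e ve; apply/eqP/contraT => e0; exfalso; apply: noe; by exists e.
split.
- split=> //.
  have [eps eps0 iso] := isolated_eigenvalue (@dotC R) (@dotDl R) (@dotJ R) (@dotR R)
    (@dot_ge0 R) (@dot_complete R) AL Aeq Asym onto ellL ellB ellS ve e0.
  exists eps => // z sz zl; apply/eqP/contraT => znl; exfalso.
  apply: sz; apply: resolvent_setP; apply: iso => //.
  by move: zl; rewrite normc_def ltcR.
- exists (e : R -> R[i]); split; first exact: ve.
  by move=> /(eqL2E e 0); rewrite subr0; apply/eqP.
- exists 1%N, (fun _ => e : R -> R[i]) => u [Lu _].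
  have [u1 [v1 [uE vE h]]] := L_lift Lu.
  have hu : L2_op u1 (l%:C *: u1).
    by move: Lu; rewrite uE.
  have [c hc] := eigenspace_dim1 (@dotC R) (@dotDl R) (@dotR R) AL Asym onto ellL ellS ve e0 hu.
  exists (fun=> c); rewrite uE.
  have /(eqL2E u1 (c *: e)) := hc.
  by apply: filterS => x h' /h'; rewrite big_ord1.
Qed.

End spectrum.

Theorem theorem2 (R : realType) (Gamma : set R)
    (mu : {finite_measure set (measurableTypeR R) -> \bar R})
    (beta : R -> R) :
  bounded_set Gamma -> closed Gamma ->
  lebesgue_measure Gamma = 0%E ->
  regular_measure mu -> msupport mu = Gamma ->
  mu.-integrable Gamma (EFin \o beta) ->
  [/\ selfadjoint setT (L_op Gamma mu beta),
      delta'_interaction Gamma (L_op Gamma mu beta) &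
      discrete_negative_spectrum setT (L_op Gamma mu beta)].
Proof.
move=> [M [_ bM]] cG G0 _ _ betai.
have Gamma_a y : Gamma y -> `|y| <= M + 1 by apply: bM; rewrite ltrDl.
have Gamma0 : {ae leb, forall x : measurableTypeR R, ~ Gamma x}.
  apply/negligibleP; first by rewrite setCK; exact: closed_measurable.
  by rewrite setCK.
split.
- exact: (L_selfadjoint betai Gamma_a Gamma0 cG).
- exact: (L_delta'_interaction betai Gamma_a Gamma0 cG).
- exact: (L_discrete betai Gamma_a Gamma0 cG).
Qed.
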